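(* Suppose assumptions (H1)-(H3) listed in the context hold. Let $u^*=\{u_k^*:k=0,\ldots,N-1\}\in\mathcal{U}$, with corresponding state process $\{X_k^*:k=0,\ldots,N\}$, and $P^*\in\mathcal{P}^*$ satisfy $$H_u(k,X_k^*,u_k^*,P_k,Q_k)(u-u_k^* )\ge0,\quad P^*\text{-a.s.},\quad\forall u\in U_k,\ k=0,\ldots,N-1,$$ where $\{(P_k,Q_k):k=0,\ldots,N-1\}$ is the solution of the adjoint equation under $P^*$ (given in the context). Assume that $H(k,\cdot,\cdot,p,q)$ is convex with respect to $(x,u)$ for each $k\le N-1$ (and all $p\in\mathbb{R}^n$, $q\in\mathbb{R}^{n\times d}$) and that $\varphi$ is convex with respect to $x$. Then $u^*$ is an optimal control.
   Context: Noise. Let $\Omega$ be a sample space, $N$ a positive integer, $W_k=(W_k^1,\ldots,W_k^d)^T:\Omega\to\mathbb{R}^d$, $k=1,\ldots,N$, given functions, $W=(W_1,\ldots,W_N)$, $\mathcal{F}_k=\sigma\{W_1,\ldots,W_k\}$, $\mathcal{F}_0=\{\emptyset,\Omega\}$. $C_{b,Lip}$ denotes bounded Lipschitz functions and $Lip(\mathcal{F}_k)=\{\phi(W_1,\ldots,W_k):\phi\in C_{b,Lip}(\mathbb{R}^{d\times k})\}$. Let $\{F_\theta:\theta\in\Theta\}$ be a family of probability measures on $\mathbb{R}^d$. Define $\hat{\mathbb{E}}[\varphi(W_k)]=\sup_{\theta\in\Theta}\int\varphi\,dF_\theta$ for $\varphi\in C_{b,Lip}(\mathbb{R}^d)$,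 and for $\phi\in C_{b,Lip}(\mathbb{R}^{d\times N})$ set $\phi_N=\phi$, $\phi_k(x_1,\ldots,x_k)=\hat{\mathbb{E}}[\phi_{k+1}(x_1,\ldots,x_k,W_{k+1})]$ for $k=N-1,\ldots,1$, and $\hat{\mathbb{E}}[\phi(W_1,\ldots,W_N)]=\hat{\mathbb{E}}[\phi_1(W_1)]$. Standing assumptions: (A1) $W(\Omega)=A_1\times\cdots\times A_N$ with $A_k=W_k(\Omega)$ and $F_\theta(\bar A_k)=1$ for all $\theta,k$ ($\bar A_k$ the closure of $A_k$); (A2) $\sup_\theta\int|x|F_\theta(dx)<\infty$; (A3) for each $Q\in\mathcal{A}$ there is a probability measure $P$ on $(\Omega,\mathcal{F}_N)$ with $Q=P\circ W^{-1}$, where $\mathcal{A}$ is the set of probability measures $Q$ on $\mathbb{R}^{d\times N}$ with $E_Q[\phi]\le\hat{\mathbb{E}}[\phi(W)]$ for all $\phi\in C_{b,Lip}(\mathbb{R}^{d\times N})$. Let $\mathcal{P}$ be the set of probability measures $P$ on $(\Omega,\mathcal{F}_N)$ with $E_P[\phi(W)]\le\hat{\mathbb{E}}[\phi(W)]$ for all $\phi\in C_{b,Lip}(\mathbb{R}^{d\times N})$. A set $B\in\mathcal{F}_N$ is polar if $\sup_{P\in\mathcal{P}}P(B)=0$; random variables equal outside a polar set are identified. $\hat{\mathbb{E}}$ is extended by $\hat{\mathbb{E}}[X]=\sup_{P\in\mathcal{P}}E_P[X]$ to all $\mathcal{F}_N$-measurable $X$ with $\sup_{P\in\mathcal{P}}E_P[|X|]<\infty$.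 $L_c^p(\mathcal{F}_k)$ is the completion of $Lip(\mathcal{F}_k)$ under $\|X\|_p=(\hat{\mathbb{E}}[|X|^p])^{1/p}$ (a closed subspace of the $\mathcal{F}_k$-measurable $X$ with $\hat{\mathbb{E}}[|X|^p]<\infty$), and $L_c^p(\mathcal{F}_0)=\mathbb{R}$. For vector-valued $Z$, ''$|Z|\in L_c^2(\mathcal{F}_k)$'' means that all components of $Z$ lie in $L_c^2(\mathcal{F}_k)$. Standing assumption: $|W_k|\in L_c^2(\mathcal{F}_k)$ for $k=1,\ldots,N$. Control problem. $U_k\subset\mathbb{R}^m$, $k=0,\ldots,N-1$, are nonempty convex sets; $\mathcal{U}$ is the set of admissible controls $u=\{u_k\}_{k=0}^{N-1}$ with $u_k:\Omega\to U_k$ and $|u_k|\in L_c^2(\mathcal{F}_k)$. The coefficients are $b(k,\cdot),\sigma^l(k,\cdot):\mathbb{R}^n\times U_k\times\Omega\to\mathbb{R}^n$, $f(k,\cdot):\mathbb{R}^n\times U_k\times\Omega\to\mathbb{R}$, $\varphi:\mathbb{R}^n\times\Omega\to\mathbb{R}$ ($l=1,\ldots,d$, $k=0,\ldots,N-1$), with $b,\sigma^l,f$ differentiable in $(x,u)$ and $\varphi$ differentiable in $x$; the argument $\omega$ is suppressed. The state process of $u\in\mathcal{U}$ is the solution of $X_{k+1}=b(k,X_k,u_k)+\sum_{l=1}^d\sigma^l(k,X_k,u_k)W_{k+1}^l$, $X_0=x_0\in\mathbb{R}^n$, $k=0,\ldots,N-1$, and the cost is $J(u)=\hat{\mathbb{E}}[\sum_{k=0}^{N-1}f(k,X_k,u_k)+\varphi(X_N)]$.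 A control $u^*\in\mathcal{U}$ is optimal if it minimizes $J$ over $\mathcal{U}$. (H1) $|b(k,x,u)|,|\sigma^l(k,x,u)|\in L_c^2(\mathcal{F}_k)$, $f(k,x,u)\in L_c^1(\mathcal{F}_k)$, $\varphi(x)\in L_c^1(\mathcal{F}_N)$ for all $x\in\mathbb{R}^n$, $u\in U_k$, $l$, $k$. (H2) There is $L>0$ with $|b_x(k,x,u)|+|b_u(k,x,u)|+|\sigma^l_x(k,x,u)|+|\sigma^l_u(k,x,u)|\le L$ and $|f_x(k,x,u)|+|f_u(k,x,u)|+|\varphi_x(x)|\le L(1+|x|+|u|)$ for all $x\in\mathbb{R}^n$, $u\in U_k$, $l$, $k$. (H3) For each $\alpha>0$ there is a modulus of continuity $\omega_\alpha:[0,\infty)\to[0,\infty)$ (nondecreasing, $\omega_\alpha(r)\to\omega_\alpha(0)=0$ as $r\downarrow0$) such that for all $x,x'\in\mathbb{R}^n$ with $|x|,|x'|\le\alpha$ and $u,u'\in U_k$ with $|u|,|u'|\le\alpha$, $|\phi(k,x,u)-\phi(k,x',u')|+|\varphi_x(x)-\varphi_x(x')|\le\omega_\alpha(|x-x'|+|u-u'|)$, where $\phi(k,\cdot,\cdot)$ is the derivative in $(x,u)$ of any of $b(k,\cdot,\cdot)$, $\sigma^l(k,\cdot,\cdot)$, $f(k,\cdot,\cdot)$. Notation. $b_x$ is the Jacobian matrix $(\partial b_i/\partial x_j)$, similarly $b_u,\sigma_x^l,\sigma_u^l$; $f_x,f_u,\varphi_x$ are row vectors. Write $b_x(k)=b_x(k,X_k^*,u_k^*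 )$ and similarly $\sigma_x^l(k),f_x(k)$. For the given $u^*$ with state process $X^*$, $\mathcal{P}^*=\{P\in\mathcal{P}:E_P[\sum_{k=0}^{N-1}f(k,X_k^*,u_k^* )+\varphi(X_N^* )]=\hat{\mathbb{E}}[\sum_{k=0}^{N-1}f(k,X_k^*,u_k^* )+\varphi(X_N^* )]\}$. Adjoint equation under $P^*$, with unknowns $P_k:\Omega\to\mathbb{R}^n$ and $Q_k=[Q_k^1,\ldots,Q_k^d]:\Omega\to\mathbb{R}^{n\times d}$ (equalities $P^*$-a.s.): $$P_{N-1}=E_{P^*}[\varphi_x^T(X_N^* )|\mathcal{F}_{N-1}],\qquad Q_{N-1}=E_{P^*}[\varphi_x^T(X_N^* )W_N^T|\mathcal{F}_{N-1}],$$ and for $k=N-2,\ldots,0$, $$P_k=E_{P^*}\Big[b_x^T(k+1)P_{k+1}+\sum_{l=1}^d(\sigma_x^l(k+1))^TQ_{k+1}^l+f_x^T(k+1)\Big|\mathcal{F}_k\Big],$$ $$Q_k=E_{P^*}\Big[\Big(b_x^T(k+1)P_{k+1}+\sum_{l=1}^d(\sigma_x^l(k+1))^TQ_{k+1}^l+f_x^T(k+1)\Big)W_{k+1}^T\Big|\mathcal{F}_k\Big].$$ Hamiltonian. For $k=0,\ldots,N-1$, $x\in\mathbb{R}^n$, $u\in U_k$, $p\in\mathbb{R}^n$, $q=[q^1,\ldots,q^d]\in\mathbb{R}^{n\times d}$: $H(k,x,u,p,q)=p^Tb(k,x,u)+\sum_{l=1}^d(q^l)^T\sigma^l(k,x,u)+f(k,x,u)$,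 so that $H_u(k,x,u,p,q)=p^Tb_u(k,x,u)+\sum_{l=1}^d(q^l)^T\sigma_u^l(k,x,u)+f_u(k,x,u)$ (a row vector). *)

(* Defs.v *)
From HB Require Import structures.
From mathcomp Require Import all_boot all_order all_algebra.
From mathcomp Require Import all_classical all_reals all_analysis.

Set Implicit Arguments.
Unset Strict Implicit.
Unset Printing Implicit Defensive.
Import Order.TTheory GRing.Theory Num.Theory.
Import numFieldNormedType.Exports.

Local Open Scope classical_set_scope.
Local Open Scope ring_scope.

(* Conventions.  Vectors are columns ['cV_d]; R^{d x k} is ['M_(d, k)], whose
   j-th column is the j-th argument in R^d.  Time-indexed families are indexed
   by [nat]; only the values at 1..N (noise), 0..N-1 (controls, b, sigma, f,
   adjoint processes) and 0..N (state) are ever used.  The measurable structure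
   of [Omega] stands for F_N; it is equated with [Fsig W N] as a hypothesis. *)

(* The library norm on matrices is the sup norm; |.| is the Euclidean
   (Frobenius) one. *)
Definition enorm (R : realType) (a c : nat) (A : 'M[R]_(a, c)) : R :=
  Num.sqrt (\sum_i \sum_j (A i j) ^+ 2).

Notation borel T := (g_sigma_algebraType (@open T)).

Definition CbLip (R : realType) (a c : nat) (phi : 'M[R]_(a, c) -> R) : Prop :=
  (exists M, forall x, `|phi x| <= M) /\
  (exists L, forall x y, `|phi x - phi y| <= L * enorm (x - y)).

Definition snoc (R : realType) (d k : nat) (x : 'M[R]_(d, k)) (y : 'cV[R]_d) :
    'M[R]_(d, k.+1) :=
  \matrix_(i, j) (if unlift ord_max j is Some j' then x i j' else y i 0).

(* Backward recursion phi_k(x_1..x_k) = sup_theta int phi_{k+1}(x_1..x_k, y)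
   F_theta(dy), run down to k = 0, where phi_0 = hatE[phi_1(W_1)]. *)
Fixpoint Ehat_lip (R : realType) (d : nat) (Theta : Type)
    (F : Theta -> probability (borel 'cV[R]_d) R) (k : nat) :
    ('M[R]_(d, k) -> R) -> R :=
  match k with
  | 0 => fun phi => phi 0
  | k'.+1 => fun phi => Ehat_lip F (fun x : 'M[R]_(d, k') =>
      sup (range (fun theta : Theta => \int[F theta]_y phi (snoc x y))))
  end.

Section Noise.
Context {R : realType} {disp : measure_display} {Omega : measurableType disp}.
Context {d : nat} {Theta : Type}.
Variables (N : nat) (F : Theta -> probability (borel 'cV[R]_d) R).
Variable W : nat -> Omega -> 'cV[R]_d.

Definition hist (k : nat) (w : Omega) : 'M[R]_(d, k) :=
  \matrix_(i, j) W j.+1 w i 0.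

Definition Fsig (k : nat) : set (set Omega) :=
  <<s [set A | exists j (B : set (borel 'cV[R]_d)),
         [/\ (1 <= j <= k)%N, measurable B & A = W j @^-1` B]] >>.

Definition measurable_Fsig (k : nat) (X : Omega -> R) : Prop :=
  forall B : set R, measurable B -> Fsig k (X @^-1` B).

Definition assumption_A1 : Prop :=
  range (hist N) =
    [set x | forall j : 'I_N, range (W j.+1) (col j x)] /\
  forall (theta : Theta) (k : nat), (1 <= k <= N)%N ->
    F theta (closure (range (W k))) = 1%E.

Definition assumption_A2 : Prop :=
  (ereal_sup (range (fun theta : Theta =>
     \int[F theta]_x (enorm (x : 'cV[R]_d))%:E)) < +oo)%E.

Definition Aset : set (probability (borel 'M[R]_(d, N)) R) :=
  [set Q : probability (borel 'M[R]_(d, N)) R | forall phi : 'M[R]_(d, N) -> R, CbLip phi ->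
     (\int[Q]_x (phi x)%:E <= (Ehat_lip F phi)%:E)%E].

Definition assumption_A3 : Prop :=
  forall Q : probability (borel 'M[R]_(d, N)) R, Aset Q ->
    exists P : probability Omega R,
      forall B : set (borel 'M[R]_(d, N)), measurable B ->
        Q B = P (hist N @^-1` B).

Definition Pset : set (probability Omega R) :=
  [set P : probability Omega R | forall phi : 'M[R]_(d, N) -> R, CbLip phi ->
     ('E_P[phi \o hist N] <= (Ehat_lip F phi)%:E)%E].

Definition polar (B : set Omega) : Prop :=
  measurable B /\ ereal_sup [set P B | P in Pset] = 0%E.

Definition eq_qs (X Y : Omega -> R) : Prop :=
  exists2 B, polar B & forall w, ~ B w -> X w = Y w.

Definition Ehat (X : Omega -> R) : \bar R :=
  ereal_sup [set ('E_P[X])%E | P in Pset].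

Definition Ehat_norm (p : nat) (X : Omega -> R) : \bar R :=
  poweR (Ehat (fun w => `|X w| ^+ p)) (p%:R^-1).

Definition Lip (k : nat) : set (Omega -> R) :=
  [set Y | exists2 phi : 'M[R]_(d, k) -> R, CbLip phi & Y = phi \o hist k].

(* L_c^p(F_k) is a space of classes modulo polar sets; membership of a random
   variable X means that X has an F_k-measurable version in the closure of
   Lip(F_k).  For k = 0 this says that X is constant outside a polar set. *)
Definition Lc (p k : nat) (X : Omega -> R) : Prop :=
  measurable_fun setT X /\
  exists X' : Omega -> R,
    [/\ measurable_Fsig k X',
        eq_qs X X',
        (Ehat (fun w => (`|X' w| ^+ p)%R) < +oo)%E &
        forall e : R, 0 < e ->
          exists2 Y, Lip k Y & (Ehat_norm p (fun w => (X' w - Y w)%R) < e%:E)%E].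

Definition Lc_mx (a c p k : nat) (Z : Omega -> 'M[R]_(a, c)) : Prop :=
  forall i j, Lc p k (fun w => Z w i j).

(* Y = E_P[X | F_k], P-a.s.: Y agrees P-a.s. with a version Z. *)
Definition condexp (P : probability Omega R) (k : nat) (X Y : Omega -> R) :
    Prop :=
  P.-integrable setT (EFin \o X) /\
  exists Z : Omega -> R,
    [/\ measurable_Fsig k Z,
        P.-integrable setT (EFin \o Z),
        forall A, Fsig k A ->
          (\int[P]_(w in A) (Z w)%:E = \int[P]_(w in A) (X w)%:E)%E &
        {ae P, forall w, Y w = Z w}].

Definition condexp_mx (a c : nat) (P : probability Omega R) (k : nat)
    (X Y : Omega -> 'M[R]_(a, c)) : Prop :=
  forall i j, condexp P k (fun w => X w i j) (fun w => Y w i j).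

End Noise.

Arguments hist {R disp Omega d} W k w.
Arguments Fsig {R disp Omega d} W k.

(* A is a (Frechet) derivative of g at z relative to D. *)
Definition is_jacobian (R : realType) (a c : nat) (D : set 'cV[R]_a)
    (g : 'cV[R]_a -> 'cV[R]_c) (z : 'cV[R]_a) (A : 'M[R]_(c, a)) : Prop :=
  forall e : R, 0 < e -> exists2 delta : R, 0 < delta &
    forall z', D z' -> enorm (z' - z) < delta ->
      enorm (g z' - g z - A *m (z' - z)) <= e * enorm (z' - z).

Record coefficients (R : realType) (Omega : Type) (n m d : nat) := Coefficients {
  b : nat -> 'cV[R]_n -> 'cV[R]_m -> Omega -> 'cV[R]_n;
  sigma : 'I_d -> nat -> 'cV[R]_n -> 'cV[R]_m -> Omega -> 'cV[R]_n;
  f : nat -> 'cV[R]_n -> 'cV[R]_m -> Omega -> R;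
  varphi : 'cV[R]_n -> Omega -> R
}.

Record derivatives (R : realType) (Omega : Type) (n m d : nat) := Derivatives {
  b_x : nat -> 'cV[R]_n -> 'cV[R]_m -> Omega -> 'M[R]_n;
  b_u : nat -> 'cV[R]_n -> 'cV[R]_m -> Omega -> 'M[R]_(n, m);
  sigma_x : 'I_d -> nat -> 'cV[R]_n -> 'cV[R]_m -> Omega -> 'M[R]_n;
  sigma_u : 'I_d -> nat -> 'cV[R]_n -> 'cV[R]_m -> Omega -> 'M[R]_(n, m);
  f_x : nat -> 'cV[R]_n -> 'cV[R]_m -> Omega -> 'rV[R]_n;
  f_u : nat -> 'cV[R]_n -> 'cV[R]_m -> Omega -> 'rV[R]_m;
  varphi_x : 'cV[R]_n -> Omega -> 'rV[R]_n
}.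

Section Control.
Context {R : realType} {disp : measure_display} {Omega : measurableType disp}.
Context {d n m : nat} {Theta : Type}.
Variables (N : nat) (F : Theta -> probability (borel 'cV[R]_d) R).
Variable W : nat -> Omega -> 'cV[R]_d.
Variable U : nat -> set 'cV[R]_m.
Variable C : coefficients R Omega n m d.
Variable DC : derivatives R Omega n m d.
Variable x0 : 'cV[R]_n.

(* The coefficients are functions on R^n x U_k only (their values for u outside
   U_k are never used), so differentiability in (x, u) is relative to R^n x U_k.
   When U_k has empty interior the derivative in u need not be unique, so the
   derivatives are carried as data. *)
Definition is_derivatives : Prop :=
  (forall k x u w, (k < N)%N -> U k u ->
    let D := [set z : 'cV[R]_(n + m) | U k (dsubmx z)] in
    [/\ is_jacobian D (fun z => b C k (usubmx z) (dsubmx z) w)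
          (col_mx x u) (row_mx (b_x DC k x u w) (b_u DC k x u w)),
        forall l, is_jacobian D (fun z => sigma C l k (usubmx z) (dsubmx z) w)
          (col_mx x u) (row_mx (sigma_x DC l k x u w) (sigma_u DC l k x u w)) &
        is_jacobian D (fun z => (f C k (usubmx z) (dsubmx z) w)%:M)
          (col_mx x u) (row_mx (f_x DC k x u w) (f_u DC k x u w))]) /\
  (forall x w, is_jacobian setT (fun z => (varphi C z w)%:M) x
                 (varphi_x DC x w)).

Definition assumption_H1 : Prop :=
  (forall k x u, (k < N)%N -> U k u ->
    [/\ Lc_mx N F W 2 k (b C k x u),
        forall l, Lc_mx N F W 2 k (sigma C l k x u) &
        Lc N F W 1 k (f C k x u)]) /\
  (forall x, Lc N F W 1 N (varphi C x)).

Definition assumption_H2 : Prop :=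
  exists2 L : R, 0 < L &
    forall k x u l w, (k < N)%N -> U k u ->
      enorm (b_x DC k x u w) + enorm (b_u DC k x u w) +
      enorm (sigma_x DC l k x u w) + enorm (sigma_u DC l k x u w) <= L /\
      enorm (f_x DC k x u w) + enorm (f_u DC k x u w) + enorm (varphi_x DC x w)
        <= L * (1 + enorm x + enorm u).

Definition modulus (om : R -> R) : Prop :=
  [/\ forall r, 0 <= r -> 0 <= om r,
      forall r s, 0 <= r -> r <= s -> om r <= om s,
      om 0 = 0 &
      om r @[r --> 0^'+] --> 0].

Definition assumption_H3 : Prop :=
  forall alpha : R, 0 < alpha -> exists2 om : R -> R, modulus om &
    forall k x x' u u' w, (k < N)%N -> U k u -> U k u' ->
      enorm x <= alpha -> enorm x' <= alpha ->
      enorm u <= alpha -> enorm u' <= alpha ->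
      let dphi := enorm (varphi_x DC x w - varphi_x DC x' w) in
      let bound := om (enorm (x - x') + enorm (u - u')) in
      [/\ enorm (row_mx (b_x DC k x u w) (b_u DC k x u w) -
                 row_mx (b_x DC k x' u' w) (b_u DC k x' u' w)) + dphi <= bound,
          forall l,
          enorm (row_mx (sigma_x DC l k x u w) (sigma_u DC l k x u w) -
                 row_mx (sigma_x DC l k x' u' w) (sigma_u DC l k x' u' w)) + dphi
            <= bound &
          enorm (row_mx (f_x DC k x u w) (f_u DC k x u w) -
                 row_mx (f_x DC k x' u' w) (f_u DC k x' u' w)) + dphi <= bound].

Definition admissible (u : nat -> Omega -> 'cV[R]_m) : Prop :=
  forall k, (k < N)%N -> (forall w, U k (u k w)) /\ Lc_mx N F W 2 k (u k).

Fixpoint state (u : nat -> Omega -> 'cV[R]_m) (k : nat) (w : Omega) : 'cV[R]_n :=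
  match k with
  | 0 => x0
  | k'.+1 => b C k' (state u k' w) (u k' w) w +
      \sum_(l < d) W k'.+1 w l 0 *: sigma C l k' (state u k' w) (u k' w) w
  end.

Definition total_cost (u : nat -> Omega -> 'cV[R]_m) (w : Omega) : R :=
  \sum_(k < N) f C k (state u k w) (u k w) w + varphi C (state u N w) w.

Definition J (u : nat -> Omega -> 'cV[R]_m) : \bar R :=
  Ehat N F W (total_cost u).

Definition optimal (ustar : nat -> Omega -> 'cV[R]_m) : Prop :=
  admissible ustar /\ forall u, admissible u -> (J ustar <= J u)%E.

Definition Pstar_set (ustar : nat -> Omega -> 'cV[R]_m) :
    set (probability Omega R) :=
  [set P : probability Omega R | Pset N F W P /\ ('E_P[total_cost ustar] = J ustar)%E].

(* The random variable inside the conditional expectations, at time k. *)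
Definition adjoint_driver (ustar : nat -> Omega -> 'cV[R]_m)
    (p : nat -> Omega -> 'cV[R]_n) (q : nat -> Omega -> 'M[R]_(n, d))
    (k : nat) (w : Omega) : 'cV[R]_n :=
  let x := state ustar k w in let u := ustar k w in
  (b_x DC k x u w)^T *m p k w +
  \sum_(l < d) (sigma_x DC l k x u w)^T *m col l (q k w) +
  (f_x DC k x u w)^T.

Definition adjoint_solution (P : probability Omega R)
    (ustar : nat -> Omega -> 'cV[R]_m)
    (p : nat -> Omega -> 'cV[R]_n) (q : nat -> Omega -> 'M[R]_(n, d)) : Prop :=
  let terminal w := (varphi_x DC (state ustar N w) w)^T in
  let driver := adjoint_driver ustar p q in
  [/\ condexp_mx W P N.-1 terminal (p N.-1),
      condexp_mx W P N.-1 (fun w => terminal w *m (W N w)^T) (q N.-1) &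
      forall k, (k.+1 < N)%N ->
        condexp_mx W P k (driver k.+1) (p k) /\
        condexp_mx W P k (fun w => driver k.+1 w *m (W k.+1 w)^T) (q k)].

Definition Ham (k : nat) (x : 'cV[R]_n) (u : 'cV[R]_m) (p : 'cV[R]_n)
    (q : 'M[R]_(n, d)) (w : Omega) : R :=
  (p^T *m b C k x u w + \sum_(l < d) (col l q)^T *m sigma C l k x u w) 0 0 +
  f C k x u w.

Definition Ham_u (k : nat) (x : 'cV[R]_n) (u : 'cV[R]_m) (p : 'cV[R]_n)
    (q : 'M[R]_(n, d)) (w : Omega) : 'rV[R]_m :=
  p^T *m b_u DC k x u w + \sum_(l < d) (col l q)^T *m sigma_u DC l k x u w +
  f_u DC k x u w.

End Control.

(* Main.v *)
Require Import Defs.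
From mathcomp Require Import all_boot all_order all_algebra.
From mathcomp Require Import all_classical all_reals all_analysis.
From mathcomp Require finmap.
From mathcomp Require Import measurable_realfun.
From mathcomp Require Import ring lra.

Set Implicit Arguments.
Unset Strict Implicit.
Unset Printing Implicit Defensive.
Import Order.TTheory GRing.Theory Num.Theory.
Import numFieldNormedType.Exports.
Local Open Scope classical_set_scope.
Local Open Scope ring_scope.

(** Let [P] be the model [Pstar], which attains the worst-case cost of [ustar].
    Since [J u] is a supremum over models, it is at least the [P]-expectation of
    the cost of [u], so it is enough to compare the two costs under [P] alone.

    Under [P] the comparison is the classical duality argument. Let [costate]
    be the random vector whose conditional expectations are the adjoint pair,
    and let [variation j] be its scalar product at time [j] with the difference
    of the two states. At time [k.+1] this difference is a function of the past
    plus a function of the past times the noise, so conditioning on the past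
    turns the expectation of [variation k.+1] into that of the increment of the
    [p, q]-part of the Hamiltonian at time [k]. Adding the increment of [f]
    completes the Hamiltonian; its convexity ([Ham_tangent]) bounds the total
    below by the [x]-derivative, which is [variation k], plus the
    [u]-derivative, which is nonnegative by assumption ([variational_ae]). This
    is [variation_step]. Summing over [k] and using the convexity of [varphi] at
    time [N] gives [cost_le]; the sum telescopes to [variation 0], which
    vanishes.

    All of this requires integrability. The products of past variables with the
    next noise are in L2 because the conditional second moment of the noise is
    bounded ([cond_second_moment], [noise_second_moment]). That bound has two
    sources. Independent noise of any one-step law belongs to the uncertainty set
    ([iid_law], [marginal_in_Pset]), so a second moment that is finite uniformly
    over the uncertainty set bounds the second moments of all one-step laws. And
    for a nonnegative Lipschitz function of the past times a centred test
    function of the next noise, the backward recursion is nonpositive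
    ([Ehat_lip_factor_le0]); Lipschitz functions of the past are dense among its
    events ([Fsig_lip_dense]). The adjoint processes are then in L2 by duality
    ([condexp_sqr_le]), and the coefficients along the controlled states are
    measurable by approximation with constants ([measurable_caratheodory]) and
    of controlled size by the mean value theorem. *)

(** * Matrix norms and Borel measurability entry by entry *)

Lemma enorm_ge0 (R : realType) a c (A : 'M[R]_(a, c)) : 0 <= enorm A.
Proof. exact: sqrtr_ge0. Qed.

Lemma le_entry_enorm (R : realType) a c (A : 'M[R]_(a, c)) i j :
  `|A i j| <= enorm A.
Proof.
rewrite -sqrtr_sqr ler_wsqrtr//.
rewrite (bigD1 i)//= (bigD1 j)//= -addrA lerDl addr_ge0//.
  by apply: sumr_ge0 => *; exact: sqr_ge0.
by apply: sumr_ge0 => *; apply: sumr_ge0 => *; exact: sqr_ge0.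
Qed.

(** The sum norm: unlike [enorm] it is additive in its entries, so that
    measurability and integrability pass through it entry by entry. *)
Definition sumnorm (R : realType) a c (A : 'M[R]_(a, c)) : R :=
  \sum_i \sum_j `|A i j|.

Lemma sumnorm_ge0 (R : realType) a c (A : 'M[R]_(a, c)) : 0 <= sumnorm A.
Proof. by apply: sumr_ge0 => i _; apply: sumr_ge0. Qed.

Lemma sqr_sum_le (R : realType) (I : Type) (r : seq I) (g : I -> R) :
  (forall i, 0 <= g i) -> \sum_(i <- r) (g i) ^+ 2 <= (\sum_(i <- r) g i) ^+ 2.
Proof.
move=> g0; elim: r => [|i r IH]; first by rewrite !big_nil expr0n.
rewrite !big_cons sqrrD -addrA lerD2l (le_trans IH)// lerDr.
by rewrite mulrn_wge0 // mulr_ge0 // sumr_ge0.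
Qed.

Lemma sumnorm_cV (R : realType) a (x : 'cV[R]_a) :
  sumnorm x = \sum_i `|x i 0|.
Proof. by apply: eq_bigr => i _; rewrite big_ord1. Qed.

Lemma enorm_le_sumnorm (R : realType) a c (A : 'M[R]_(a, c)) :
  enorm A <= sumnorm A.
Proof.
rewrite -(ger0_norm (sumnorm_ge0 A)) -sqrtr_sqr ler_wsqrtr//.
apply: le_trans (sqr_sum_le _ _); last by move=> i; apply: sumr_ge0.
apply: ler_sum => i _; apply: le_trans (sqr_sum_le _ _); last by [].
by apply: ler_sum => j _; rewrite real_normK ?num_real.
Qed.

Lemma sumnorm_le_enorm (R : realType) a c (A : 'M[R]_(a, c)) :
  sumnorm A <= (a * c)%:R * enorm A.
Proof.
apply: (@le_trans _ _ (\sum_(i < a) \sum_(j < c) enorm A)).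
  by apply: ler_sum => i _; apply: ler_sum => j _; exact: le_entry_enorm.
by rewrite !sumr_const !card_ord -mulrnA mulr_natl mulnC.
Qed.

Lemma enorm0 (R : realType) a c : enorm (0 : 'M[R]_(a, c)) = 0.
Proof.
rewrite /enorm big1 ?sqrtr0// => i _.
by rewrite big1// => j _; rewrite mxE expr0n.
Qed.

Lemma enormZ (R : realType) a c (t : R) (A : 'M[R]_(a, c)) :
  enorm (t *: A) = `|t| * enorm A.
Proof.
rewrite /enorm -sqrtr_sqr -sqrtrM ?sqr_ge0//; congr Num.sqrt.
rewrite mulr_sumr; apply: eq_bigr => i _; rewrite mulr_sumr.
by apply: eq_bigr => j _; rewrite mxE exprMn.
Qed.

Lemma enormB (R : realType) a c (A B : 'M[R]_(a, c)) :
  enorm (A - B) = enorm (B - A).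
Proof. by rewrite -opprB -scaleN1r enormZ normrN1 mul1r. Qed.

Lemma sumnormD (R : realType) a c (A B : 'M[R]_(a, c)) :
  sumnorm (A + B) <= sumnorm A + sumnorm B.
Proof.
rewrite -big_split ler_sum//= => i _; rewrite -big_split ler_sum//= => j _.
by rewrite mxE ler_normD.
Qed.

Lemma sumnormZ (R : realType) a c (t : R) (A : 'M[R]_(a, c)) :
  sumnorm (t *: A) = `|t| * sumnorm A.
Proof.
rewrite /sumnorm mulr_sumr; apply: eq_bigr => i _; rewrite mulr_sumr.
by apply: eq_bigr => j _; rewrite mxE normrM.
Qed.

Lemma sumnorm_col_mx (R : realType) a c (x : 'cV[R]_a) (y : 'cV[R]_c) :
  sumnorm (col_mx x y) = sumnorm x + sumnorm y.
Proof.
rewrite /sumnorm big_split_ord/=; congr (_ + _); apply: eq_bigr => i _;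
  apply: eq_bigr => j _; by rewrite ?col_mxEu ?col_mxEd.
Qed.

Lemma le_sumnorm_mulmx (R : realType) a c (A : 'M[R]_(a, c)) (x : 'cV[R]_c) i :
  `|(A *m x) i 0| <= enorm A * sumnorm x.
Proof.
rewrite mxE (le_trans (ler_norm_sum _ _ _))// mulr_sumr ler_sum// => j _.
by rewrite big_ord1 normrM ler_wpM2r// le_entry_enorm.
Qed.

Lemma rat_approx (R : realType) (a c : nat) (x : 'M[R]_(a, c)) (e : R) :
  0 < e -> exists q : 'M[rat]_(a, c), forall i j, `|x i j - ratr (q i j)| < e.
Proof.
move=> e0.
have H i j : exists q : rat, `|x i j - ratr q| < e.
  have [|q] := @rat_in_itvoo R (x i j - e) (x i j + e); first by lra.
  rewrite in_itv /= => /andP[h1 h2]; exists q.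
  by rewrite ltr_norml; apply/andP; split; lra.
pose q i j := sval (cid (H i j)).
exists (\matrix_(i, j) q i j) => i j; rewrite mxE; exact: svalP (cid (H i j)).
Qed.

(** Every set of vectors is separable: in each rational ball that meets [D],
    pick a point of [D]. *)
Lemma dense_sequence (R : realType) a (D : set 'cV[R]_a) : D !=set0 ->
  exists z : nat -> 'cV[R]_a, (forall i, D (z i)) /\
    forall x (e : R), D x -> 0 < e -> exists i, sumnorm (x - z i) < e.
Proof.
move=> [x1 Dx1].
pose K : Type := ('cV[rat]_a * nat)%type.
pose close (x : 'cV[R]_a) (s : K) :=
  forall i, `|x i 0 - ratr (s.1 i 0)| < s.2.+1%:R^-1.
pose pick (s : K) : 'cV[R]_a :=
  if pselect (exists x, D x /\ close x s) is left h then sval (cid h) else x1.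
have Dpick s : D (pick s).
  by rewrite /pick; case: pselect => [h|//]; case: (svalP (cid h)).
exists (fun i => if unpickle i is Some s then pick s else x1); split.
  by move=> i; case: unpickle.
move=> x e Dx e0.
(* Two points of one rational ball differ by at most [2 / k.+1] in each of
     the [a] entries. *)
have [k hk] : exists k : nat, (2 * a.+1)%:R / e < k.+1%:R.
  exists (Num.trunc ((2 * a.+1)%:R / e)); exact: truncnS_gt.
have [q hq] := @rat_approx R a 1 x k.+1%:R^-1 ltac:(by rewrite invr_gt0).
exists (pickle ((q, k) : K)); rewrite pickleK /pick.
case: pselect => [h|[]]; last by exists x; split => // i; exact: hq.
have [_ hc] := svalP (cid h); set y := sval (cid h) in hc *.
rewrite sumnorm_cV.
apply: (@le_lt_trans _ _ (\sum_(i < a) ((1 + 1) * k.+1%:R^-1))).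
  apply: ler_sum => i _; rewrite mulrDl !mul1r !mxE.
  rewrite -(subrKA (ratr (q i 0))) (le_trans (ler_normD _ _))//.
  by rewrite lerD// ltW// ?(hq i 0)// distrC; exact: hc.
rewrite sumr_const card_ord -[_ *+ a]mulr_natl mulrA ltr_pdivrMr//.
rewrite ltr_pdivrMr// mulrC in hk; rewrite (le_lt_trans _ hk)//.
by rewrite -[1 + 1]/(2%:R) -natrM ler_nat mulnC leq_mul2l leqnSn orbT.
Qed.

Lemma continuous_borel_measurable (R : realType) a c (g : 'M[R]_(a, c) -> R) :
  continuous g -> measurable_fun setT (g : borel 'M[R]_(a, c) -> R).
Proof.
move=> cg; apply: (measurability _ (RGenOInfty.measurableE R)).
move=> _ [_ [y ->] <-]; rewrite setTI; apply: sub_sigma_algebra.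
by apply: open_comp => // x _; exact: cg.
Qed.

Lemma entry_borel_measurable (R : realType) a c i j :
  measurable_fun setT ((fun x => x i j) : borel 'M[R]_(a, c) -> R).
Proof. apply: continuous_borel_measurable; exact: coord_continuous. Qed.

(** An open set of matrices is a countable union of rational boxes, so Borel
    measurability can be tested entry by entry. *)
Lemma measurable_fun_borel_mx (disp : measure_display) (T : measurableType disp)
    (R : realType) a c (g : T -> 'M[R]_(a, c)) :
  (forall i j, measurable_fun setT (fun t => g t i j)) ->
  measurable_fun setT (g : T -> borel 'M[R]_(a, c)).
Proof.
move=> mg; apply: (measurability (rT := borel 'M[R]_(a, c)) open).
  by [].
move=> _ [V oV <-]; rewrite setTI.
pose box (s : 'M[rat]_(a, c) * nat) : set 'M[R]_(a, c) :=
  [set y | forall i j, `|y i j - ratr (s.1 i j)| < s.2.+1%:R^-1].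
pose inV s := `[< box s `<=` V >].
have -> : g @^-1` V = \bigcup_s (if inV s then g @^-1` box s else set0).
  apply/seteqP; split => [t Vgt|t [s _]]; last first.
    by case: ifP => // /asboolP; apply.
  have /nbhs_ballP[e /= e0 he] : nbhs (g t) V by exact: open_nbhs_nbhs.
  have [k hk] : exists k : nat, 2 / e < k.+1%:R.
    exists (Num.trunc (2 / e)); exact: truncnS_gt.
  have [q hq] := @rat_approx R a c (g t) k.+1%:R^-1 ltac:(by rewrite invr_gt0).
  exists (q, k) => //.
  suff -> : inV (q, k) by exact: hq.
  apply/asboolP => y hy; apply: he; split => // i j; rewrite /ball/=.
  have hk2 : (1 + 1) * k.+1%:R^-1 < e.
    by rewrite ltr_pdivrMr// mulrC -ltr_pdivrMr.
  apply: le_lt_trans hk2; rewrite mulrDl !mul1r -(subrKA (ratr (q i j))).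
  rewrite (le_trans (ler_normD _ _))//.
  by rewrite lerD// ltW// ?(hq i j)// distrC; exact: hy.
apply: countable_bigcupT_measurable => // s.
case: ifP => // _.
have -> : g @^-1` box s = \bigcap_(ij in [set: 'I_a * 'I_c])
    ((fun t => `|g t ij.1 ij.2 - ratr (s.1 ij.1 ij.2)|) @^-1`
       [set y | y < s.2.+1%:R^-1]).
  by apply/seteqP; split => [t h [i j] _|t h i j]; [exact: h|exact: (h (i, j))].
apply: fin_bigcap_measurable => // -[i j] _ /=; rewrite -[X in measurable X]setTI.
have : measurable_fun setT (fun t => `|g t i j - ratr (s.1 i j)|).
  by apply: measurableT_comp => //; apply: measurable_funB.
apply => //.
rewrite (_ : [set y | _] = `]-oo, s.2.+1%:R^-1[%classic)//.
Qed.

(** * Bounded Lipschitz test functions *)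

Section CbLipTheory.
Variables (R : realType) (a c : nat).
Implicit Types phi psi : 'M[R]_(a, c) -> R.

(** Sums and products combine the bounds, which is sound only for nonnegative
    ones. *)
Lemma CbLipP phi : CbLip phi <-> exists M L : R,
  [/\ 0 <= M, 0 <= L, forall x, `|phi x| <= M &
      forall x y, `|phi x - phi y| <= L * enorm (x - y)].
Proof.
split=> [[[M hM] [L hL]]|[M [L [M0 L0 hM hL]]]]; last first.
  by split; [exists M|exists L].
exists `|M|, `|L|; split => // [x|x y].
  exact: le_trans (hM x) (ler_norm M).
by apply: le_trans (hL x y) _; rewrite ler_wpM2r ?ler_norm ?enorm_ge0.
Qed.

Lemma CbLip_cst (r : R) : CbLip (fun _ : 'M[R]_(a, c) => r).
Proof.
apply/CbLipP; exists `|r|, 0; split => // x y.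
by rewrite subrr normr0 mul0r.
Qed.

Lemma CbLipD phi psi : CbLip phi -> CbLip psi -> CbLip (fun x => phi x + psi x).
Proof.
move=> /CbLipP[M [L [M0 L0 hM hL]]] /CbLipP[M' [L' [M0' L0' hM' hL']]].
apply/CbLipP; exists (M + M'), (L + L'); split=> [||x|x y]; rewrite ?addr_ge0//.
  by rewrite (le_trans (ler_normD _ _))// lerD.
by rewrite opprD addrACA mulrDl (le_trans (ler_normD _ _))// lerD.
Qed.

Lemma CbLipM phi psi : CbLip phi -> CbLip psi -> CbLip (fun x => phi x * psi x).
Proof.
move=> /CbLipP[M [L [M0 L0 hM hL]]] /CbLipP[M' [L' [M0' L0' hM' hL']]].
apply/CbLipP; exists (M * M'), (M * L' + M' * L).
split=> [||x|x y]; rewrite ?addr_ge0 ?mulr_ge0//.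
  by rewrite normrM ler_pM.
have -> : phi x * psi x - phi y * psi y =
  phi x * (psi x - psi y) + psi y * (phi x - phi y) by ring.
by rewrite mulrDl (le_trans (ler_normD _ _))// !normrM -!mulrA lerD// ler_pM.
Qed.

(** The test functions that are needed explicitly are clamps and truncated
    squares of one entry. *)
Lemma CbLip_entry (h : R -> R) (M L : R) i j :
  0 <= L -> (forall s, `|h s| <= M) ->
  (forall s t, `|h s - h t| <= L * `|s - t|) ->
  CbLip (fun x : 'M[R]_(a, c) => h (x i j)).
Proof.
move=> L0 hM hL; split; first by exists M => x; exact: hM.
exists L => x y; apply: le_trans (hL _ _) _; rewrite ler_wpM2l//.
by have := le_entry_enorm (x - y) i j; rewrite !mxE.
Qed.

Lemma CbLip_continuous phi : CbLip phi -> continuous phi.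
Proof.
move=> /CbLipP[M [L [M0 L0 hM hL]]] x.
have F : Filter (nbhs x) by exact: nbhs_filter.
apply/(@cvgrPdist_lt _ _ _ _ F phi (phi x)) => e e0.
pose K := L * (a * c)%:R + 1.
have K0 : 0 < K by rewrite ltr_wpDl// mulr_ge0.
apply/nbhs_ballP; exists (e / K) => /=; first by rewrite divr_gt0.
move=> y [_ hy]; apply: le_lt_trans (hL x y) _.
apply: (@le_lt_trans _ _ (L * ((a * c)%:R * (e / K)))).
  rewrite ler_wpM2l// (le_trans (enorm_le_sumnorm _))//.
  apply: (@le_trans _ _ (\sum_(i < a) \sum_(j < c) (e / K))).
    apply: ler_sum => i _; apply: ler_sum => j _; rewrite !mxE.
    by apply: ltW; exact: hy.
  by rewrite !sumr_const !card_ord -mulrnA mulr_natl mulnC.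
by rewrite !mulrA ltr_pdivrMr// mulrC ltr_pM2l// /K ltrDl.
Qed.

Lemma CbLip_measurable phi : CbLip phi ->
  measurable_fun setT (phi : borel 'M[R]_(a, c) -> R).
Proof.
by move=> /CbLip_continuous; exact: continuous_borel_measurable.
Qed.

End CbLipTheory.

Lemma CbLip_comp (R : realType) (a c e h : nat) (g : 'M[R]_(e, h) -> 'M[R]_(a, c))
    (phi : 'M[R]_(a, c) -> R) :
  (forall x y, enorm (g x - g y) <= enorm (x - y)) ->
  CbLip phi -> CbLip (phi \o g).
Proof.
move=> hg /CbLipP[M [L [M0 L0 hM hL]]]; apply/CbLipP; exists M, L; split => //.
  by move=> x; exact: hM.
by move=> x y; apply: le_trans (hL _ _) _; rewrite ler_wpM2l.
Qed.

Lemma bounded_integrable (d : measure_display) (T : measurableType d)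
    (R : realType) (P : probability T R) (X : T -> R) (M : R) :
  measurable_fun setT X -> (forall t, `|X t| <= M) ->
  P.-integrable setT (EFin \o X).
Proof.
move=> mX hM; apply: measurable_bounded_integrable => //.
  exact: le_lt_trans (probability_le1 P measurableT) (ltry 1).
by exists M; split; rewrite ?num_real// => N MN x _; exact: le_trans (hM x) (ltW MN).
Qed.

Lemma CbLip_integrable (R : realType) a c (P : probability (borel 'M[R]_(a, c)) R)
    (phi : 'M[R]_(a, c) -> R) :
  CbLip phi -> P.-integrable setT (EFin \o phi).
Proof.
move=> h; have [[M hM] _] := h.
exact: bounded_integrable (CbLip_measurable h) hM.
Qed.

(** * Independent noise and the sublinear expectation *)

Lemma sup_le0 (R : realType) (A : set R) :
  (forall x, A x -> x <= 0) -> sup A <= 0.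
Proof.
move=> h; have [->|/set0P A0] := eqVneq A set0; first by rewrite sup0.
exact: ge_sup.
Qed.

Lemma Rintegral_le0 (d : measure_display) (T : measurableType d) (R : realType)
    (P : measure T R) (X : T -> R) :
  (forall t, X t <= 0) -> \int[P]_t X t <= 0.
Proof.
move=> h; rewrite /Rintegral -oppr_ge0 -fineN fine_ge0//.
rewrite integralE (eq_integral (cst 0%E)) ?integral0 ?sub0e ?oppeK.
  by apply: integral_ge0.
by move=> t _; rewrite (le0_funeposE (D := setT)) ?inE// => u _; rewrite lee_fin.
Qed.

Section Snoc.
Variables (R : realType) (d k : nat).
Implicit Types (x : 'M[R]_(d, k)) (y : 'cV[R]_d).

Lemma snocE x y i (j : 'I_k.+1) (h : (j < k)%N) :
  snoc x y i j = x i (Ordinal h).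
Proof.
rewrite mxE; case: unliftP => [j' ej|ej].
  congr (x i _); apply: val_inj => /=.
  by rewrite ej /= /bump leqNgt ltn_ord.
by exfalso; move: h; rewrite ej ltnn.
Qed.

Lemma snoc_widen x y i (j : 'I_k) : snoc x y i (widen_ord (leqnSn k) j) = x i j.
Proof.
by rewrite (snocE _ _ _ (ltn_ord j : widen_ord _ _ < k)%N); congr (x i _); apply: val_inj.
Qed.

Lemma snoc_max x y i : snoc x y i ord_max = y i 0.
Proof. by rewrite mxE unlift_none. Qed.

Lemma enorm_snoc x y x' y' : enorm (snoc x y - snoc x' y') ^+ 2 =
  enorm (x - x') ^+ 2 + enorm (y - y') ^+ 2.
Proof.
have E a c (A : 'M[R]_(a, c)) : enorm A ^+ 2 = \sum_i \sum_j (A i j) ^+ 2.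
  rewrite sqr_sqrtr// sumr_ge0// => i _; rewrite sumr_ge0// => j _.
  exact: sqr_ge0.
have BE a c (A B : 'M[R]_(a, c)) i j : (A - B) i j = A i j - B i j.
  by rewrite !mxE.
rewrite !E -big_split; apply: eq_bigr => i _ /=.
rewrite big_ord_recr big_ord1/= !BE !snoc_max; congr (_ + _).
by apply: eq_bigr => j _; rewrite !BE !snoc_widen.
Qed.

Lemma enorm_snocl x x' y : enorm (snoc x y - snoc x' y) = enorm (x - x').
Proof.
apply: (@pexpIrn _ 2) => //; rewrite ?nnegrE ?enorm_ge0// enorm_snoc.
by rewrite subrr enorm0 expr0n addr0.
Qed.

Lemma enorm_snocr x y y' : enorm (snoc x y - snoc x y') = enorm (y - y').
Proof.
apply: (@pexpIrn _ 2) => //; rewrite ?nnegrE ?enorm_ge0// enorm_snoc.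
by rewrite subrr enorm0 expr0n add0r.
Qed.

Lemma CbLip_snocr (phi : 'M[R]_(d, k.+1) -> R) x :
  CbLip phi -> CbLip (fun y => phi (snoc x y)).
Proof.
by move=> h; apply: (CbLip_comp _ h) => y y'; rewrite enorm_snocr.
Qed.

Lemma measurable_snoc : measurable_fun setT
  ((fun z => snoc z.1 z.2) :
     (borel 'M[R]_(d, k) * borel 'cV[R]_d)%type -> borel 'M[R]_(d, k.+1)).
Proof.
apply: measurable_fun_borel_mx => i j.
have [jk|] := ltnP j k.
  rewrite (_ : (fun z => _) =
    (fun x : borel 'M[R]_(d, k) => x i (Ordinal jk)) \o fst); last first.
    by apply/funext => z; rewrite snocE.
  by apply: measurableT_comp => //; exact: entry_borel_measurable.
move=> kj; have -> : j = ord_max.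
  by apply: val_inj; apply/eqP; rewrite eqn_leq kj -ltnS ltn_ord.
rewrite (_ : (fun z => _) = (fun y : borel 'cV[R]_d => y i 0) \o snd).
  by apply: measurableT_comp => //; exact: entry_borel_measurable.
by apply/funext => z; rewrite snoc_max.
Qed.

End Snoc.

Lemma Rintegral_cst_proba (d : measure_display) (T : measurableType d)
    (R : realType) (P : probability T R) (r : R) : \int[P]__ r = r.
Proof.
rewrite Rintegral_cst// (_ : fine _ = 1) ?mulr1//.
exact: (f_equal fine (probability_setT P)).
Qed.

Lemma Rintegral_bound (d : measure_display) (T : measurableType d)
    (R : realType) (P : probability T R) (X : T -> R) (M : R) :
  measurable_fun setT X -> (forall t, `|X t| <= M) -> `|\int[P]_t X t| <= M.
Proof.
move=> mX hM; have iX := bounded_integrable P mX hM.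
rewrite (le_trans (le_normr_Rintegral _ iX))//.
apply: (@le_trans _ _ (\int[P]_t cst M t)).
  apply: le_Rintegral => //; first exact: integrable_norm.
  exact: finite_measure_integrable_cst.
by rewrite Rintegral_cst_proba.
Qed.

Section OneStep.
Variables (R : realType) (d : nat) (Theta : Type).
Variables (F : Theta -> probability (borel 'cV[R]_d) R) (theta : Theta).

Lemma Ehat_step_bound k (phi : 'M[R]_(d, k.+1) -> R) M :
  CbLip phi -> (forall x, `|phi x| <= M) -> forall x,
  ubound (range (fun theta => \int[F theta]_y phi (snoc x y))) M.
Proof.
move=> cphi hM x _ [t _ <-]; apply: le_trans (ler_norm _) _.
apply: Rintegral_bound => [|y]; last exact: hM.
by apply: CbLip_measurable; exact: CbLip_snocr.
Qed.

Lemma Ehat_step_ge k (phi : 'M[R]_(d, k.+1) -> R) x t : CbLip phi ->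
  \int[F t]_y phi (snoc x y) <=
  sup (range (fun theta => \int[F theta]_y phi (snoc x y))).
Proof.
move=> cphi; have [[M hM] _] := cphi.
by apply: ub_le_sup; [exists M; exact: Ehat_step_bound|exists t].
Qed.

(** A supremum of functions with a common bound and a common Lipschitz constant
    inherits both, so the recursion stays within test functions. *)
Lemma CbLip_Ehat_step k (phi : 'M[R]_(d, k.+1) -> R) : CbLip phi ->
  CbLip (fun x => sup (range (fun theta => \int[F theta]_y phi (snoc x y)))).
Proof.
move=> cphi; have /CbLipP[M [L [M0 L0 hM hL]]] := cphi.
set g := fun x => sup _.
have ne x : range (fun theta => \int[F theta]_y phi (snoc x y)) !=set0.
  by exists (\int[F theta]_y phi (snoc x y)), theta.
have gL x x' : g x <= g x' + L * enorm (x - x').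
  apply: ge_sup => // _ [t _ <-].
  apply: le_trans (lerD (Ehat_step_ge x' t cphi) (lexx _)).
  rewrite -lerBlDl -RintegralB//; try exact: CbLip_integrable (CbLip_snocr _ _).
  apply: le_trans (ler_norm _) _; apply: Rintegral_bound.
    by apply: measurable_funB; apply: CbLip_measurable; exact: CbLip_snocr.
  by move=> y; apply: le_trans (hL _ _) _; rewrite enorm_snocl.
apply/CbLipP; exists M, L; split => // [x|x x'].
  rewrite ler_norml; apply/andP; split; last first.
    by apply: ge_sup => //; exact: Ehat_step_bound.
  apply: le_trans (Ehat_step_ge x theta cphi); rewrite lerNl.
  apply: le_trans (ler_norm _) _; rewrite normrN.
  apply: Rintegral_bound => [|y]; last exact: hM.
  by apply: CbLip_measurable; exact: CbLip_snocr.
have := gL x x'; have := gL x' x; rewrite (enormB x').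
by move=> h1 h2; rewrite ler_norml; apply/andP; split; lra.
Qed.

End OneStep.

Lemma CbLip_integral (R : realType) d k (P : probability (borel 'cV[R]_d) R)
    (phi : 'M[R]_(d, k.+1) -> R) :
  CbLip phi -> CbLip (fun x => \int[P]_y phi (snoc x y)).
Proof.
move=> /(CbLip_Ehat_step (fun _ : unit => P) tt).
rewrite (_ : (fun x => sup _) = fun x => \int[P]_y phi (snoc x y))//.
apply/funext => x; rewrite (_ : range _ = [set \int[P]_y phi (snoc x y)]) ?sup1//.
by apply/seteqP; split => [_ [_ _ <-]//|_ ->]; exists tt.
Qed.

Lemma enorm_col (R : realType) a c (A : 'M[R]_(a, c)) j :
  enorm (col j A) <= enorm A.
Proof.
rewrite /enorm ler_wsqrtr// ler_sum// => i _.
rewrite big_ord1 mxE (bigD1 j)//= lerDl sumr_ge0// => *; exact: sqr_ge0.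
Qed.

Lemma CbLip_col (R : realType) a c (j : 'I_c) (g : 'cV[R]_a -> R) :
  CbLip g -> CbLip (fun x : 'M[R]_(a, c) => g (col j x)).
Proof.
by move=> h; apply: (CbLip_comp _ h) => x y; rewrite -raddfB /= enorm_col.
Qed.

Section IidLaw.
Variables (R : realType) (d : nat) (Theta : Type).
Variables (F : Theta -> probability (borel 'cV[R]_d) R) (theta : Theta).

(** Independent noise of law [F theta] is one of the models over which the
    sublinear expectation is the worst case: this is how the marginals of the
    uncertainty set are known to be realized. *)
Lemma iid_law (N : nat) : exists Q : probability (borel 'M[R]_(d, N)) R,
  (forall phi, CbLip phi -> \int[Q]_x phi x <= Ehat_lip F phi) /\
  forall (j : 'I_N) (g : 'cV[R]_d -> R), CbLip g ->
    \int[Q]_x g (col j x) = \int[F theta]_y g y.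
Proof.
elim: N => [|k [Q [hQ hc]]].
  exists (\d_(0 : borel 'M[R]_(d, 0)) : probability _ _); split => [phi cphi|[]//].
  rewrite /Rintegral integral_dirac//= ?diracT ?mul1e//.
    by rewrite indicT mul1r.
  by apply/measurable_EFinP; exact: CbLip_measurable.
pose S : {mfun (borel 'M[R]_(d, k) * borel 'cV[R]_d)%type >-> borel 'M[R]_(d, k.+1)} :=
  mfun_Sub (mem_set (@measurable_snoc R d k)).
pose Q' := distribution (Q \x F theta : probability _ _)%E S.
have IE (phi : 'M[R]_(d, k.+1) -> R) : CbLip phi ->
    \int[Q']_x phi x = \int[Q]_x \int[F theta]_y phi (snoc x y).
  move=> cphi; have mphi := CbLip_measurable cphi; have [[M hM] _] := cphi.
  have iS : (Q \x F theta)%E.-integrable setT (EFin \o (phi \o S)).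
    apply: (@bounded_integrable _ _ _ (Q \x F theta : probability _ _)%E _ M).
      by apply: measurableT_comp => //; exact: measurable_snoc.
    by move=> z; exact: hM.
  rewrite /Rintegral integral_distribution//; last exact/measurable_EFinP.
  rewrite -integral12_prod_meas1//; congr fine; apply: eq_integral => x _.
  rewrite /fubini_F fineK//; apply: integrable_fin_num => //.
  exact: CbLip_integrable (CbLip_snocr _ cphi).
exists Q'; split => [phi cphi|j g cg].
  rewrite IE//=; apply: le_trans (hQ _ (CbLip_Ehat_step F theta cphi)).
  apply: le_Rintegral => //; try apply: CbLip_integrable.
  - exact: CbLip_integral.
  - exact: CbLip_Ehat_step.
  - by move=> x _; exact: Ehat_step_ge.
rewrite IE; last exact: CbLip_col.
have [jk|kj] := ltnP j k.
  rewrite -(hc (Ordinal jk) g cg); apply: eq_Rintegral => x _.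
  rewrite -[RHS](Rintegral_cst_proba (F theta)); apply: eq_Rintegral => y _.
  by congr g; apply/colP => i; rewrite mxE snocE mxE.
have -> : j = ord_max.
  by apply: val_inj; apply/eqP; rewrite eqn_leq kj -ltnS ltn_ord.
rewrite -[RHS](Rintegral_cst_proba Q); apply: eq_Rintegral => x _.
apply: eq_Rintegral => y _; congr g; apply/colP => i.
by rewrite mxE snoc_max.
Qed.

End IidLaw.

(** * The backward recursion on products *)

(** Columns indexed by [nat], with default value [0], avoid transporting
    ordinals between the arities met along the backward recursion. *)
Definition colz (R : realType) (d k : nat) (x : 'M[R]_(d, k)) (a : nat) :
    'cV[R]_d :=
  if insub a is Some a' then col a' x else 0.

Definition lead (R : realType) (d j k : nat) (x : 'M[R]_(d, k)) : 'M[R]_(d, j) :=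
  \matrix_(i, a) colz x a i 0.
Arguments lead {R d} j {k} x.

Section Columns.
Variables (R : realType) (d : nat).

Lemma colzE k (x : 'M[R]_(d, k)) (a : nat) (h : (a < k)%N) :
  colz x a = col (Ordinal h) x.
Proof. by rewrite /colz insubT. Qed.

Lemma colz_ord k (x : 'M[R]_(d, k)) (a : 'I_k) i : colz x a i 0 = x i a.
Proof. by rewrite (colzE _ (ltn_ord a)) mxE; congr (x i _); apply: val_inj. Qed.

Lemma colz_snoc_lt k (x : 'M[R]_(d, k)) y a :
  (a < k)%N -> colz (snoc x y) a = colz x a.
Proof.
move=> h; rewrite (colzE _ (ltnW h : (a < k.+1)%N)) (colzE _ h).
by apply/colP => i; rewrite mxE snocE [RHS]mxE; congr (x i _); apply: val_inj.
Qed.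

Lemma colz_snoc k (x : 'M[R]_(d, k)) y : colz (snoc x y) k = y.
Proof.
rewrite (colzE _ (ltnSn k)); apply/colP => i; rewrite mxE -(snoc_max x).
by congr (snoc x y i _); apply: val_inj.
Qed.

Lemma lead_snoc j k (x : 'M[R]_(d, k)) y :
  (j <= k)%N -> lead j (snoc x y) = lead j x.
Proof.
move=> jk; apply/matrixP => i a; rewrite !mxE colz_snoc_lt//.
exact: leq_trans (ltn_ord a) jk.
Qed.

Lemma enorm_lead j k (x y : 'M[R]_(d, k)) :
  (j <= k)%N -> enorm (lead j x - lead j y) <= enorm (x - y).
Proof.
move=> jk; rewrite /enorm ler_wsqrtr// ler_sum// => i _.
pose G a := (colz x a i 0 - colz y a i 0) ^+ 2.
rewrite (eq_bigr (fun a : 'I_j => G a)); last by move=> a _; rewrite !mxE.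
rewrite [leRHS](eq_bigr (fun a : 'I_k => G a)); last first.
  by move=> a _; rewrite /G !colz_ord !mxE.
rewrite (big_ord_widen k G jk) big_mkcond ler_sum// => a _.
by case: ifP => // _; exact: sqr_ge0.
Qed.

End Columns.

Lemma Ehat_lip_le0 (R : realType) d (Theta : Type)
    (F : Theta -> probability (borel 'cV[R]_d) R) k (phi : 'M[R]_(d, k) -> R) :
  (forall x, phi x <= 0) -> Ehat_lip F phi <= 0.
Proof.
elim: k phi => [|k IH] phi h /=; first exact: h.
apply: IH => x; apply: sup_le0 => _ [t _ <-].
by apply: Rintegral_le0 => y; exact: h.
Qed.

(** The recursion integrates out the last arguments first. Those after the
    [k]-th do not enter the integrand; integrating the [k]-th freezes [psi],
    which is nonnegative, and leaves the worst case of [g - c], which is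
    nonpositive. *)
Lemma Ehat_lip_factor_le0 (R : realType) d (Theta : Type)
    (F : Theta -> probability (borel 'cV[R]_d) R) k j
    (psi : 'M[R]_(d, k) -> R) (g : 'cV[R]_d -> R) (c : R) :
  (k < j)%N -> (forall x, 0 <= psi x) -> CbLip g ->
  (forall t, \int[F t]_y g y <= c) ->
  Ehat_lip F (fun x : 'M[R]_(d, j) => psi (lead k x) * (g (colz x k) - c)) <= 0.
Proof.
move=> kj psi0 cg hc; elim: j kj => // j IH; rewrite ltnS leq_eqVlt.
case/orP => [/eqP ej|kj] /=.
  clear IH; subst j.
  apply: Ehat_lip_le0 => x; apply: sup_le0 => _ [t _ <-].
  under eq_Rintegral do rewrite lead_snoc// colz_snoc.
  have ig := CbLip_integrable (F t) cg.
  rewrite RintegralZl//; last first.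
    by apply: CbLip_integrable; apply: CbLipD => //; exact: CbLip_cst.
  rewrite mulr_ge0_le0// RintegralB//; last exact: finite_measure_integrable_cst.
  by rewrite Rintegral_cst_proba subr_le0.
have [[t0 _]|noT] := pselect (exists t : Theta, True); last first.
  apply: Ehat_lip_le0 => x; apply: sup_le0 => r [t _ _].
  by exfalso; apply: noT; exists t.
apply: le_trans (IH kj); rewrite le_eqVlt; apply/orP; left; apply/eqP.
congr Ehat_lip; apply/funext => x.
rewrite -[RHS]sup1; congr sup.
have step t : \int[F t]_y (psi (lead k (snoc x y)) * (g (colz (snoc x y) k) - c))
    = psi (lead k x) * (g (colz x k) - c).
  rewrite -[RHS](Rintegral_cst_proba (F t)); apply: eq_Rintegral => y _.
  by rewrite lead_snoc ?(ltnW kj)// colz_snoc_lt.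
by apply/seteqP; split => [_ [t _ <-]|_ ->] /=; [|exists t0].
Qed.

(** * Moments of the noise over the uncertainty set *)

Lemma Rintegral_cvg0 (d : measure_display) (T : measurableType d)
    (R : realType) (P : probability T R) (h : nat -> T -> R) :
  (forall n, measurable_fun setT (h n)) -> (forall n t, 0 <= h n t <= 1) ->
  (forall t, h n t @[n --> \oo] --> (0 : R)) ->
  forall e : R, 0 < e -> exists n, \int[P]_t h n t <= e.
Proof.
move=> mh h01 h0 e e0.
have [] := @dominated_convergence _ T R P setT measurableT
  (fun n t => (h n t)%:E) (cst 0%E) (cst 1%E).
- by move=> n; apply/measurable_EFinP.
- exact: measurable_cst.
- by apply: aeW => t _; apply: cvg_EFin => //; [exact: nearW|exact: h0].
- exact: finite_measure_integrable_cst.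
- apply: aeW => t n _ /=; rewrite lee_fin.
  by have /andP[? ?] := h01 n t; rewrite ger0_norm.
move=> _ _; rewrite integral0 => /fine_cvg /cvgrPdist_lt /(_ e e0)[n _ hn].
exists n; have := hn n (leqnn n); rewrite sub0r normrN => /ltW.
by apply: le_trans; exact: ler_norm.
Qed.

Section Noise.
Variables (R : realType) (disp : measure_display) (Omega : measurableType disp).
Variables (d : nat) (Theta : Type) (N : nat).
Variables (F : Theta -> probability (borel 'cV[R]_d) R).
Variable W : nat -> Omega -> 'cV[R]_d.
Hypothesis hFN : (@measurable _ Omega : set (set Omega)) = Fsig W N.

Lemma measurable_noise j : (1 <= j <= N)%N ->
  measurable_fun setT (W j : Omega -> borel 'cV[R]_d).
Proof.
move=> hj _ B mB; rewrite setTI hFN; apply: sub_sigma_algebra.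
by exists j, B.
Qed.

Lemma measurable_noise_entry j l : (1 <= j <= N)%N ->
  measurable_fun setT (fun w => W j w l 0).
Proof.
move=> hj.
exact: (measurableT_comp (@entry_borel_measurable R d 1 l 0) (measurable_noise hj)).
Qed.

Lemma Fsig_mono j k : (j <= k)%N -> Fsig W j `<=` Fsig W k.
Proof.
move=> jk; apply: sub_sigma_algebra2 => _ [i [B [/andP[i1 ij] mB ->]]].
by exists i, B; split => //; rewrite i1 (leq_trans ij).
Qed.

Lemma Fsig_measurable k A : (k <= N)%N -> Fsig W k A -> measurable A.
Proof. by move=> kN /(Fsig_mono kN); rewrite hFN. Qed.

Lemma measurable_Fsig_fun k (X : Omega -> R) : (k <= N)%N ->
  measurable_Fsig W k X -> measurable_fun setT X.
Proof.
by move=> kN hX _ B mB; rewrite setTI; apply: (Fsig_measurable kN); exact: hX.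
Qed.

Lemma measurable_hist k : (k <= N)%N ->
  measurable_fun setT (hist W k : Omega -> borel 'M[R]_(d, k)).
Proof.
move=> kN; apply: measurable_fun_borel_mx => i j.
under eq_fun do rewrite mxE.
by apply: measurable_noise_entry; rewrite /= (leq_trans (ltn_ord j)).
Qed.

Lemma colz_hist k a w : (a < k)%N -> colz (hist W k w) a = W a.+1 w.
Proof. by move=> h; rewrite (colzE _ h); apply/colP => i; rewrite !mxE. Qed.

Lemma lead_hist j k w : (j <= k)%N -> lead j (hist W k w) = hist W j w.
Proof.
move=> jk; apply/matrixP => i a; rewrite mxE colz_hist ?mxE//.
exact: leq_trans (ltn_ord a) jk.
Qed.

Section Marginal.
Hypothesis hA3 : assumption_A3 N F W.

(** Every one-step law is the law of the next noise in some model of the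
    uncertainty set: the joint law of independent noise lies below the sublinear
    expectation, and [hA3] realizes it on [Omega]. *)
Lemma marginal_in_Pset theta j (g : 'cV[R]_d -> R) : (j < N)%N -> CbLip g ->
  exists2 P, Pset N F W P & \int[P]_w g (W j.+1 w) = \int[F theta]_y g y.
Proof.
move=> jN cg; have [Q [hQ hm]] := iid_law F theta N.
have AQ : Aset F Q.
  move=> phi cphi; rewrite -[leLHS]fineK ?lee_fin ?hQ//.
  by apply: integrable_fin_num => //; exact: CbLip_integrable.
have [P hP] := hA3 AQ.
pose H : {mfun Omega >-> borel 'M[R]_(d, N)} :=
  mfun_Sub (mem_set (measurable_hist (leqnn N))).
have IE phi : CbLip phi ->
    (\int[P]_w (phi (hist W N w))%:E = \int[Q]_x (phi x)%:E)%E.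
  move=> cphi; have [[M hM] _] := cphi.
  have mphi := CbLip_measurable cphi.
  transitivity (\int[distribution P H]_x (phi x)%:E)%E.
    rewrite integral_distribution//; first exact/measurable_EFinP.
    apply: (@bounded_integrable _ _ _ P _ M) => [|w]; last exact: hM.
    exact: measurableT_comp mphi (measurable_hist (leqnn N)).
  by apply: eq_measure_integral => A mA _; exact: (esym (hP A mA)).
exists P.
  move=> phi cphi; rewrite unlock IE//; exact: AQ.
rewrite -(hm (Ordinal jN) g cg) /Rintegral -IE; last exact: CbLip_col.
congr fine; apply: eq_integral => w _; congr (g _)%:E.
by apply/colP => i; rewrite !mxE.
Qed.

End Marginal.

(** The bound is uniform over the uncertainty set because polar sets are null
    for all its members at once. *)
Lemma Lc_second_moment k (X : Omega -> R) : (k <= N)%N -> Lc N F W 2 k X ->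
  exists2 c : R, 0 <= c & forall P, Pset N F W P ->
    (\int[P]_w ((X w) ^+ 2)%:E <= c%:E)%E.
Proof.
move=> kN [mX [X' [mX' [B [mB pB] XB] fin _]]].
set E := Ehat _ _ _ _ in fin; exists `|fine E| => // P hP.
have leE : (\int[P]_w ((X w) ^+ 2)%:E <= E)%E.
  apply: ereal_sup_ubound; exists P => //.
  rewrite unlock; apply: ae_eq_integral => //.
  - apply/measurable_EFinP/measurable_funX; apply: measurableT_comp => //.
    exact: measurable_Fsig_fun mX'.
  - by apply/measurable_EFinP/measurable_funX.
  - exists B; split => //; last first.
      move=> w /= h; apply: contrapT => nB; apply: h => _.
      by rewrite XB// real_normK ?num_real.
    apply/eqP; rewrite eq_le measure_ge0 andbT -pB.
    by apply: ereal_sup_ubound; exists P.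
apply: le_trans leE _.
by move: fin; case: E => [r|//|_] /=; rewrite ?leNye ?lee_fin ?ler_norm.
Qed.

End Noise.

(** * Conditional second moment of the noise *)

Definition clamp (R : realType) (t : R) : R := Num.max 0 (Num.min 1 t).

Lemma clamp_bounds (R : realType) (t : R) : 0 <= clamp t <= 1.
Proof. by rewrite /clamp le_max lexx ge_max ler01 ge_min lexx. Qed.

Lemma clamp_lipschitz (R : realType) (s t : R) :
  `|clamp s - clamp t| <= `|s - t|.
Proof.
have h (x : R) : [\/ clamp x = 0 /\ x <= 0, clamp x = 1 /\ 1 <= x |
    clamp x = x /\ 0 <= x <= 1].
  rewrite /clamp; case: (leP 1 x) => x1.
    by apply: Or32; rewrite max_r.
  case: (leP 0 x) => x0; first by apply: Or33; split => //=; exact: ltW.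
  by apply: Or31; rewrite ltW.
have := ler_norm (s - t); have := lerNnormlW (lexx `|s - t|).
move=> h1 h2; rewrite ler_norml.
case: (h s) => -[-> h3]; case: (h t) => -[-> h4]; try case/andP: h3 => *;
  try case/andP: h4 => *; apply/andP; split; lra.
Qed.

Lemma clamp_le0 (R : realType) (t : R) : t <= 0 -> clamp t = 0.
Proof.
by move=> t0; rewrite /clamp min_r ?max_l// (le_trans t0).
Qed.

Lemma clamp_ge1 (R : realType) (t : R) : 1 <= t -> clamp t = 1.
Proof. by move=> t1; rewrite /clamp min_l// max_r. Qed.

(** The square of an entry is not a test function; its truncations are, and they
    increase to it. *)
Definition trunc_sq (R : realType) (d : nat) (K : R) (l : 'I_d) (y : 'cV[R]_d) : R :=
  (Num.min `|y l 0| K) ^+ 2.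

Lemma trunc_sq_mono (R : realType) (d : nat) (K K' : R) (l : 'I_d) y : 0 <= K -> K <= K' ->
  trunc_sq K l y <= trunc_sq K' l y.
Proof.
move=> K0 KK'; have K0' := le_trans K0 KK'.
rewrite /trunc_sq lerXn2r ?nnegrE ?le_min ?normr_ge0 ?K0 ?K0'//=.
by rewrite !ge_min lexx KK' orbT.
Qed.

Lemma CbLip_trunc_sq (R : realType) (d : nat) (K : R) (l : 'I_d) : 0 <= K -> CbLip (trunc_sq K l).
Proof.
move=> K0; have b (s : R) : 0 <= Num.min `|s| K <= K.
  by rewrite le_min normr_ge0 K0 ge_min lexx orbT.
apply: (@CbLip_entry _ _ _ (fun s => (Num.min `|s| K) ^+ 2) (K ^+ 2) (K + K)).
- by rewrite addr_ge0.
- move=> s; have /andP[? ?] := b s.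
  by rewrite ger0_norm ?exprn_ge0// lerXn2r// nnegrE.
- move=> s t; have /andP[s0 sK] := b s; have /andP[t0 tK] := b t.
  rewrite subr_sqr mulrC normrM ler_pM//.
    by rewrite ger0_norm ?addr_ge0// lerD.
  have : `|Num.min `|s| K - Num.min `|t| K| <= `| `|s| - `|t| |.
    have := ler_norm (`|s| - `|t|); have := lerNnormlW (lexx `| `|s| - `|t| |).
    move=> h1 h2; rewrite ler_norml.
    case: (leP `|s| K) => ?; case: (leP `|t| K) => ?; apply/andP; split; lra.
  by move/le_trans; apply; exact: ler_dist_dist.
Qed.

Section CondMoment.
Variables (R : realType) (disp : measure_display) (Omega : measurableType disp).
Variables (d : nat) (Theta : Type) (N : nat).
Variables (F : Theta -> probability (borel 'cV[R]_d) R).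
Variable W : nat -> Omega -> 'cV[R]_d.
Hypothesis hFN : (@measurable _ Omega : set (set Omega)) = Fsig W N.
Variable P : probability Omega R.

(** Linear inequalities between integrals extend to these events from Lipschitz
    functions of the past, to which alone the sublinear expectation applies. *)
Definition lip_dense (k : nat) : set (set Omega) :=
  [set A | measurable A /\ forall e : R, 0 < e ->
     exists psi : 'M[R]_(d, k) -> R, [/\ CbLip psi, forall x, 0 <= psi x <= 1 &
       \int[P]_w `|psi (hist W k w) - \1_A w| <= e]].

Lemma measurable_CbLip_hist k (psi : 'M[R]_(d, k) -> R) : (k <= N)%N ->
  CbLip psi -> measurable_fun setT (psi \o hist W k).
Proof.
move=> kN /CbLip_measurable h.
exact: measurableT_comp h (measurable_hist hFN kN).
Qed.

Lemma measurable_err k psi A : (k <= N)%N -> CbLip psi -> measurable A ->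
  measurable_fun setT (fun w => `|psi (hist W k w) - \1_A w|).
Proof.
move=> kN cpsi mA; apply: measurableT_comp => //.
apply: measurable_funB; last exact: measurable_indic.
exact: measurable_CbLip_hist.
Qed.

Lemma indic01 (A : set Omega) w : 0 <= (\1_A w : R) <= 1.
Proof. by rewrite indicE; case: (_ \in _); rewrite ?lexx ?ler01. Qed.

Lemma integrable_unit (h : Omega -> R) : measurable_fun setT h ->
  (forall w, 0 <= h w <= 1) -> P.-integrable setT (EFin \o h).
Proof.
move=> mh h01; apply: (@bounded_integrable _ _ _ _ _ 1) => // w.
by have /andP[? ?] := h01 w; rewrite ger0_norm.
Qed.

Lemma err01 k (psi : 'M[R]_(d, k) -> R) A w : (forall x, 0 <= psi x <= 1) ->
  0 <= `|psi (hist W k w) - \1_A w| <= 1.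
Proof.
move=> h; rewrite normr_ge0/= ler_norml.
have /andP[? ?] := h (hist W k w); have /andP[? ?] := indic01 A w.
by apply/andP; split; lra.
Qed.

(** Closure of [lip_dense] under set operations amounts to splitting an L1 error
    into two errors that are already small. *)
Lemma le_int_err k (psi : 'M[R]_(d, k) -> R) A (h1 h2 : Omega -> R) (e1 e2 : R) :
  (k <= N)%N -> CbLip psi -> (forall x, 0 <= psi x <= 1) -> measurable A ->
  measurable_fun setT h1 -> (forall w, 0 <= h1 w <= 1) -> \int[P]_w h1 w <= e1 ->
  measurable_fun setT h2 -> (forall w, 0 <= h2 w <= 1) -> \int[P]_w h2 w <= e2 ->
  (forall w, `|psi (hist W k w) - \1_A w| <= h1 w + h2 w) ->
  \int[P]_w `|psi (hist W k w) - \1_A w| <= e1 + e2.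
Proof.
move=> kN cpsi psi01 mA mh1 h101 he1 mh2 h201 he2 le.
have i1 := integrable_unit mh1 h101; have i2 := integrable_unit mh2 h201.
apply: (@le_trans _ _ (\int[P]_w (h1 w + h2 w))).
  apply: le_Rintegral => //; last by have := integrableD measurableT i1 i2.
  by apply: integrable_unit; [exact: measurable_err|move=> w; exact: err01].
by rewrite RintegralD// lerD.
Qed.

Lemma sigma_algebra_lip_dense k : (k <= N)%N ->
  sigma_algebra setT (lip_dense k).
Proof.
move=> kN; apply/sigma_algebraP; first by move=> X _; exact: subsetT.
have comb A B C (f : R -> R -> R) : measurable C ->
    (forall (phi psi : 'M[R]_(d, k) -> R), CbLip phi -> CbLip psi ->
       CbLip (fun x => f (phi x) (psi x))) ->
    (forall a b : R, 0 <= a <= 1 -> 0 <= b <= 1 -> 0 <= f a b <= 1) ->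
    (forall a b a' b' : R, 0 <= a <= 1 -> 0 <= b <= 1 -> 0 <= a' <= 1 -> 0 <= b' <= 1 ->
       `|f a b - f a' b'| <= `|a - a'| + `|b - b'|) ->
    (forall w, \1_C w = f (\1_A w) (\1_B w)) ->
    lip_dense k A -> lip_dense k B -> lip_dense k C.
  move=> mC cf f01 fl fC [mA hA] [mB hB]; split => // e e0.
  have e20 : 0 < e / 2 by rewrite divr_gt0.
  have [p [cp p01 hp]] := hA _ e20; have [q [cq q01 hq]] := hB _ e20.
  exists (fun x => f (p x) (q x)); split; [exact: cf|by move=> x; exact: f01|].
  rewrite [e]splitr; 
  apply: (@le_int_err k (fun x => f (p x) (q x)) _ (fun w => `|p (hist W k w) - \1_A w|)
    (fun w => `|q (hist W k w) - \1_B w|)) => //.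
  - exact: cf.
  - by move=> x; exact: f01.
  - exact: measurable_err.
  - by move=> w; exact: err01.
  - exact: measurable_err.
  - by move=> w; exact: err01.
  - by move=> w; rewrite fC; apply: fl => //; exact: indic01.
have prod01 (a b : R) : 0 <= a <= 1 -> 0 <= b <= 1 -> 0 <= a * b <= 1.
  by move=> /andP[? ?] /andP[? ?]; rewrite mulr_ge0//= mulr_ile1.
have prodl (a b a' b' : R) : 0 <= a <= 1 -> 0 <= b <= 1 -> 0 <= a' <= 1 ->
    0 <= b' <= 1 -> `|a * b - a' * b'| <= `|a - a'| + `|b - b'|.
  move=> /andP[a0 a1] /andP[b0 b1] /andP[a0' a1'] /andP[b0' b1'].
  have -> : a * b - a' * b' = b * (a - a') + a' * (b - b') by ring.
  rewrite (le_trans (ler_normD _ _))// !normrM lerD// ler_piMl//.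
  - by rewrite ger0_norm.
  - by rewrite ger0_norm.
split.
- split => // e e0; exists (fun=> 1); split; first exact: CbLip_cst.
    by move=> x; rewrite ler01 lexx.
  under eq_Rintegral do rewrite indicT subrr normr0.
  by rewrite Rintegral_cst_proba ltW.
- move=> A B BA GA GB.
  apply: (comb A B _ (fun a b => a * (1 - b)) _ _ _ _ _ GA GB).
  + by apply: measurableD; [case: GA|case: GB].
  + move=> phi psi h1 h2; apply: CbLipM => //; apply: CbLipD; first exact: CbLip_cst.
    have := CbLipM (CbLip_cst _ _ (-1)) h2.
    by under eq_fun do rewrite mulN1r.
  + by move=> a b ha /andP[? ?]; apply: prod01 => //; apply/andP; split; lra.
  + move=> a b a' b' ha /andP[? ?] ha' /andP[? ?].
    have -> : `|b - b'| = `|(1 - b) - (1 - b')|.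
      by rewrite -normrN; congr `|_|; lra.
    by apply: prodl => //; apply/andP; split; lra.
  + move=> w; rewrite !indicE in_setD.
    by case: (w \in A); case: (w \in B); rewrite /= ?mul0r ?mul1r ?subr0 ?subrr.
- move=> A ndA GA; split.
    by apply: bigcup_measurable => n _; case: (GA n).
  move=> e e0; have e20 : 0 < e / 2 by rewrite divr_gt0.
  have mU : measurable (\bigcup_n A n) by apply: bigcup_measurable => n _; case: (GA n).
  pose h n w : R := `|\1_(A n) w - \1_(\bigcup_n A n) w|.
  have mh n : measurable_fun setT (h n).
    apply: measurableT_comp => //; apply: measurable_funB; apply: measurable_indic => //.
    by case: (GA n).
  have h01 n w : 0 <= h n w <= 1.
    have /andP[? ?] := indic01 (A n) w; have /andP[? ?] := indic01 (\bigcup_n A n) w.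
    by rewrite normr_ge0/= ler_norml; apply/andP; split; lra.
  have h0 w : h n w @[n --> \oo] --> (0 : R).
    apply/cvgrPdist_lt => r r0; have [[m _ Am]|nU] := pselect ((\bigcup_n A n) w).
      exists m => // n /= mn; rewrite /h !indicE.
      have An : A n w by have /subsetPset := ndA _ _ mn; apply.
      by rewrite !mem_set ?subrr ?normr0 ?subr0 ?normr0//; exists m.
    near=> n; rewrite /h !indicE memNset ?memNset//.
      by rewrite subrr normr0 subrr normr0.
    by move=> An; apply: nU; exists n.
  have [n hn] := Rintegral_cvg0 P mh h01 h0 e20.
  have [mA /(_ _ e20)[psi [cpsi psi01 hpsi]]] := GA n.
  exists psi; split => //; rewrite [e]splitr.
  apply: (@le_int_err k psi _ (fun w => `|psi (hist W k w) - \1_(A n) w|) (h n)) => //.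
  + exact: measurable_err.
  + by move=> w; exact: err01.
  + move=> w; rewrite /h; set a := \1_(A n) w; set b := \1_ _ w.
    by rewrite -(subrKA a) ler_normD.
- move=> A B GA GB; apply: (comb A B _ *%R _ _ _ _ _ GA GB) => //.
  + by apply: measurableI; [case: GA|case: GB].
  + exact: CbLipM.
  + move=> w; rewrite !indicE in_setI.
    by case: (w \in A); case: (w \in B); rewrite /= ?mul0r ?mul1r.
Unshelve. all: by end_near.
Qed.

(** Steeper and steeper clamps converge pointwise to the indicator of an open
    half-space. *)
Lemma lip_dense_halfspace k j i (a : R) : (k <= N)%N -> (1 <= j <= k)%N ->
  lip_dense k [set w | a < W j w i 0].
Proof.
move=> kN /andP[j1 jk]; set A := [set w | _].
have mA : measurable A.
  have := @measurable_noise_entry _ _ _ _ _ W hFN j i.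
  rewrite j1 (leq_trans jk kN) => /(_ isT) h.
  have := h measurableT _ (measurable_itv `]a, +oo[); rewrite setTI.
  rewrite (_ : _ @^-1` _ = A)//; apply/seteqP.
  by split=> w; rewrite /A /= in_itv/= andbT.
split => // e e0.
have jk' : (j.-1 < k)%N by rewrite prednK.
pose psi m (x : 'M[R]_(d, k)) := clamp (m%:R * (x i (Ordinal jk') - a)).
have cpsi m : CbLip (psi m).
  apply: (@CbLip_entry _ _ _ (fun s => clamp (m%:R * (s - a))) 1 m%:R) => //.
    by move=> s; have /andP[? ?] := clamp_bounds (m%:R * (s - a)); rewrite ger0_norm.
  move=> s t; apply: le_trans (clamp_lipschitz _ _) _.
  by rewrite -mulrBr normrM ger0_norm// ler_wpM2l// opprB addrA subrK.
have psi01 m x : 0 <= psi m x <= 1 by exact: clamp_bounds.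
have psiE m w : psi m (hist W k w) = clamp (m%:R * (W j w i 0 - a)).
  by rewrite /psi mxE /= prednK.
have [] := @Rintegral_cvg0 _ _ _ P (fun m w => `|psi m (hist W k w) - \1_A w|)
  _ _ _ _ e0.
- by move=> m; exact: measurable_err.
- by move=> m w; exact: err01.
- move=> w; apply/cvgrPdist_lt => r r0; have [aw|wa] := ltP a (W j w i 0).
    near=> m; rewrite psiE indicE mem_set// clamp_ge1 ?subrr ?normr0 ?subr0 ?normr0//.
    rewrite -ler_pdivrMr ?subr_gt0// mul1r.
    near: m; exact: nbhs_infty_ger.
  near=> m; rewrite psiE indicE memNset /A/=; last by rewrite ltNge wa.
  by rewrite clamp_le0 ?subrr ?normr0 ?subr0 ?normr0// mulr_ge0_le0// subr_le0.
by move=> m hm; exists (psi m); split.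
Unshelve. all: by end_near.
Qed.

(** Since [lip_dense k] is a sigma-algebra, the measurability of [W j] for it can
    be tested on entries, that is, on half-spaces. *)
Lemma Fsig_lip_dense k A : (k <= N)%N -> Fsig W k A -> lip_dense k A.
Proof.
move=> kN; have sG := sigma_algebra_lip_dense kN; apply; split => //.
move=> _ [j [B [jk mB ->]]].
pose T := g_sigma_algebraType (lip_dense k).
have mE : measurable = lip_dense k :> set (set T) by exact: sigma_algebra_id.
have : measurable_fun setT (W j : T -> borel 'cV[R]_d).
  apply: measurable_fun_borel_mx => i l; rewrite (ord1 l).
  apply: (measurability _ (RGenOInfty.measurableE R)).
  move=> _ [_ [y ->] <-]; rewrite setTI mE.
  rewrite (_ : _ @^-1` _ = [set w | y < W j w i 0]); first exact: lip_dense_halfspace.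
  by apply/seteqP; split=> w; rewrite /= in_itv/= andbT.
by move=> /(_ measurableT _ mB); rewrite setTI mE.
Qed.

(** For a Lipschitz weight on the past this is the sign of the sublinear
    expectation of [psi * (g - c)]; density of such weights gives indicators. *)
Lemma cond_moment_le k A (g : 'cV[R]_d -> R) (c : R) : (k < N)%N ->
  Pset N F W P -> Fsig W k A -> CbLip g -> (forall t, \int[F t]_y g y <= c) ->
  \int[P]_w (\1_A w * (g (W k.+1 w) - c)) <= 0.
Proof.
move=> kN hP FA cg hc; have kN' := ltnW kN.
have mA := Fsig_measurable hFN kN' FA.
have [[M hM] _] := cg; set K := `|M| + `|c| + 1.
have K0 : 0 < K by rewrite ltr_wpDl.
set D : Omega -> R := fun w => g (W k.+1 w) - c.
have hD w : `|D w| <= K.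
  rewrite (le_trans (ler_normB _ _))// /K -addrA lerD//.
    exact: le_trans (hM _) (ler_norm _).
  by rewrite lerDl.
have mD : measurable_fun setT D.
  apply: measurable_funB => //.
  by apply: measurableT_comp (CbLip_measurable cg) (measurable_noise hFN _).
apply/ler_addgt0Pl => e e0; rewrite addr0.
have [_ /(_ (e / K))] := Fsig_lip_dense kN' FA.
case; first by rewrite divr_gt0.
move=> psi [cpsi psi01 hpsi].
have mpsi := measurable_CbLip_hist kN' cpsi.
have ipsi : \int[P]_w (psi (hist W k w) * D w) <= 0.
  pose phi (x : 'M[R]_(d, N)) := psi (lead k x) * (g (colz x k) - c).
  have cphi : CbLip phi.
    apply: CbLipM.
      by apply: (CbLip_comp _ cpsi) => x y; exact: enorm_lead.
    apply: CbLipD; last exact: CbLip_cst.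
    rewrite (_ : (fun x => _) = fun x : 'M[R]_(d, N) => g (col (Ordinal kN) x)).
      exact: CbLip_col.
    by apply/funext => x; rewrite (colzE _ kN).
  have := hP phi cphi; rewrite unlock.
  have -> : (\int[P]_w ((phi \o hist W N) w)%:E =
             \int[P]_w (psi (hist W k w) * D w)%:E)%E.
    apply: eq_integral => w _.
    by rewrite /phi/= lead_hist// colz_hist.
  move=> h; have := le_trans h _; rewrite -(lee_fin _ 0).
  have i1 : P.-integrable setT (EFin \o (fun w => psi (hist W k w) * D w)).
    apply: (@bounded_integrable _ _ _ _ _ K); first exact: measurable_funM.
    move=> w; rewrite normrM -[K]mul1r ler_pM//.
    by have /andP[? ?] := psi01 (hist W k w); rewrite ger0_norm.
  rewrite /Rintegral fineK ?(integrable_fin_num _ i1)//; apply.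
  rewrite lee_fin; apply: Ehat_lip_factor_le0 => // x.
  by have /andP[] := psi01 x.
have bnd (h : Omega -> R) : measurable_fun setT h -> (forall w, `|h w| <= 1) ->
    P.-integrable setT (EFin \o (fun w => h w * D w)).
  move=> mh h1; apply: (@bounded_integrable _ _ _ _ _ K); first exact: measurable_funM.
  by move=> w; rewrite normrM -[K]mul1r ler_pM.
have bndpsi : P.-integrable setT (EFin \o (fun w => psi (hist W k w) * D w)).
  by apply: bnd => // w; have /andP[? ?] := psi01 (hist W k w); rewrite ger0_norm.
have bndA : P.-integrable setT (EFin \o (fun w => \1_A w * D w)).
  apply: bnd => [|w]; first exact: measurable_indic.
  by have /andP[? ?] := indic01 A w; rewrite ger0_norm.
have merr := measurable_err kN' cpsi mA.
have ierr := integrable_unit merr (fun w => err01 A w psi01).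
have iKerr : P.-integrable setT
    (EFin \o (fun w => K * `|psi (hist W k w) - \1_A w|)).
  by have := integrableZl measurableT K ierr.
apply: (@le_trans _ _ (\int[P]_w (psi (hist W k w) * D w +
                                  K * `|psi (hist W k w) - \1_A w|))).
  apply: le_Rintegral => //; first by have := integrableD measurableT bndpsi iKerr.
  move=> w _; rewrite -lerBlDl -mulrBl (le_trans (ler_norm _))//.
  rewrite normrM [leRHS]mulrC [X in _ <= X * _]distrC ler_wpM2l//; exact: hD.
rewrite RintegralD// RintegralZl//; rewrite -[e]add0r lerD// mulrC.
by rewrite -ler_pdivlMr.
Qed.

(** Monotone convergence along the truncations passes from bounded test functions
    to the square. *)
Lemma cond_second_moment k l A (c : R) : (k < N)%N -> Pset N F W P ->
  (forall K t, 0 <= K -> \int[F t]_y trunc_sq K l y <= c) -> Fsig W k A ->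
  (\int[P]_(w in A) ((W k.+1 w l 0) ^+ 2)%:E <= c%:E * P A)%E.
Proof.
move=> kN hP hc FA; have mA := Fsig_measurable hFN (ltnW kN) FA.
have mW := @measurable_noise_entry _ _ _ _ _ W hFN k.+1 l kN.
pose h (n : nat) (w : Omega) : \bar R := (\1_A w * trunc_sq n%:R l (W k.+1 w))%:E.
have mh n : measurable_fun setT (h n).
  apply/measurable_EFinP; apply: measurable_funM; first exact: measurable_indic.
  apply: measurableT_comp (measurable_noise hFN _) => //.
  by apply: CbLip_measurable; exact: CbLip_trunc_sq.
have h0 n w : (0 <= h n w)%E.
  rewrite lee_fin mulr_ge0// ?sqr_ge0//; by have /andP[] := indic01 A w.
have hle n : (\int[P]_w h n w <= c%:E * P A)%E.
  have K0 : 0 <= n%:R :> R by [].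
  have cg := CbLip_trunc_sq l K0.
  have := cond_moment_le kN hP FA cg (fun t => hc _ t K0).
  have iA : P.-integrable setT (EFin \o (\1_A : Omega -> R)).
    by apply: integrable_unit; [exact: measurable_indic|exact: indic01].
  have icA : P.-integrable setT (EFin \o (fun w => c * \1_A w)).
    by have := integrableZl measurableT c iA.
  have ih : P.-integrable setT (h n).
    apply: (@bounded_integrable _ _ _ _ _ (n%:R ^+ 2)); first by
      apply/measurable_EFinP; exact: (mh n).
    move=> w; rewrite normrM -[leRHS]mul1r ler_pM//.
      by have /andP[? ?] := indic01 A w; rewrite ger0_norm.
    rewrite ger0_norm ?sqr_ge0// lerXn2r ?nnegrE ?le_min ?normr_ge0//.
    by rewrite ge_min lexx orbT.
  under eq_Rintegral do rewrite mulrBr [\1_A _ * c]mulrC.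
  rewrite RintegralB// RintegralZl// subr_le0.
  rewrite -lee_fin /Rintegral fineK ?(integrable_fin_num _ ih)// EFinM.
  by rewrite fineK ?(integrable_fin_num _ iA)// integral_indic// setIT.
have ndh m n w : (m <= n)%N -> (h m w <= h n w)%E.
  move=> mn; rewrite lee_fin; apply: ler_wpM2l.
    by have /andP[] := indic01 A w.
  by apply: trunc_sq_mono => //; rewrite ler_nat.
rewrite integral_mkcond.
rewrite (_ : (\int[P]_w _ = limn (fun n => \int[P]_w h n w))%E).
  apply: lime_le; last exact: nearW.
  apply: ereal_nondecreasing_is_cvgn => m n mn.
  by apply: ge0_le_integral => // w _; exact: ndh.
rewrite -monotone_convergence//; last by move=> w _ m n; exact: ndh.
apply: eq_integral => w _; apply/esym/cvg_lim => //.
apply: cvg_near_cst; near=> n.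
have Wn : `|W k.+1 w l 0| <= n%:R by near: n; exact: nbhs_infty_ger.
rewrite /h /trunc_sq min_l// real_normK ?num_real// patchE indicE.
by case: (w \in A); rewrite ?mul1r ?mul0r.
Unshelve. all: by end_near.
Qed.

End CondMoment.

(** * Conditional expectation on a sub-sigma-algebra *)

(** [Omega] carries the full sigma-algebra; measurability for a smaller one is
    measurability on the alias that carries it, so that the closure properties
    of measurable functions remain available. *)
Notation gmeas G V := (@measurable_fun _ _ (g_sigma_algebraType G) _ setT V).

Section SubSigmaAlgebra.
Import finmap HBSimple HBNNSimple.
Variables (R : realType) (disp : measure_display) (Omega : measurableType disp).
Variable P : probability Omega R.
Variable G : set (set Omega).
Hypothesis sG : sigma_algebra setT G.
Hypothesis mG : G `<=` measurable.
Implicit Types (V X Y D Z : Omega -> R) (A : set Omega).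

Lemma gmeasE : (@measurable _ (g_sigma_algebraType G) : set (set Omega)) = G.
Proof. exact: sigma_algebra_id. Qed.

Lemma gmeas_measurable V : gmeas G V -> measurable_fun setT V.
Proof.
by move=> mV _ B mB; apply: mG; rewrite -gmeasE; exact: mV.
Qed.

Lemma gmeas_norm V : gmeas G V -> gmeas G (fun w => `|V w|).
Proof. by move=> mV; apply: measurableT_comp mV. Qed.

Lemma gmeas_preimage V B : gmeas G V -> measurable B -> G (V @^-1` B).
Proof. by move=> mV mB; rewrite -[V @^-1` B]setTI -gmeasE; exact: mV. Qed.

(** A comparison of two densities on the events of [G] extends from indicators
    to nonnegative [G]-measurable weights. *)
Lemma weighted_le X Y V : measurable_fun setT X -> measurable_fun setT Y ->
  (forall w, 0 <= X w) -> (forall w, 0 <= Y w) ->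
  (forall A, G A -> (\int[P]_(w in A) (X w)%:E <= \int[P]_(w in A) (Y w)%:E)%E) ->
  gmeas G V -> (forall w, 0 <= V w) ->
  (\int[P]_w (V w * X w)%:E <= \int[P]_w (V w * Y w)%:E)%E.
Proof.
move=> mX mY X0 Y0 XY mV V0.
have mVE : gmeas G (EFin \o V) by exact/measurable_EFinP.
pose f := nnsfun_approx (T := g_sigma_algebraType G) measurableT mVE.
pose g n : Omega -> R := f n.
have g0 n w : 0 <= g n w by rewrite /g.
pose S n y : set Omega := g n @^-1` [set y].
have ff n w : g n w = \sum_(y <- fset_set (range (f n))) `|y| * \1_(S n y) w.
  rewrite {1}/g (fimfunE (f n) w) fsbig_finite//=.
  apply: eq_big_seq => y; rewrite in_fset_set// => /set_mem[t _ <-].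
  by rewrite ger0_norm.
have mg n : gmeas G (g n) by exact: measurable_funPT.
have Gf n y : G (S n y).
  by apply: gmeas_preimage.
have term Z : measurable_fun setT Z -> (forall w, 0 <= Z w) -> forall n,
    (\int[P]_w (g n w * Z w)%:E = \sum_(y <- fset_set (range (f n)))
      `|y|%:E * \int[P]_(w in S n y) (Z w)%:E)%E.
  move=> mZ Z0 n.
  pose h y w : \bar R := (`|y| * (\1_(S n y) w * Z w))%:E.
  have mh0 y : measurable_fun setT (fun w => \1_(S n y) w * Z w).
    by apply: measurable_funM => //; apply: measurable_indic; exact: mG.
  have h0 y w : 0 <= \1_(S n y) w * Z w by rewrite mulr_ge0.
  rewrite (eq_integral (fun w => \sum_(y <- fset_set (range (f n))) h y w)%E).
    have mh y : measurable_fun setT (h y).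
      by apply/measurable_EFinP; apply: measurable_funM => //; exact: mh0.
    have hpos y w : setT w -> (0 <= h y w)%E by move=> _; rewrite lee_fin mulr_ge0.
    rewrite ge0_integral_sum//.
    apply: eq_bigr => y _; rewrite /h; under eq_integral do rewrite EFinM.
    have mE : measurable_fun setT (EFin \o (fun w => \1_(S n y) w * Z w)).
      by apply/measurable_EFinP; exact: mh0.
    have E0 w : setT w -> (0 <= (\1_(S n y) w * Z w)%:E)%E by rewrite lee_fin.
    rewrite ge0_integralZl//.
    rewrite [in RHS]integral_mkcond; congr (_ * _)%E; apply: eq_integral => w _.
    by rewrite patchE indicE; case: (w \in _); rewrite ?mul1r ?mul0r.
  move=> w _; rewrite sumEFin ff mulr_suml; congr EFin.
  by apply: eq_bigr => y _; rewrite mulrA.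
have lim Z : measurable_fun setT Z -> (forall w, 0 <= Z w) ->
    (\int[P]_w (V w * Z w)%:E = limn (fun n => \int[P]_w (g n w * Z w)%:E)
     /\ cvgn (fun n => \int[P]_w (g n w * Z w)%:E))%E.
  move=> mZ Z0.
  have mh n : measurable_fun setT (fun w => (g n w * Z w)%:E).
    apply/measurable_EFinP.
    by apply: measurable_funM => //; exact: gmeas_measurable.
  have nd w : nondecreasing_seq (fun n => (g n w * Z w)%:E).
    move=> m n mn; rewrite lee_fin; apply: ler_wpM2r => //.
    by apply/lefP; 
      exact: (nd_nnsfun_approx (T := g_sigma_algebraType G) measurableT mVE mn).
  split; last first.
    apply: ereal_nondecreasing_is_cvgn => m n mn.
    apply: ge0_le_integral => //; try by move=> w _; rewrite lee_fin mulr_ge0.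
    by move=> w _; exact: nd.
  rewrite -monotone_convergence//; last by move=> n w _; rewrite lee_fin mulr_ge0.
  apply: eq_integral => w _; apply/esym/cvg_lim => //.
  rewrite EFinM; under eq_fun do rewrite EFinM.
  apply: cvgeZr => //.
  by apply: (cvg_nnsfun_approx (T := g_sigma_algebraType G)) => // x _; rewrite lee_fin.
have [-> cX] := lim X mX X0; have [-> cY] := lim Y mY Y0.
apply: lee_lim => //; apply: nearW => n; rewrite !term//.
by apply: lee_sum => y _; rewrite lee_wpmul2l ?lee_fin// XY.
Qed.

Lemma integrable_ge0_lty (X : Omega -> R) : measurable_fun setT X ->
  (forall w, 0 <= X w) -> (\int[P]_w (X w)%:E < +oo)%E ->
  P.-integrable setT (EFin \o X).
Proof.
move=> mX X0 fin; apply/integrableP; split; first exact/measurable_EFinP.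
by under eq_integral do rewrite /= ger0_norm//.
Qed.

(** In contrast with [condexp], the variable [Z] is itself measurable for [G];
    almost sure equality with the adjoint processes is kept apart. *)
Definition is_condexp D Z : Prop :=
  [/\ P.-integrable setT (EFin \o D), gmeas G Z,
      P.-integrable setT (EFin \o Z) &
      forall A, G A -> (\int[P]_(w in A) (Z w)%:E = \int[P]_(w in A) (D w)%:E)%E].

Lemma integrable_sub X A : measurable A -> P.-integrable setT (EFin \o X) ->
  P.-integrable A (EFin \o X).
Proof. by move=> mA iX; apply: (integrableS measurableT). Qed.

Lemma integrable_measurable X : P.-integrable setT (EFin \o X) ->
  measurable_fun setT X.
Proof. by move=> /measurable_int /measurable_EFinP. Qed.

(** On each of the events [Z >= 0] and [Z < 0], which belong to [G], the norm of
    [Z] is [Z] up to a constant sign. *)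
Lemma condexp_norm_le D Z A : is_condexp D Z -> G A ->
  (\int[P]_(w in A) `|Z w|%:E <= \int[P]_(w in A) `|D w|%:E)%E.
Proof.
move=> [iD mZ iZ hZ] GA.
have key (s : R) (C : set Omega) : `|s| = 1 -> G C ->
    (forall w, C w -> `|Z w| = s * Z w) ->
    (\int[P]_(w in C) `|Z w|%:E <= \int[P]_(w in C) `|D w|%:E)%E.
  move=> s1 GC hs; have mC := mG GC.
  have iDC := integrable_sub mC iD; have iZC := integrable_sub mC iZ.
  rewrite (eq_integral (fun w => s%:E * (Z w)%:E)%E); last first.
    by move=> w /set_mem Cw; rewrite hs.
  rewrite integralZl// hZ// -integralZl//.
  apply: le_trans (lee_abs _) _.
  apply: le_trans (le_abse_integral _ _ _) _ => //.
    by apply: measurable_funeM; exact: measurable_int iDC.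
  by under eq_integral do rewrite -EFinM /= normrM s1 mul1r.
have GP : G (Z @^-1` `[0, +oo[) by exact: gmeas_preimage.
have [G0 GC GU] := sG.
have GI B C : G B -> G C -> G (B `&` C).
  by have := @measurableI _ (g_sigma_algebraType G) B C; rewrite gmeasE; apply.
have GN : G (~` (Z @^-1` `[0, +oo[)) by rewrite -setTD; exact: GC.
have -> : A = (A `&` Z @^-1` `[0, +oo[) `|` (A `&` ~` (Z @^-1` `[0, +oo[)).
  by rewrite -setIUr setUv setIT.
have mabs Y B : measurable B -> measurable_fun setT Y ->
    measurable_fun B (fun w => `|Y w|%:E).
  move=> mB mY; apply/measurable_EFinP/measurableT_comp => //.
  exact: measurable_funS mY.
have disj : [disjoint A `&` Z @^-1` `[0, +oo[ & A `&` ~` (Z @^-1` `[0, +oo[)].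
  by apply/disj_setPS => w [[_ ?] [_ ?]].
have mPP := mG (GI _ _ GA GP); have mNN := mG (GI _ _ GA GN).
rewrite !ge0_integral_setU//; try by apply: mabs => //; try exact: measurableU;
  exact: integrable_measurable.
apply: leeD.
  apply: (key 1) => //; first by rewrite normr1.
    exact: GI.
  by move=> w [_]; rewrite /= in_itv/= andbT => z0; rewrite mul1r ger0_norm.
apply: (key (-1)) => //; first by rewrite normrN1.
  exact: GI.
move=> w [_]; rewrite /= in_itv/= andbT => /negP; rewrite -ltNge => z0.
by rewrite mulN1r ltr0_norm.
Qed.

Lemma condexp_weighted_norm_le D Z V : is_condexp D Z -> gmeas G V ->
  (forall w, 0 <= V w) ->
  (\int[P]_w (V w * `|Z w|)%:E <= \int[P]_w (V w * `|D w|)%:E)%E.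
Proof.
move=> cDZ mV V0; have [iD mZ iZ hZ] := cDZ.
apply: weighted_le => //.
- by apply: measurableT_comp => //; exact: integrable_measurable.
- by apply: measurableT_comp => //; exact: integrable_measurable.
- by move=> A GA; exact: condexp_norm_le.
Qed.

(** The weighted comparison of norms transfers integrability from [V * D] to
    [V * Z]. *)
Lemma condexp_mul_integrable D Z V : is_condexp D Z -> gmeas G V ->
  P.-integrable setT (EFin \o (fun w => V w * D w)) ->
  P.-integrable setT (EFin \o (fun w => V w * Z w)).
Proof.
move=> cDZ mV iVD; have [iD mZ iZ hZ] := cDZ.
have mVO := gmeas_measurable mV.
apply/integrableP; split.
  by apply/measurable_EFinP/measurable_funM => //; exact: gmeas_measurable.
have : (\int[P]_w (`|V w| * `|D w|)%:E < +oo)%E.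
  have /integrableP[_] := iVD.
  by under eq_integral do rewrite /= normrM.
apply: le_lt_trans; under eq_integral do rewrite /= normrM.
apply: condexp_weighted_norm_le => //.
exact: gmeas_norm.
Qed.

(** Adding [|D| + |Z|] to both sides makes them nonnegative, so that the
    comparison of weighted densities applies in both directions. *)
Lemma condexp_mul_ge0 D Z V : is_condexp D Z -> gmeas G V ->
  (forall w, 0 <= V w) ->
  P.-integrable setT (EFin \o (fun w => V w * D w)) ->
  \int[P]_w (V w * Z w) = \int[P]_w (V w * D w).
Proof.
move=> cDZ mV V0 iVD; have [iD mZ iZ hZ] := cDZ.
have iVZ := condexp_mul_integrable cDZ mV iVD.
pose S w := `|D w| + `|Z w|.
have iS : P.-integrable setT (EFin \o S).
  by have := integrableD measurableT (integrable_norm iD) (integrable_norm iZ).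
have iVS : P.-integrable setT (EFin \o (fun w => V w * S w)).
  have := integrableD measurableT (integrable_norm iVD) (integrable_norm iVZ).
  apply: eq_integrable => // w _ /=.
  by rewrite !normrM (ger0_norm (V0 w)) -EFinD -mulrDr.
have E X : P.-integrable setT (EFin \o X) ->
    P.-integrable setT (EFin \o (fun w => X w + S w)).
  by move=> iX; have := integrableD measurableT iX iS.
have D0 w : 0 <= D w + S w.
  by have := lerNnormlW (lexx `|D w|); have := normr_ge0 (Z w); rewrite /S; lra.
have Z0 w : 0 <= Z w + S w.
  by have := lerNnormlW (lexx `|Z w|); have := normr_ge0 (D w); rewrite /S; lra.
have eqA A : G A -> (\int[P]_(w in A) (Z w + S w)%:E = \int[P]_(w in A) (D w + S w)%:E)%E.
  move=> GA; have mA := mG GA.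
  under eq_integral do rewrite EFinD.
  under [in RHS]eq_integral do rewrite EFinD.
  by rewrite !integralD//; try exact: integrable_sub; rewrite hZ.
have : (\int[P]_w (V w * (Z w + S w))%:E = \int[P]_w (V w * (D w + S w))%:E)%E.
  have mD' := integrable_measurable (E _ iD).
  have mZ' := integrable_measurable (E _ iZ).
  by apply/eqP; rewrite eq_le; apply/andP; split;
    apply: weighted_le => // A GA; rewrite eqA.
move=> h; have : \int[P]_w (V w * Z w + V w * S w) = \int[P]_w (V w * D w + V w * S w).
  have rw X : \int[P]_w (V w * X w + V w * S w) = \int[P]_w (V w * (X w + S w)).
    by apply: eq_Rintegral => w _; rewrite -mulrDr.
  by rewrite !rw /Rintegral h.
by rewrite !RintegralD// => /addIr.
Qed.

Lemma condexp_mul D Z V : is_condexp D Z -> gmeas G V ->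
  P.-integrable setT (EFin \o (fun w => V w * D w)) ->
  \int[P]_w (V w * Z w) = \int[P]_w (V w * D w).
Proof.
move=> cDZ mV iVD; have [iD mZ iZ hZ] := cDZ.
pose Vp w := Num.max (V w) 0; pose Vn w := Num.max (- V w) 0.
have VE w : V w = Vp w - Vn w.
  by rewrite /Vp /Vn; case: (leP (V w) 0) => h;
    [rewrite max_l ?oppr_ge0// sub0r opprK|rewrite max_r ?subr0// oppr_le0 ltW].
have mVp : gmeas G Vp by exact: measurable_maxr.
have mVn : gmeas G Vn by apply: measurable_maxr => //; exact: measurable_funN.
have p0 w : 0 <= Vp w by rewrite /Vp le_max lexx orbT.
have n0 w : 0 <= Vn w by rewrite /Vn le_max lexx orbT.
have iD' (U : Omega -> R) : gmeas G U -> (forall w, `|U w| <= `|V w|) ->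
    P.-integrable setT (EFin \o (fun w => U w * D w)).
  move=> mU hU; apply: le_integrable iVD => //.
    apply/measurable_EFinP/measurable_funM; first exact: gmeas_measurable.
    exact: integrable_measurable.
  by move=> w _ /=; rewrite lee_fin !normrM ler_wpM2r.
have ip : P.-integrable setT (EFin \o (fun w => Vp w * D w)).
  apply: iD' => // w; rewrite ger0_norm// /Vp ge_max ler_norm.
  exact: normr_ge0.
have jn : P.-integrable setT (EFin \o (fun w => Vn w * D w)).
  apply: iD' => // w; rewrite ger0_norm// /Vn ge_max -normrN ler_norm.
  exact: normr_ge0.
have ipZ := condexp_mul_integrable cDZ mVp ip.
have jnZ := condexp_mul_integrable cDZ mVn jn.
under eq_Rintegral do rewrite VE mulrBl.
under [RHS]eq_Rintegral do rewrite VE mulrBl.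
by rewrite !RintegralB// !(condexp_mul_ge0 cDZ).
Qed.

(** Duality: testing [|Z|] against its own truncations bounds its second
    moment, because the quadratic term is absorbed by the left-hand side. *)
Lemma condexp_sqr_le D Z (c : R) : is_condexp D Z ->
  (forall V K, gmeas G V -> (forall w, 0 <= V w <= K) ->
     \int[P]_w (V w * `|D w|) <= c + 2^-1 * \int[P]_w (V w ^+ 2)) ->
  P.-integrable setT (EFin \o (fun w => Z w ^+ 2)).
Proof.
move=> cDZ hc; have [iD mZ iZ hZ] := cDZ.
have mZO := gmeas_measurable mZ.
pose V (n : nat) w := Num.min `|Z w| n%:R.
have V01 n w : 0 <= V n w <= n%:R.
  by rewrite /V le_min normr_ge0 ler0n ge_min lexx orbT.
have mV n : gmeas G (V n).
  apply: measurable_minr => //.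
  exact: gmeas_norm.
have mVO n := gmeas_measurable (mV n).
have VK n w : `|V n w| <= n%:R.
  by have /andP[? ?] := V01 n w; rewrite ger0_norm.
have iV2 n : P.-integrable setT (EFin \o (fun w => V n w ^+ 2)).
  apply: (@bounded_integrable _ _ _ _ _ (n%:R ^+ 2)).
    exact: measurable_funX.
  by move=> w; rewrite normrX lerXn2r ?nnegrE.
have iVm n (X : Omega -> R) : P.-integrable setT (EFin \o X) ->
    P.-integrable setT (EFin \o (fun w => V n w * `|X w|)).
  move=> iX; have := integrableZl measurableT n%:R (integrable_norm iX).
  apply: le_integrable => //.
    apply/measurable_EFinP/measurable_funM => //.
    by apply: measurableT_comp => //; exact: integrable_measurable.
  by move=> w _ /=; rewrite lee_fin !normrM !normr_id normr_nat ler_wpM2r.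
have bound n : \int[P]_w (V n w ^+ 2) <= 2 * c.
  have h1 : \int[P]_w (V n w ^+ 2) <= \int[P]_w (V n w * `|Z w|).
    apply: le_Rintegral => //; first exact: iVm.
    move=> w _; have /andP[v0 _] := V01 n w; rewrite expr2 ler_wpM2l//.
    by rewrite /V ge_min lexx.
  have h2 : \int[P]_w (V n w * `|Z w|) <= \int[P]_w (V n w * `|D w|).
    rewrite -lee_fin /Rintegral !fineK; try exact: integrable_fin_num (iVm _ _ _).
    by apply: condexp_weighted_norm_le => // w; have /andP[] := V01 n w.
  by have := hc _ _ (mV n) (V01 n); lra.
apply: integrable_ge0_lty => [||]; first exact: measurable_funX.
  by move=> w; exact: sqr_ge0.
apply: (@le_lt_trans _ _ (2 * c)%:E); last exact: ltry.
rewrite (_ : (\int[P]_w _ = limn (fun n => \int[P]_w (V n w ^+ 2)%:E))%E); last first.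
  have nd w : nondecreasing_seq (fun n => (V n w ^+ 2)%:E).
    move=> a b ab; rewrite lee_fin; have /andP[a0 _] := V01 a w.
    have /andP[b0 _] := V01 b w; rewrite lerXn2r ?nnegrE//.
    by rewrite /V le_min !ge_min lexx/= ler_nat ab orbT.
  rewrite -monotone_convergence//; last 2 first.
  - by move=> n; apply/measurable_EFinP; exact: measurable_funX.
  - by move=> n w _; rewrite lee_fin sqr_ge0.
  apply: eq_integral => w _; apply/esym/cvg_lim => //; apply: cvg_near_cst; near=> n.
  rewrite /V min_l ?real_normK ?num_real//.
  by near: n; exact: nbhs_infty_ger.
apply: lime_le; last first.
  apply: nearW => n; rewrite -(fineK (integrable_fin_num _ (iV2 n)))// lee_fin.
  exact: bound.
apply: ereal_nondecreasing_is_cvgn => a b ab.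
have mV2 n : measurable_fun setT (fun w => (V n w ^+ 2)%:E).
  by apply/measurable_EFinP; exact: measurable_funX.
apply: ge0_le_integral => //; try by move=> w _; rewrite lee_fin sqr_ge0.
move=> w _; rewrite lee_fin; have /andP[a0 _] := V01 a w.
have /andP[b0 _] := V01 b w; rewrite lerXn2r ?nnegrE//.
by rewrite /V le_min !ge_min lexx/= ler_nat ab orbT.
Unshelve. all: by end_near.
Qed.

End SubSigmaAlgebra.

(** * Square integrable random variables *)

Section SquareIntegrable.
Variables (R : realType) (disp : measure_display) (Omega : measurableType disp).
Variable P : probability Omega R.
Implicit Types X Y : Omega -> R.

Definition L2 X : Prop :=
  measurable_fun setT X /\ P.-integrable setT (EFin \o (fun w => X w ^+ 2)).

Lemma integrableDr X Y : P.-integrable setT (EFin \o X) ->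
  P.-integrable setT (EFin \o Y) ->
  P.-integrable setT (EFin \o (fun w => X w + Y w)).
Proof. by move=> iX iY; have := integrableD measurableT iX iY. Qed.

Lemma integrableBr X Y : P.-integrable setT (EFin \o X) ->
  P.-integrable setT (EFin \o Y) ->
  P.-integrable setT (EFin \o (fun w => X w - Y w)).
Proof. by move=> iX iY; have := integrableB measurableT iX iY. Qed.

Lemma integrable_scale X (r : R) : P.-integrable setT (EFin \o X) ->
  P.-integrable setT (EFin \o (fun w => r * X w)).
Proof. by move=> iX; have := integrableZl measurableT r iX. Qed.

Lemma integrable_sumr (I : Type) (s : seq I) (X : I -> Omega -> R) :
  (forall i, P.-integrable setT (EFin \o X i)) ->
  P.-integrable setT (EFin \o (fun w => \sum_(i <- s) X i w)).
Proof.
move=> iX; have := integrable_sum measurableT s (P := xpredT) (fun i _ => iX i).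
by apply: eq_integrable => // w _; rewrite sumEFin.
Qed.

Lemma Rintegral_sumr (I : Type) (s : seq I) (X : I -> Omega -> R) :
  (forall i, P.-integrable setT (EFin \o X i)) ->
  \int[P]_w (\sum_(i <- s) X i w) = \sum_(i <- s) \int[P]_w X i w.
Proof.
move=> iX; elim: s => [|i s IH].
  rewrite big_nil; under eq_Rintegral do rewrite big_nil.
  exact: Rintegral_cst_proba.
rewrite big_cons -IH -RintegralD//; last exact: integrable_sumr.
by under eq_Rintegral do rewrite big_cons.
Qed.

Lemma le_integrable_r X Y : measurable_fun setT Y -> (forall w, `|Y w| <= X w) ->
  P.-integrable setT (EFin \o X) -> P.-integrable setT (EFin \o Y).
Proof.
move=> mY YX; apply: le_integrable => //; first exact/measurable_EFinP.
by move=> w _ /=; rewrite lee_fin (le_trans (YX w))// ler_norm.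
Qed.

Lemma mul_le_sqr (x y : R) : `|x * y| <= x ^+ 2 + y ^+ 2.
Proof.
have := sqr_ge0 (x - y); have := sqr_ge0 (x + y).
have := sqr_ge0 x; have := sqr_ge0 y.
rewrite sqrrD sqrrB => h1 h2 h3 h4; rewrite ler_norml.
by apply/andP; split; lra.
Qed.

Lemma L2_mul X Y : L2 X -> L2 Y -> P.-integrable setT (EFin \o (fun w => X w * Y w)).
Proof.
move=> [mX iX] [mY iY]; apply: le_integrable_r (integrableDr iX iY).
  exact: measurable_funM.
by move=> w; exact: mul_le_sqr.
Qed.

Lemma L2_cst (r : R) : L2 (fun _ => r).
Proof. by split => //; exact: finite_measure_integrable_cst. Qed.

Lemma L2_integrable X : L2 X -> P.-integrable setT (EFin \o X).
Proof.
move=> LX; have := L2_mul LX (L2_cst 1).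
by under eq_fun do rewrite mulr1.
Qed.

Lemma L2_le_ae X Y : measurable_fun setT Y -> L2 X ->
  {ae P, forall w, `|Y w| <= `|X w|} -> L2 Y.
Proof.
move=> mY [mX iX] YX; split => //.
have mY2 : measurable_fun setT (fun w => Y w ^+ 2) by exact: measurable_funX.
have mX2 : measurable_fun setT (fun w => X w ^+ 2) by exact: measurable_funX.
apply: integrable_ge0_lty => // [w|]; first exact: sqr_ge0.
apply: (@le_lt_trans _ _ (\int[P]_w (X w ^+ 2)%:E)%E).
  apply: ae_ge0_le_integral => //; try exact/measurable_EFinP;
    try by move=> w _; rewrite lee_fin sqr_ge0.
  apply: filterS YX => w h _; rewrite lee_fin -(real_normK (num_real (Y w))).
  by rewrite -(real_normK (num_real (X w))) lerXn2r ?nnegrE.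
by rewrite -ge0_fin_numE ?integral_ge0 ?(integrable_fin_num _ iX)// => w _;
  rewrite lee_fin sqr_ge0.
Qed.

Lemma L2_le X Y : measurable_fun setT Y -> L2 X ->
  (forall w, `|Y w| <= `|X w|) -> L2 Y.
Proof. by move=> mY LX YX; apply: (L2_le_ae mY LX); exact: aeW. Qed.

Lemma L2D X Y : L2 X -> L2 Y -> L2 (fun w => X w + Y w).
Proof.
move=> LX LY; have [mX iX] := LX; have [mY iY] := LY.
have mXY : measurable_fun setT (fun w => X w + Y w) by exact: measurable_funD.
split => //; apply: le_integrable_r (integrable_scale 2 (integrableDr iX iY)).
  exact: measurable_funX.
move=> w; rewrite ger0_norm ?sqr_ge0//; have := sqr_ge0 (X w - Y w).
by rewrite sqrrB sqrrD; lra.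
Qed.

Lemma L2Z X (r : R) : L2 X -> L2 (fun w => r * X w).
Proof.
move=> [mX iX]; split; first exact: measurable_funM.
by under eq_fun do rewrite exprMn; exact: integrable_scale.
Qed.

Lemma L2B X Y : L2 X -> L2 Y -> L2 (fun w => X w - Y w).
Proof.
move=> LX LY; have := L2D LX (L2Z (-1) LY).
by under eq_fun do rewrite mulN1r.
Qed.

Lemma L2_norm X : L2 X -> L2 (fun w => `|X w|).
Proof.
move=> LX; apply: (L2_le _ LX) => [|w]; last by rewrite normr_id.
by apply: measurableT_comp => //; case: LX.
Qed.

Lemma L2_sum (I : Type) (s : seq I) (X : I -> Omega -> R) :
  (forall i, L2 (X i)) -> L2 (fun w => \sum_(i <- s) X i w).
Proof.
move=> LX; elim: s => [|i s IH].
  by under eq_fun do rewrite big_nil; exact: L2_cst.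
by under eq_fun do rewrite big_cons; exact: L2D.
Qed.

End SquareIntegrable.

(** * The completed filtration *)

Section Filtration.
Variables (R : realType) (disp : measure_display) (Omega : measurableType disp).
Variables (d : nat) (Theta : Type) (N : nat).
Variables (F : Theta -> probability (borel 'cV[R]_d) R).
Variable W : nat -> Omega -> 'cV[R]_d.
Hypothesis hFN : (@measurable _ Omega : set (set Omega)) = Fsig W N.
Variable P : probability Omega R.

(** The past up to time [k], enlarged by the measurable [P]-null sets: random
    variables given up to almost sure equality become genuinely measurable. *)
Definition Gsig (k : nat) : set (set Omega) :=
  [set A | measurable A /\
     exists2 B, Fsig W k B & {ae P, forall w, A w <-> B w}].

Lemma sigma_algebra_Gsig k : sigma_algebra setT (Gsig k).
Proof.
have [F0 FC FU] : sigma_algebra setT (Fsig W k).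
  exact: smallest_sigma_algebra.
split.
- by split => //; exists set0 => //; exact: aeW.
- move=> A [mA [B FB AB]]; split; first exact: measurableD.
  exists (setT `\` B); first exact: FC.
  by apply: filterS AB => w h; split=> -[_ n]; split => // /h.
- move=> A hA; have hB n := (hA n).2; split.
    by apply: bigcup_measurable => n _; case: (hA n).
  pose B n := s2val (cid2 (hB n)).
  exists (\bigcup_n B n).
    by apply: FU => n; exact: (s2valP (cid2 (hB n))).
  have : {ae P, forall w, forall n, A n w <-> B n w}.
    by apply: ae_foralln => n; exact: (s2valP' (cid2 (hB n))).
  by apply: filterS => w h; split=> -[n _ /h]; exists n.
Qed.

Lemma Gsig_measurable k : Gsig k `<=` measurable.
Proof. by move=> A []. Qed.

Lemma Gsig_mono j k : (j <= k)%N -> Gsig j `<=` Gsig k.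
Proof.
by move=> jk A [mA [B FB AB]]; split => //; exists B => //; exact: Fsig_mono FB.
Qed.

Lemma gmeas_mono j k (X : Omega -> R) : (j <= k)%N ->
  gmeas (Gsig j) X -> gmeas (Gsig k) X.
Proof.
move=> jk mX _ B mB; rewrite (gmeasE (sigma_algebra_Gsig k)) setTI.
apply: (Gsig_mono jk); apply: gmeas_preimage => //.
exact: sigma_algebra_Gsig.
Qed.

Lemma gmeas_ae k (X Z : Omega -> R) : (k <= N)%N -> measurable_fun setT X ->
  measurable_Fsig W k Z -> {ae P, forall w, X w = Z w} -> gmeas (Gsig k) X.
Proof.
move=> kN mX mZ XZ _ B mB; rewrite (gmeasE (sigma_algebra_Gsig k)) setTI.
split; first by rewrite -[X in measurable X]setTI; exact: mX.
exists (Z @^-1` B); first exact: mZ.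
by apply: filterS XZ => w /= ->.
Qed.

Lemma gmeas_Fsig k (Z : Omega -> R) : (k <= N)%N -> measurable_Fsig W k Z ->
  gmeas (Gsig k) Z.
Proof.
move=> kN mZ; apply: (gmeas_ae kN _ mZ); last exact: aeW.
exact: (measurable_Fsig_fun hFN kN).
Qed.

Lemma gmeas_noise k l : (1 <= k <= N)%N -> gmeas (Gsig k) (fun w => W k w l 0).
Proof.
move=> /andP[k1 kN]; apply: gmeas_Fsig => // B mB.
apply: sub_sigma_algebra.
exists k, ((fun y => y l 0) @^-1` B : set (borel 'cV[R]_d)); split => //.
  by rewrite k1 leqnn.
by rewrite -[X in measurable X]setTI; exact: entry_borel_measurable.
Qed.

Lemma polar_ae B : Pset N F W P -> polar N F W B -> {ae P, forall w, ~ B w}.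
Proof.
move=> hP [mB pB]; exists B; split => //; last by move=> w /= /contrapT.
apply/eqP; rewrite eq_le measure_ge0 andbT -pB.
by apply: ereal_sup_ubound; exists P.
Qed.

Lemma gmeas_Lc p k X : (k <= N)%N -> Pset N F W P -> Lc N F W p k X ->
  gmeas (Gsig k) X.
Proof.
move=> kN hP [mX [Z [mZ [B pB XZ] _ _]]].
apply: (gmeas_ae kN mX mZ); apply: filterS (polar_ae hP pB) => w; exact: XZ.
Qed.

Lemma L2_Lc k X : (k <= N)%N -> Pset N F W P -> Lc N F W 2 k X -> L2 P X.
Proof.
move=> kN hP LX; have [mX _] := LX; split => //.
have [c _ hc] := Lc_second_moment hFN kN LX.
apply: integrable_ge0_lty => [||]; first exact: measurable_funX.
  by move=> w; exact: sqr_ge0.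
exact: le_lt_trans (hc _ hP) (ltry _).
Qed.

Lemma integrable_Lc k X : (k <= N)%N -> Pset N F W P -> Lc N F W 1 k X ->
  P.-integrable setT (EFin \o X).
Proof.
move=> kN hP [mX [Z [mZ [B pB XZ] fin _]]].
have mZ' := measurable_Fsig_fun hFN kN mZ.
apply/integrableP; split; first exact/measurable_EFinP.
have -> : (\int[P]_w `|(EFin \o X) w| = \int[P]_w `|(EFin \o Z) w|)%E.
  apply: ae_eq_integral => //.
  - by apply/measurable_EFinP; apply: measurableT_comp.
  - by apply/measurable_EFinP; apply: measurableT_comp.
  - by apply: filterS (polar_ae hP pB) => w h _ /=; rewrite XZ.
apply: le_lt_trans fin; apply: ereal_sup_ubound; exists P => //.
by rewrite unlock; apply: eq_integral => w _; rewrite /= expr1.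
Qed.

Lemma integral_ae_set (A B : set Omega) (X : Omega -> R) : measurable A ->
  measurable B -> measurable_fun setT X -> {ae P, forall w, A w <-> B w} ->
  (\int[P]_(w in A) (X w)%:E = \int[P]_(w in B) (X w)%:E)%E.
Proof.
move=> mA mB mX AB; rewrite integral_mkcond [RHS]integral_mkcond.
have mr C : measurable C -> measurable_fun setT ((fun w => (X w)%:E) \_ C).
  move=> mC; apply/(measurable_restrictT _ mC).
  by apply/measurable_EFinP; exact: measurable_funS mX.
apply: ae_eq_integral => //; try exact: mr.
apply: filterS AB => w [h1 h2] _; rewrite !patchE.
have [Aw|nA] := pselect (A w); first by rewrite !mem_set//; exact: h1.
by rewrite !memNset// => /h2.
Qed.

Lemma is_condexp_condexp k X Y : (k <= N)%N -> condexp W P k X Y ->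
  exists2 Z, is_condexp P (Gsig k) X Z & {ae P, forall w, Y w = Z w}.
Proof.
move=> kN [iX [Z [mZ iZ hZ YZ]]]; exists Z => //; split => //.
  exact: gmeas_Fsig.
move=> A [mA [B FB AB]]; have mB := Fsig_measurable hFN kN FB.
rewrite (integral_ae_set mA mB (integrable_measurable iZ) AB) hZ//.
by rewrite (integral_ae_set mA mB (integrable_measurable iX) AB).
Qed.

Section NoiseBound.
Hypothesis hP : Pset N F W P.
Hypothesis hA3 : assumption_A3 N F W.
Hypothesis hW : forall k, (1 <= k <= N)%N -> Lc_mx N F W 2 k (W k).

(** The second moments of the one-step laws share the constant [c] because they
    are marginals of models in the uncertainty set; hence so do the conditional
    second moments, and a weight from the past can be integrated against them. *)
Lemma noise_second_moment k l : (k < N)%N -> exists2 c : R, 0 <= c &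
  forall V, gmeas (Gsig k) V -> L2 P V ->
    L2 P (fun w => V w * W k.+1 w l 0) /\
    \int[P]_w (V w * W k.+1 w l 0) ^+ 2 <= c * \int[P]_w (V w ^+ 2).
Proof.
move=> kN; have LW := hW (k := k.+1) kN l 0.
have [c c0 hc] := Lc_second_moment hFN kN LW; exists c => //.
have mW := measurable_noise_entry hFN l (kN : 1 <= k.+1 <= N)%N.
have hF K t : 0 <= K -> \int[F t]_y trunc_sq K l y <= c.
  move=> K0; have cg := CbLip_trunc_sq l K0.
  have [P' hP' <-] := marginal_in_Pset hFN hA3 t kN cg.
  have [[M hM] _] := cg.
  have iT : P'.-integrable setT (EFin \o (fun w => trunc_sq K l (W k.+1 w))).
    apply: (@bounded_integrable _ _ _ _ _ M) => // .
    exact: measurableT_comp (CbLip_measurable cg) (measurable_noise hFN _).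
  rewrite -lee_fin /Rintegral fineK ?(integrable_fin_num _ iT)//.
  apply: le_trans (hc _ hP'); apply: ge0_le_integral => //;
    try by move=> w _; rewrite lee_fin sqr_ge0.
  - by case/integrableP: iT.
  - by apply/measurable_EFinP; exact: measurable_funX.
  - move=> w _; rewrite lee_fin /trunc_sq -[leRHS](real_normK (num_real _)).
    by rewrite lerXn2r ?nnegrE ?le_min ?normr_ge0 ?K0// ge_min lexx.
move=> V mV LV; have [mVO iV2] := LV.
have mW2 : measurable_fun setT (fun w => (W k.+1 w l 0) ^+ 2).
  exact: measurable_funX.
have le : (\int[P]_w (V w ^+ 2 * (W k.+1 w l 0) ^+ 2)%:E <=
           \int[P]_w (V w ^+ 2 * c)%:E)%E.
  apply: (weighted_le (sigma_algebra_Gsig k) (@Gsig_measurable k)) => //.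
  - by move=> w; exact: sqr_ge0.
  - move=> A [mA [B FB AB]]; have mB := Fsig_measurable hFN (ltnW kN) FB.
    rewrite !(integral_ae_set mA mB _ AB)// integral_cst//.
    exact: (cond_second_moment hFN kN hP hF FB).
  - exact: measurable_funX.
  - by move=> w; exact: sqr_ge0.
have ic := integrable_scale c iV2.
have E : (\int[P]_w (V w ^+ 2 * c)%:E = (c * \int[P]_w (V w ^+ 2))%:E)%E.
  rewrite -RintegralZl// /Rintegral fineK ?(integrable_fin_num _ ic)//.
  by apply: eq_integral => w _; rewrite mulrC.
have L : L2 P (fun w => V w * W k.+1 w l 0).
  split; first exact: measurable_funM.
  apply: integrable_ge0_lty => [||].
  - by apply: measurable_funX; exact: measurable_funM.
  - by move=> w; exact: sqr_ge0.
  - under eq_integral do rewrite exprMn.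
    by apply: le_lt_trans le _; rewrite E ltry.
split => //; have [_ i2] := L.
rewrite -lee_fin -E /Rintegral fineK ?(integrable_fin_num _ i2)//.
by under eq_integral do rewrite exprMn.
Qed.

End NoiseBound.

End Filtration.

(** * Gradients, convexity and mean values *)

Section Frechet.
Variables (R : realType) (a : nat).
Implicit Types (D : set 'cV[R]_a) (h : 'cV[R]_a -> R) (z v : 'cV[R]_a) (r : 'rV[R]_a).

(** Scalar fields suffice: the entries of [b] and [sigma] are treated one by one,
    and the Hamiltonian is scalar. *)
Definition has_grad D h z r : Prop :=
  forall e : R, 0 < e -> exists2 delta : R, 0 < delta &
    forall z', D z' -> sumnorm (z' - z) < delta ->
      `|h z' - h z - (r *m (z' - z)) 0 0| <= e * sumnorm (z' - z).

Lemma has_gradD D h1 h2 z r1 r2 : has_grad D h1 z r1 -> has_grad D h2 z r2 ->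
  has_grad D (fun y => h1 y + h2 y) z (r1 + r2).
Proof.
move=> H1 H2 e e0; have e20 : 0 < e / 2 by rewrite divr_gt0.
have [d1 d10 h1d] := H1 _ e20; have [d2 d20 h2d] := H2 _ e20.
exists (Num.min d1 d2); first by rewrite lt_min d10.
move=> z' Dz'; rewrite lt_min => /andP[z1 z2].
rewrite mulmxDl mxE [e]splitr mulrDl.
have -> (x1 x2 y1 y2 s1 s2 : R) : x1 + x2 - (y1 + y2) - (s1 + s2) =
  (x1 - y1 - s1) + (x2 - y2 - s2) by ring.
by rewrite (le_trans (ler_normD _ _))// lerD// ?h1d// h2d.
Qed.

Lemma has_grad0 D z : has_grad D (fun _ => 0) z 0.
Proof.
move=> e e0; exists 1 => // z' _ _.
by rewrite mul0mx mxE !subrr normr0 mulr_ge0 ?sumnorm_ge0 ?ltW.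
Qed.

Lemma has_grad_sum (I : Type) (s : seq I) D (h : I -> 'cV[R]_a -> R) z
    (r : I -> 'rV[R]_a) :
  (forall i, has_grad D (h i) z (r i)) ->
  has_grad D (fun y => \sum_(i <- s) h i y) z (\sum_(i <- s) r i).
Proof.
move=> H; elim: s => [|i s IH].
  by under eq_fun do rewrite big_nil; rewrite big_nil; exact: has_grad0.
by under eq_fun do rewrite big_cons; rewrite big_cons; exact: has_gradD.
Qed.

Lemma has_grad_jacobian c D (g : 'cV[R]_a -> 'cV[R]_c) z A (p : 'rV[R]_c) :
  is_jacobian D g z A -> has_grad D (fun y => (p *m g y) 0 0) z (p *m A).
Proof.
move=> H e e0; pose K := enorm p * (c * 1)%:R + 1.
have K0 : 0 < K by rewrite ltr_wpDl// mulr_ge0 ?enorm_ge0.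
pose K' := (a * 1)%:R + 1 : R; have K'0 : 0 < K' by rewrite ltr_wpDl.
have [d d0 hd] := H (e / K) ltac:(by rewrite divr_gt0).
exists d => // z' Dz' hz.
have -> : (p *m g z') 0 0 - (p *m g z) 0 0 - (p *m A *m (z' - z)) 0 0 =
    (p *m (g z' - g z - A *m (z' - z))) 0 0.
  by rewrite -mulmxA !mulmxBr !mxE.
rewrite (le_trans (le_sumnorm_mulmx _ _ _))//.
set E := g z' - g z - _.
have hE : enorm E <= e / K * sumnorm (z' - z).
  rewrite (le_trans (hd _ Dz' (le_lt_trans (enorm_le_sumnorm _) hz)))//.
  by rewrite ler_wpM2l ?enorm_le_sumnorm// ltW// divr_gt0.
apply: (@le_trans _ _ (enorm p * ((c * 1)%:R * (e / K * sumnorm (z' - z))))).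
  rewrite ler_wpM2l ?enorm_ge0// (le_trans (sumnorm_le_enorm _))//.
  by rewrite ler_wpM2l.
rewrite !mulrA ler_wpM2r ?sumnorm_ge0// ler_pdivrMr// mulrC ler_wpM2l ?(ltW e0)//.
by rewrite /K lerDl.
Qed.

Lemma has_grad_continuous D h z r : has_grad D h z r ->
  forall e : R, 0 < e -> exists2 delta : R, 0 < delta &
    forall z', D z' -> sumnorm (z' - z) < delta -> `|h z' - h z| < e.
Proof.
move=> H e e0; have [d d0 hd] := H 1 ltr01.
pose K := enorm r + 2; have K0 : 0 < K by rewrite ltr_wpDl ?enorm_ge0.
exists (Num.min d (e / K)); first by rewrite lt_min d0 divr_gt0.
move=> z' Dz'; rewrite lt_min => /andP[z1 z2].
have h1 := hd _ Dz' z1; rewrite mul1r in h1.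
have h2 := le_sumnorm_mulmx r (z' - z) 0.
rewrite -[_ - _](subrK ((r *m (z' - z)) 0 0)) (le_lt_trans (ler_normD _ _))//.
rewrite (le_lt_trans (lerD h1 h2))//.
rewrite -[X in X + _]mul1r -mulrDl.
apply: (@le_lt_trans _ _ (sumnorm (z' - z) * K)).
  by rewrite mulrC ler_wpM2l ?sumnorm_ge0// /K addrC lerD2l ler1n.
by rewrite -ltr_pdivlMr.
Qed.

(** The tangent plane of a convex function lies below its graph: compare the
    chord with the first-order expansion at a point close to [z]. *)
Lemma convex_above_tangent D h z z' r : has_grad D h z r ->
  (forall t : R, 0 < t -> t <= 1 -> D (z + t *: (z' - z)) /\
     h (z + t *: (z' - z)) <= t * h z' + (1 - t) * h z) ->
  (r *m (z' - z)) 0 0 <= h z' - h z.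
Proof.
move=> H hc; set v := z' - z.
have V0 := sumnorm_ge0 v; set S := sumnorm v in V0.
apply/ler_addgt0Pr => e e0.
have e1 : 0 < e / (S + 1) by rewrite divr_gt0// ltr_wpDl.
have [d d0 hd] := H _ e1.
(* The step [t] keeps the point on the segment and within [d] of [z]. *)
pose t := Num.min 1 (d / (2 * (S + 1))).
have dS : 0 < d / (2 * (S + 1)) by rewrite divr_gt0// mulr_gt0// ltr_wpDl.
have t0 : 0 < t by rewrite lt_min ltr01.
have t1 : t <= 1 by rewrite ge_min lexx.
have tS : t * S < d.
  have : t <= d / (2 * (S + 1)) by rewrite ge_min lexx orbT.
  rewrite ler_pdivlMr ?mulr_gt0 ?ltr_wpDl// => ht.
  have : 0 <= t * S by rewrite mulr_ge0// ltW.
  by lra.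
have [Dz ht] := hc t t0 t1; have := hd _ Dz.
rewrite addrC addKr sumnormZ (gtr0_norm t0) -/S -scalemxAr mxE => /(_ tS).
rewrite ler_norml => /andP[lo _].
have eS : e / (S + 1) * (t * S) <= t * e.
  have -> : e / (S + 1) * (t * S) = t * (e * (S / (S + 1))) by ring.
  rewrite ler_wpM2l ?(ltW t0)// ler_piMr ?(ltW e0)//.
  by rewrite ler_pdivrMr ?ltr_wpDl// mul1r lerDl.
rewrite -(ler_pM2l t0) mulrDr mulrBr; rewrite -[z + t *: v]addrC in lo *.
have {}ht : h (t *: v + z) <= t * h z' + (1 - t) * h z by rewrite addrC.
lra.
Qed.

(** Clamping the parameter extends the function from the segment to a continuous
    function on the real line; its derivative matters only at interior points,
    where the clamp is locally the identity. *)
Lemma mean_value_bound D h z z' (r : 'cV[R]_a -> 'rV[R]_a) (K : R) :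
  (forall t : R, 0 <= t <= 1 -> D (z + t *: (z' - z)) /\
     has_grad D h (z + t *: (z' - z)) (r (z + t *: (z' - z))) /\
     `|(r (z + t *: (z' - z)) *m (z' - z)) 0 0| <= K) ->
  `|h z' - h z| <= K.
Proof.
move=> H; set v := z' - z in H *; set S := sumnorm v.
have S0 : 0 <= S by exact: sumnorm_ge0.
have K0 : 0 <= K.
  have [_ [_ hK]] := H 0 ltac:(by rewrite lexx ler01).
  exact: le_trans (normr_ge0 _) hK.
pose y (t : R) := z + clamp t *: v.
pose phi t := h (y t).
have yB s t : y s - y t = (clamp s - clamp t) *: v.
  by rewrite /y opprD addrACA subrr add0r scalerBl.
have snB s t : sumnorm (y s - y t) <= `|s - t| * S.
  by rewrite yB sumnormZ ler_wpM2r// clamp_lipschitz.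
have cphi : continuous phi.
  move=> t; apply/cvgrPdist_lt => e e0.
  have [_ [/has_grad_continuous /(_ _ e0)[d d0 hd] _]] := H _ (clamp_bounds t).
  apply/nbhs_ballP; exists (d / (S + 1)) => /=; first by rewrite divr_gt0// ltr_wpDl.
  move=> s; rewrite /ball/= => hs; rewrite distrC; apply: hd.
    by have [] := H _ (clamp_bounds s).
  apply: le_lt_trans (snB s t) _; rewrite distrC.
  apply: (@le_lt_trans _ _ (`|t - s| * (S + 1))); first by rewrite ler_wpM2l// lerDl.
  by rewrite -ltr_pdivlMr// ltr_wpDl.
have clampE (t : R) : 0 <= t <= 1 -> clamp t = t.
  by move=> /andP[t0 t1]; rewrite /clamp min_r// max_r.
have dphi (t : R) : t \in `]0, 1[ -> is_derive t 1 phi ((r (z + t *: v) *m v) 0 0).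
  rewrite in_itv/= => /andP[t0 t1].
  have t01 : 0 <= t <= 1 by rewrite !ltW.
  have yt : y t = z + t *: v by rewrite /y clampE.
  suff lim : (s^-1 *: ((phi \o shift t) (s *: 1) - phi t)) @[s --> 0^'] -->
      (r (z + t *: v) *m v) 0 0.
    by apply: DeriveDef; [apply: cvgP lim|exact: cvg_lim lim].
  apply/cvgrPdist_le => e e0.
  have e1 : 0 < e / (S + 1) by rewrite divr_gt0// ltr_wpDl.
  have [_ [G _]] := H _ t01; have [d d0 hd] := G _ e1.
  near=> s.
  have s0 : s != 0 by near: s; exact: nbhs_dnbhs_neq.
  have sd : `|s| < d / (S + 1).
    near: s; apply/nbhs_ballP; exists (d / (S + 1)) => /=.
      by rewrite divr_gt0// ltr_wpDl.
    by move=> s; rewrite /ball/= sub0r normrN.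
  have st : `|s| < Num.min t (1 - t).
    near: s; apply/nbhs_ballP; exists (Num.min t (1 - t)) => /=.
      by rewrite lt_min t0 subr_gt0.
    by move=> s; rewrite /ball/= sub0r normrN.
  rewrite /= /phi [s *: 1]mulr1 /shift.
  have st01 : 0 <= s + t <= 1.
    move: st; rewrite lt_min !ltr_norml => /andP[/andP[h1 h2] /andP[h3 h4]].
    by apply/andP; split; lra.
  have yst : y (s + t) - (z + t *: v) = s *: v by rewrite -yt yB !clampE// addrK.
  have := hd (y (s + t)) (H _ (clamp_bounds _)).1.
  rewrite yst sumnormZ => /(_ _); rewrite -scalemxAr mxE yt => bnd.
  rewrite -[leLHS]mul1r -[X in X * _](@mulVf _ `|s|) ?normr_eq0// -mulrA.
  rewrite ler_pdivrMl ?normr_gt0// -normrM mulrBr.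
  rewrite [s * (s^-1 *: _)]mulrA mulfV// mul1r distrC.
  apply: le_trans (bnd _) _.
    apply: (@le_lt_trans _ _ (`|s| * (S + 1))); first by rewrite ler_wpM2l// lerDl.
    by rewrite -ltr_pdivlMr// ltr_wpDl.
  have -> : e / (S + 1) * (`|s| * S) = `|s| * (e * (S / (S + 1))) by ring.
  rewrite ler_wpM2l// ler_piMr ?(ltW e0)//.
  by rewrite ler_pdivrMr ?ltr_wpDl// mul1r lerDl.
have [c] := MVT ltr01 dphi (continuous_subspaceT cphi).
rewrite in_itv/= subr0 mulr1 => /andP[c0 c1].
rewrite /phi /y !clampE ?lexx ?ler01// scale0r addr0 scale1r.
have -> : z + v = z' by rewrite /v addrC subrK.
move=> ->.
have c01 : 0 <= c <= 1 by rewrite !ltW.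
by have [_ [_]] := H _ c01.
Unshelve. all: by end_near.
Qed.

End Frechet.

(** * Measurable substitution into a random field *)

Lemma measurable_sumnorm (d : measure_display) (T : measurableType d)
    (R : realType) a (Z : T -> 'cV[R]_a) :
  (forall i, measurable_fun setT (fun w => Z w i 0)) ->
  measurable_fun setT (fun w => sumnorm (Z w)).
Proof.
move=> mZ; under eq_fun do rewrite sumnorm_cV.
by apply: measurable_sum => i; apply: measurableT_comp.
Qed.

(** Continuity in the parameter makes substitution of a measurable process
    measurable: round the process to a dense sequence and pass to the limit. *)
Lemma measurable_caratheodory (d : measure_display) (T : measurableType d)
    (R : realType) a (D : set 'cV[R]_a) (g : 'cV[R]_a -> T -> R)
    (Z : T -> 'cV[R]_a) :
  D !=set0 -> (forall z, D z -> measurable_fun setT (g z)) ->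
  (forall w z, D z -> forall e : R, 0 < e -> exists2 delta : R, 0 < delta &
     forall z', D z' -> sumnorm (z' - z) < delta -> `|g z' w - g z w| < e) ->
  (forall i, measurable_fun setT (fun w => Z w i 0)) -> (forall w, D (Z w)) ->
  measurable_fun setT (fun w => g (Z w) w).
Proof.
move=> D0 mg cg mZ DZ; have [z [Dz dz]] := dense_sequence D0.
pose near n w i := sumnorm (z i - Z w) < n.+1%:R^-1.
have near_ex n w : exists i, near n w i.
  have [i hi] := dz (Z w) n.+1%:R^-1 (DZ w) ltac:(by rewrite invr_gt0).
  by exists i; rewrite /near -opprB -scaleN1r sumnormZ normrN1 mul1r.
pose idx n w := ex_minn (near_ex n w).
have mnear n i : measurable [set w | near n w i].
  have m : measurable_fun setT (fun w => sumnorm (z i - Z w)).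
    apply: measurable_sumnorm => j; under eq_fun do rewrite !mxE.
    exact: measurable_funB.
  rewrite -[X in measurable X]setTI.
  have := m measurableT _ (measurable_itv `]-oo, n.+1%:R^-1[).
  by rewrite (_ : _ @^-1` _ = [set w | near n w i])//; apply/seteqP; split=> w;
    rewrite /= in_itv.
apply: (@measurable_fun_cvg _ _ _ _ (fun n w => g (z (idx n w)) w)) => [n|w _].
  move=> _ B mB; rewrite setTI.
  rewrite (_ : _ @^-1` _ = \bigcup_i (([set w | near n w i] `\`
      \bigcup_(j in [set j | (j < i)%N]) [set w | near n w j]) `&` g (z i) @^-1` B)).
    apply: bigcup_measurable => i _; apply: measurableI.
      by apply: measurableD => //; apply: bigcup_measurable.
    by rewrite -[X in measurable X]setTI; exact: mg.
  apply/seteqP; split=> [w /= Bw|w [i _ [[/= ni nj] Bw]]].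
    exists (idx n w) => //; split=> //; rewrite /idx; case: ex_minnP => i ni mi.
    by split => // -[j /= ji /mi]; rewrite leqNgt ji.
  rewrite /= (_ : idx n w = i)//; rewrite /idx; case: ex_minnP => k nk mk.
  apply/eqP; rewrite eqn_leq mk//= leqNgt; apply/negP => ki.
  by apply: nj; exists k.
apply/cvgrPdist_lt => e e0; have [r r0 hr] := cg w _ (DZ w) _ e0.
near=> n; rewrite distrC; apply: hr => //.
have nr : n.+1%:R^-1 < r.
  rewrite invf_plt ?posrE//; apply: (@le_lt_trans _ _ n%:R); last by rewrite ltr_nat.
  near: n; exact: nbhs_infty_ger.
by apply: lt_trans nr; rewrite /idx; case: ex_minnP.
Unshelve. all: by end_near.
Qed.

Lemma convex_setP (R : realType) (M : lmodType R) (U : set M) (x y : M) (t : R) :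
  convex_set (U : set (convex_lmodType M)) -> U x -> U y -> 0 <= t -> t <= 1 ->
  U (x + t *: (y - x)).
Proof.
move=> cU Ux Uy t0 t1; have := cU y x (Itv01 t0 t1) (mem_set Uy) (mem_set Ux).
move=> /set_mem h; rewrite (_ : x + _ = t *: y + (1 - t) *: x); first exact: h.
by rewrite scalerBl scale1r scalerBr [RHS]addrCA.
Qed.

Lemma convex_functionP (R : realType) (M : lmodType R) (D : set M) (h : M -> R)
    (x y : M) (t : R) :
  convex_function (D : set (convex_lmodType M)) h -> D x -> D y -> 0 <= t ->
  t <= 1 -> h (x + t *: (y - x)) <= t * h y + (1 - t) * h x.
Proof.
move=> ch Dx Dy t0 t1; have := ch (Itv01 t0 t1) y x (mem_set Dy) (mem_set Dx).
apply: le_trans; rewrite le_eqVlt.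
apply/orP; left; apply/eqP; congr h.
change (x + t *: (y - x) = t *: y + (1 - t) *: x).
by rewrite scalerBl scale1r scalerBr [RHS]addrCA.
Qed.

Lemma sumnorm_segment (R : realType) a (z0 z : 'cV[R]_a) (t : R) :
  0 <= t <= 1 -> sumnorm (z0 + t *: (z - z0)) <= sumnorm z + sumnorm z0.
Proof.
move=> /andP[t0 t1]; have -> : z0 + t *: (z - z0) = t *: z + (1 - t) *: z0.
  by rewrite scalerBl scale1r scalerBr [RHS]addrCA.
rewrite (le_trans (sumnormD _ _))// !sumnormZ lerD//.
  by rewrite ger0_norm// ler_piMl// sumnorm_ge0.
by rewrite ger0_norm ?subr_ge0// ler_piMl ?sumnorm_ge0// gerBl.
Qed.

Lemma sumnormB (R : realType) a (z0 z : 'cV[R]_a) :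
  sumnorm (z - z0) <= sumnorm z + sumnorm z0.
Proof.
by rewrite (le_trans (sumnormD _ _))// -(scaleN1r z0) sumnormZ normrN1 mul1r.
Qed.

Lemma le_row_mx_mul (R : realType) c a e (A : 'M[R]_(c, a)) (B : 'M[R]_(c, e))
    (v : 'cV[R]_(a + e)) i :
  `|(row_mx A B *m v) i 0| <= (enorm A + enorm B) * sumnorm v.
Proof.
rewrite -(vsubmxK v) mul_row_col sumnorm_col_mx mxE mulrDl.
rewrite (le_trans (ler_normD _ _))// lerD//.
  rewrite (le_trans (le_sumnorm_mulmx _ _ _))// ler_wpM2l ?enorm_ge0//.
  by rewrite lerDl sumnorm_ge0.
rewrite (le_trans (le_sumnorm_mulmx _ _ _))// ler_wpM2l ?enorm_ge0//.
by rewrite lerDr sumnorm_ge0.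
Qed.

(** * Random fields with a gradient, along a process *)

Section RandomField.
Variables (R : realType) (disp : measure_display) (Omega : measurableType disp).
Variables (P : probability Omega R) (G : set (set Omega)).
Hypothesis sG : sigma_algebra setT G.
Hypothesis mG : G `<=` measurable.
Variables (a : nat) (D : set 'cV[R]_a) (g : 'cV[R]_a -> Omega -> R).
Variable r : 'cV[R]_a -> Omega -> 'rV[R]_a.
Variables (Z : Omega -> 'cV[R]_a) (z0 : 'cV[R]_a).
Hypothesis Dconv : forall z z' (t : R), D z -> D z' -> 0 <= t -> t <= 1 ->
  D (z + t *: (z' - z)).
Hypothesis Dz0 : D z0.
Hypothesis mg : forall z, D z -> gmeas G (g z).
Hypothesis gr : forall w z, D z -> has_grad D (g^~ w) z (r z w).
Hypothesis DZ : forall w, D (Z w).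
Hypothesis mZ : forall i, gmeas G (fun w => Z w i 0).

Lemma field_gmeas : gmeas G (fun w => g (Z w) w).
Proof.
apply: (measurable_caratheodory (T := g_sigma_algebraType G) (D := D)) => //.
  by exists z0.
by move=> w z Dz; exact: has_grad_continuous (gr w Dz).
Qed.

(** Apply the mean value bound on the segment from [z0] to [Z w]; along it the
    norm stays below the sum of the norms of the end points. *)
Lemma field_increment w (K : R) :
  (forall z, D z -> sumnorm z <= sumnorm (Z w) + sumnorm z0 -> forall v : 'cV[R]_a,
     `|(r z w *m v) 0 0| <= K * sumnorm v) -> 0 <= K ->
  `|g (Z w) w| <= `|g z0 w| + K * (sumnorm (Z w) + sumnorm z0).
Proof.
move=> hK K0; rewrite -lerBlDl.
apply: le_trans (lerB_dist _ _) _.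
apply: (@le_trans _ _ (K * sumnorm (Z w - z0))); last by rewrite ler_wpM2l ?sumnormB.
apply: (mean_value_bound (D := D) (h := g^~ w) (r := r^~ w)) => t /andP[t0 t1].
have Dt : D (z0 + t *: (Z w - z0)) by exact: Dconv.
split => //; split; first exact: gr.
by apply: hK => //; apply: sumnorm_segment; rewrite t0.
Qed.

Hypothesis LZ : forall i, L2 P (fun w => Z w i 0).

Lemma L2_sumnorm : L2 P (fun w => sumnorm (Z w) + sumnorm z0).
Proof.
apply: L2D; last exact: L2_cst.
by under eq_fun do rewrite sumnorm_cV; apply: L2_sum => i; exact: L2_norm.
Qed.

Lemma field_L2 (K : R) : 0 <= K ->
  (forall w z, D z -> forall v : 'cV[R]_a, `|(r z w *m v) 0 0| <= K * sumnorm v) ->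
  L2 P (g z0) -> L2 P (fun w => g (Z w) w).
Proof.
move=> K0 hK Lg0.
have mgZ := gmeas_measurable sG mG field_gmeas.
have L := L2D (L2_norm Lg0) (L2Z K L2_sumnorm).
apply: (L2_le mgZ L) => w; rewrite [leRHS]ger0_norm.
  by apply: field_increment => // z Dz _; exact: hK.
by rewrite addr_ge0// mulr_ge0// addr_ge0 ?sumnorm_ge0.
Qed.

Lemma field_integrable (K : R) : 0 <= K ->
  (forall w z, D z -> forall v : 'cV[R]_a,
     `|(r z w *m v) 0 0| <= K * (1 + sumnorm z) * sumnorm v) ->
  P.-integrable setT (EFin \o g z0) ->
  P.-integrable setT (EFin \o (fun w => g (Z w) w)).
Proof.
move=> K0 hK ig0; have mgZ := gmeas_measurable sG mG field_gmeas.
pose S w := sumnorm (Z w) + sumnorm z0.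
have S0 w : 0 <= S w by rewrite addr_ge0 ?sumnorm_ge0.
have LS : L2 P S by exact: L2_sumnorm.
have i1 : P.-integrable setT (EFin \o (fun w => K * (S w + S w ^+ 2))).
  exact: (integrable_scale K (integrableDr (L2_integrable LS) LS.2)).
have i0 : P.-integrable setT (EFin \o (fun w => `|g z0 w|)).
  by have := integrable_norm ig0.
apply: (le_integrable_r mgZ _ (integrableDr i0 i1)) => w.
have -> : K * (S w + S w ^+ 2) = K * (1 + S w) * S w by ring.
apply: field_increment; last by rewrite mulr_ge0// addr_ge0.
move=> z Dz zS v; apply: le_trans (hK w z Dz v) _.
by rewrite ler_wpM2r ?sumnorm_ge0// ler_wpM2l// lerD2l.
Qed.

End RandomField.

(** * Coefficients and state along an admissible control *)

Section StateProcess.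
Variables (R : realType) (disp : measure_display) (Omega : measurableType disp).
Variables (N d n m : nat) (hd : (0 < d)%N) (Theta : Type).
Variables (F : Theta -> probability (borel 'cV[R]_d) R).
Variable W : nat -> Omega -> 'cV[R]_d.
Hypothesis hFN : (@measurable _ Omega : set (set Omega)) = Fsig W N.
Hypothesis hA3 : assumption_A3 N F W.
Hypothesis hW : forall k, (1 <= k <= N)%N -> Lc_mx N F W 2 k (W k).
Variable U : nat -> set 'cV[R]_m.
Hypothesis hU0 : forall k, (k < N)%N -> U k !=set0.
Hypothesis hUconv : forall k, (k < N)%N -> convex_set (U k).
Variables (C : coefficients R Omega n m d) (DC : derivatives R Omega n m d).
Hypothesis hder : is_derivatives N U C DC.
Variable x0 : 'cV[R]_n.
Hypothesis hH1 : assumption_H1 N F W U C.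
Hypothesis hH2 : assumption_H2 N U DC.
Variable P : probability Omega R.
Hypothesis hP : Pset N F W P.

Notation G := (Gsig W P).
Let sG k : sigma_algebra setT (G k) := sigma_algebra_Gsig W P k.
Let mG k : G k `<=` measurable := @Gsig_measurable _ _ _ _ W P k.

(** The domain of the coefficients, with state and control stacked in one
    vector. *)
Definition joint_dom k : set 'cV[R]_(n + m) := [set z | U k (dsubmx z)].

Lemma joint_dom_convex k z z' (t : R) : (k < N)%N ->
  joint_dom k z -> joint_dom k z' -> 0 <= t -> t <= 1 ->
  joint_dom k (z + t *: (z' - z)).
Proof.
move=> kN Dz Dz' t0 t1; rewrite /joint_dom /=.
have -> : dsubmx (z + t *: (z' - z)) = dsubmx z + t *: (dsubmx z' - dsubmx z).
  by apply/matrixP => i j; rewrite !mxE.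
by apply: convex_setP => //; exact: hUconv.
Qed.

Lemma hder_joint k z w : (k < N)%N -> joint_dom k z ->
  let x := usubmx z in let u := dsubmx z in
  [/\ is_jacobian (joint_dom k) (fun z => b C k (usubmx z) (dsubmx z) w) z
        (row_mx (b_x DC k x u w) (b_u DC k x u w)),
      forall l, is_jacobian (joint_dom k)
          (fun z => sigma C l k (usubmx z) (dsubmx z) w) z
          (row_mx (sigma_x DC l k x u w) (sigma_u DC l k x u w)) &
      is_jacobian (joint_dom k) (fun z => (f C k (usubmx z) (dsubmx z) w)%:M) z
        (row_mx (f_x DC k x u w) (f_u DC k x u w))].
Proof.
move=> kN Dz x u; have := hder.1 k x u w kN Dz.
by rewrite /x /u vsubmxK.
Qed.

Definition adapted_pair k (X : Omega -> 'cV[R]_n) (u : Omega -> 'cV[R]_m) : Prop :=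
  [/\ forall w, U k (u w),
      forall i, gmeas (G k) (fun w => X w i 0) /\ L2 P (fun w => X w i 0) &
      forall i, gmeas (G k) (fun w => u w i 0) /\ L2 P (fun w => u w i 0)].

Section Along.
Variables (k : nat) (X : Omega -> 'cV[R]_n) (u : Omega -> 'cV[R]_m).
Hypothesis kN : (k < N)%N.
Hypothesis hXu : adapted_pair k X u.

Let Z w := col_mx (X w) (u w).
Let u0 := sval (cid (hU0 kN)).
Let z0 : 'cV[R]_(n + m) := col_mx 0 u0.

Let Dz0 : joint_dom k z0.
Proof. by rewrite /joint_dom/= /z0 col_mxKd; exact: svalP (cid (hU0 kN)). Qed.

Let DZ w : joint_dom k (Z w).
Proof. by rewrite /joint_dom/= /Z col_mxKd; case: hXu. Qed.

Let ZE (Q : (Omega -> R) -> Prop) :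
  (forall i, Q (fun w => X w i 0)) -> (forall i, Q (fun w => u w i 0)) ->
  forall i, Q (fun w => Z w i 0).
Proof.
move=> hX hu i; rewrite /Z -(fintype.splitK i); case: (fintype.split i) => j /=.
  by under eq_fun do rewrite col_mxEu.
by under eq_fun do rewrite col_mxEd.
Qed.

Let mZ i : gmeas (G k) (fun w => Z w i 0).
Proof.
case: hXu => _ hX hu.
by apply: (ZE (Q := fun Y => gmeas (G k) Y)) => j; [case: (hX j)|case: (hu j)].
Qed.

Let LZ i : L2 P (fun w => Z w i 0).
Proof.
by case: hXu => _ hX hu; apply: ZE => j; [case: (hX j)|case: (hu j)].
Qed.

Let cD z z' (t : R) := @joint_dom_convex k z z' t kN.

(** The case of [b] and [sigma]: bounded gradients keep the process in L2. *)
Lemma entry_along (g : 'cV[R]_n -> 'cV[R]_m -> Omega -> 'cV[R]_n)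
    (gx : 'cV[R]_n -> 'cV[R]_m -> Omega -> 'M[R]_n)
    (gu : 'cV[R]_n -> 'cV[R]_m -> Omega -> 'M[R]_(n, m)) (K : R) i :
  0 <= K -> (forall x v, U k v -> Lc_mx N F W 2 k (g x v)) ->
  (forall w z, joint_dom k z ->
     is_jacobian (joint_dom k) (fun z => g (usubmx z) (dsubmx z) w) z
       (row_mx (gx (usubmx z) (dsubmx z) w) (gu (usubmx z) (dsubmx z) w))) ->
  (forall x v w, U k v -> enorm (gx x v w) + enorm (gu x v w) <= K) ->
  gmeas (G k) (fun w => g (X w) (u w) w i 0) /\
  L2 P (fun w => g (X w) (u w) w i 0).
Proof.
move=> K0 Lg Jg hK; have kN' := ltnW kN.
pose h z w : R := g (usubmx z) (dsubmx z) w i 0.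
pose r z w : 'rV[R]_(n + m) := delta_mx 0 i *m
  row_mx (gx (usubmx z) (dsubmx z) w) (gu (usubmx z) (dsubmx z) w).
have hE w : g (X w) (u w) w i 0 = h (Z w) w by rewrite /h /Z col_mxKu col_mxKd.
have mh z : joint_dom k z -> gmeas (G k) (h z).
  by move=> Dz; exact: (gmeas_Lc kN' hP (Lg (usubmx z) (dsubmx z) Dz i 0)).
have hr w z : joint_dom k z -> has_grad (joint_dom k) (h^~ w) z (r z w).
  move=> Dz; have := has_grad_jacobian (delta_mx 0 i) (Jg w z Dz).
  by under eq_fun do rewrite -rowE mxE.
have rK w z : joint_dom k z -> forall v : 'cV[R]_(n + m), `|(r z w *m v) 0 0| <= K * sumnorm v.
  move=> Dz v; rewrite /r -mulmxA -rowE mxE.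
  apply: le_trans (le_row_mx_mul _ _ _ _) _.
  by rewrite ler_wpM2r ?sumnorm_ge0// hK.
have Lh0 : L2 P (h z0) by exact: (L2_Lc hFN kN' hP (Lg (usubmx z0) (dsubmx z0) Dz0 i 0)).
under eq_fun do rewrite hE; split; first exact: (field_gmeas Dz0 mh hr DZ mZ).
exact: (field_L2 (@sG k) (@mG k) cD Dz0 mh hr DZ mZ LZ K0 rK Lh0).
Qed.

Lemma b_along i : gmeas (G k) (fun w => b C k (X w) (u w) w i 0) /\
  L2 P (fun w => b C k (X w) (u w) w i 0).
Proof.
have [L L0 hL] := hH2; have l0 := Ordinal hd.
apply: (entry_along (gx := b_x DC k) (gu := b_u DC k) i (ltW L0)).
- by move=> x v Uv; have [] := hH1.1 k x v kN Uv.
- by move=> w z Dz; have [] := hder_joint w kN Dz.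
- move=> x v w Uv; have [h _] := hL k x v l0 w kN Uv.
  by apply: le_trans h; rewrite -addrA lerDl addr_ge0// enorm_ge0.
Qed.

Lemma sigma_along l i : gmeas (G k) (fun w => sigma C l k (X w) (u w) w i 0) /\
  L2 P (fun w => sigma C l k (X w) (u w) w i 0).
Proof.
have [L L0 hL] := hH2.
apply: (entry_along (gx := sigma_x DC l k) (gu := sigma_u DC l k) i (ltW L0)).
- by move=> x v Uv; have [_ + _] := hH1.1 k x v kN Uv; apply.
- by move=> w z Dz; have [_ + _] := hder_joint w kN Dz; apply.
- move=> x v w Uv; have [h _] := hL k x v l w kN Uv.
  by apply: le_trans h; rewrite -addrA lerDr addr_ge0// enorm_ge0.
Qed.

Lemma f_along : P.-integrable setT (EFin \o (fun w => f C k (X w) (u w) w)).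
Proof.
have [L L0 hL] := hH2; have l0 := Ordinal hd; have kN' := ltnW kN.
pose h z w := f C k (usubmx z) (dsubmx z) w.
pose r z w : 'rV[R]_(n + m) :=
  row_mx (f_x DC k (usubmx z) (dsubmx z) w) (f_u DC k (usubmx z) (dsubmx z) w).
have hE w : f C k (X w) (u w) w = h (Z w) w by rewrite /h /Z col_mxKu col_mxKd.
have Lf z : joint_dom k z -> Lc N F W 1 k (h z).
  by move=> Dz; have [] := hH1.1 k (usubmx z) (dsubmx z) kN Dz.
have mh z : joint_dom k z -> gmeas (G k) (h z).
  by move=> Dz; exact: (gmeas_Lc kN' hP (Lf z Dz)).
have hr w z : joint_dom k z -> has_grad (joint_dom k) (h^~ w) z (r z w).
  move=> Dz; have [_ _ Jf] := hder_joint w kN Dz.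
  have := has_grad_jacobian 1%:M Jf; rewrite mul1mx.
  by under eq_fun do rewrite mul1mx mxE eqxx mulr1n.
have rK w z : joint_dom k z -> forall v : 'cV[R]_(n + m),
    `|(r z w *m v) 0 0| <= L * (1 + sumnorm z) * sumnorm v.
  move=> Dz v; apply: le_trans (le_row_mx_mul _ _ _ _) _.
  rewrite ler_wpM2r ?sumnorm_ge0//.
  have [_ h2] := hL k (usubmx z) (dsubmx z) l0 w kN Dz.
  apply: le_trans (le_trans _ h2) _; first by rewrite lerDl enorm_ge0.
  rewrite ler_wpM2l ?(ltW L0)// -addrA lerD2l -[in leRHS](vsubmxK z) sumnorm_col_mx.
  by rewrite lerD ?enorm_le_sumnorm.
under eq_fun do rewrite hE.
apply: (field_integrable (@sG k) (@mG k) cD Dz0 mh hr DZ mZ LZ (ltW L0) rK).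
exact: (integrable_Lc hFN kN' hP (Lf z0 Dz0)).
Qed.

End Along.

(** A gradient of linear growth gives quadratic growth, which is integrable along
    a square integrable state. *)
Lemma varphi_along (X : Omega -> 'cV[R]_n) : (0 < N)%N ->
  (forall i, gmeas (G N) (fun w => X w i 0) /\ L2 P (fun w => X w i 0)) ->
  P.-integrable setT (EFin \o (fun w => varphi C (X w) w)).
Proof.
move=> hN hX; have [L L0 hL] := hH2; have l0 := Ordinal hd.
have [u0 Uu0] := hU0 hN.
pose K := L * (1 + enorm u0).
have K0 : 0 <= K by rewrite mulr_ge0 ?(ltW L0)// addr_ge0 ?enorm_ge0.
have mh z : setT z -> gmeas (G N) (varphi C z).
  by move=> _; exact: (gmeas_Lc (leqnn N) hP (hH1.2 z)).
have hr w z : setT z -> has_grad setT (varphi C ^~ w) z (varphi_x DC z w).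
  move=> _; have := has_grad_jacobian 1%:M (hder.2 z w); rewrite mul1mx.
  by under eq_fun do rewrite mul1mx mxE eqxx mulr1n.
have rK w z : setT z -> forall v : 'cV[R]_n,
    `|(varphi_x DC z w *m v) 0 0| <= K * (1 + sumnorm z) * sumnorm v.
  move=> _ v; apply: le_trans (le_sumnorm_mulmx _ _ _) _.
  rewrite ler_wpM2r ?sumnorm_ge0//.
  have [_ h2] := hL 0%N z u0 l0 w hN Uu0.
  apply: le_trans (le_trans _ h2) _; first by rewrite lerDr addr_ge0 ?enorm_ge0.
  rewrite /K -mulrA ler_wpM2l ?(ltW L0)//.
  have := enorm_le_sumnorm z; have := enorm_ge0 u0; have := sumnorm_ge0 z => s0 e0 h.
  have := mulr_ge0 e0 s0; lra.
apply: (field_integrable (D := setT) (z0 := 0) (@sG N) (@mG N) _ _ mh hr _ _ _ K0 rK) => //.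
- by move=> i; case: (hX i).
- by move=> i; case: (hX i).
- exact: (integrable_Lc hFN (leqnn N) hP (hH1.2 0)).
Qed.

(** The product of [sigma] and the next noise stays in L2, although both factors
    are only in L2, by the conditional moment bound. *)
Lemma state_adapted u : admissible N F W U u -> forall k, (k <= N)%N ->
  forall i, gmeas (G k) (fun w => state W C x0 u k w i 0) /\
    L2 P (fun w => state W C x0 u k w i 0).
Proof.
move=> hu; elim=> [_ i|k IH kN i]; first by split; [exact: measurable_cst|exact: L2_cst].
have [Uu Lu] := hu k kN; have kN' := ltnW kN.
have pair : adapted_pair k (state W C x0 u k) (u k).
  split => // j; [exact: IH|split].
    exact: (gmeas_Lc kN' hP (Lu j 0)).
  exact: (L2_Lc hFN kN' hP (Lu j 0)).
have [mb Lb] := b_along kN pair i.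
under eq_fun do rewrite /= mxE summxE.
have mono := @gmeas_mono _ _ _ _ W P k k.+1 _ (leqnSn k).
have s l : gmeas (G k.+1)
    (fun w => (W k.+1 w l 0 *: sigma C l k (state W C x0 u k w) (u k w) w) i 0)
  /\ L2 P (fun w => (W k.+1 w l 0 *: sigma C l k (state W C x0 u k w) (u k w) w) i 0).
  have [ms Ls] := sigma_along kN pair l i.
  have [c c0 hc] := noise_second_moment hFN hP hA3 hW l kN.
  have [LsW _] := hc _ ms Ls.
  have E : (fun w => (W k.+1 w l 0 *: sigma C l k (state W C x0 u k w) (u k w) w) i 0)
     = (fun w => sigma C l k (state W C x0 u k w) (u k w) w i 0 * W k.+1 w l 0).
    by apply/funext => w; rewrite mxE mulrC.
  rewrite E; split => //; apply: measurable_funM; first exact: mono.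
  exact: (gmeas_noise hFN).
split.
  apply: measurable_funD; first exact: mono.
  by apply: measurable_sum => l; case: (s l).
by apply: L2D => //; apply: L2_sum => l; case: (s l).
Qed.

Lemma admissible_pair u k : admissible N F W U u -> (k < N)%N ->
  adapted_pair k (state W C x0 u k) (u k).
Proof.
move=> hu kN; have [Uu Lu] := hu k kN; have kN' := ltnW kN.
split => // i; first exact: state_adapted.
split; first exact: (gmeas_Lc kN' hP (Lu i 0)).
exact: (L2_Lc hFN kN' hP (Lu i 0)).
Qed.

End StateProcess.

Lemma le_Rintegral_ae (d : measure_display) (T : measurableType d)
    (R : realType) (P : probability T R) (X Y : T -> R) :
  P.-integrable setT (EFin \o X) -> P.-integrable setT (EFin \o Y) ->
  {ae P, forall w, X w <= Y w} -> \int[P]_w X w <= \int[P]_w Y w.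
Proof.
move=> iX iY XY; rewrite -subr_ge0 -RintegralB//.
have iYX := integrableBr iY iX.
have -> : \int[P]_w (Y w - X w) = \int[P]_w `|Y w - X w|.
  congr fine; apply: ae_eq_integral => //; first exact: measurable_int iYX.
    by apply/measurable_EFinP/measurableT_comp => //; exact: integrable_measurable iYX.
  by apply: filterS XY => w h _; rewrite ger0_norm ?subr_ge0.
by apply: Rintegral_ge0.
Qed.

Lemma dotE (R : realType) n (x y : 'cV[R]_n) :
  (x^T *m y) 0 0 = \sum_i x i 0 * y i 0.
Proof. by rewrite mxE; apply: eq_bigr => i _; rewrite mxE. Qed.

(** * Tangent planes of the Hamiltonian *)

Section Hamiltonian.
Variables (R : realType) (disp : measure_display) (Omega : measurableType disp).
Variables (N n m d : nat).
Variable U : nat -> set 'cV[R]_m.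
Hypothesis hUconv : forall k, (k < N)%N -> convex_set (U k).
Variables (C : coefficients R Omega n m d) (DC : derivatives R Omega n m d).
Hypothesis hder : is_derivatives N U C DC.

Definition Ham_x (k : nat) x u (p : 'cV[R]_n) (q : 'M[R]_(n, d)) w : 'cV[R]_n :=
  (b_x DC k x u w)^T *m p + \sum_(l < d) (sigma_x DC l k x u w)^T *m col l q +
  (f_x DC k x u w)^T.

Lemma Ham_tangent k x u x' u' (p : 'cV[R]_n) (q : 'M[R]_(n, d)) w :
  (k < N)%N -> U k u -> U k u' ->
  convex_function
    ([set z | U k z.2] : set (convex_lmodType ('cV[R]_n * 'cV[R]_m)%type))
    (fun z => Ham C k z.1 z.2 p q w) ->
  \sum_i Ham_x k x u p q w i 0 * (x' - x) i 0 +
    (Ham_u DC k x u p q w *m (u' - u)) 0 0 <=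
  Ham C k x' u' p q w - Ham C k x u p q w.
Proof.
move=> kN Uu Uu' cH.
pose h (z : 'cV[R]_(n + m)) := Ham C k (usubmx z) (dsubmx z) p q w.
pose Jb := row_mx (b_x DC k x u w) (b_u DC k x u w).
pose Js l := row_mx (sigma_x DC l k x u w) (sigma_u DC l k x u w).
pose Jf := row_mx (f_x DC k x u w) (f_u DC k x u w).
pose r := p^T *m Jb + \sum_(l < d) (col l q)^T *m Js l + 1%:M *m Jf.
have [hb hs hf] := hder.1 k x u w kN Uu.
have hr : has_grad (joint_dom U k) h (col_mx x u) r.
  have := has_gradD (has_gradD (has_grad_jacobian p^T hb)
    (has_grad_sum (index_enum _) (fun l => has_grad_jacobian (col l q)^T (hs l))))
    (has_grad_jacobian 1%:M hf).
  congr has_grad; apply/funext => z; rewrite /h /Ham [in RHS]mxE summxE.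
  by rewrite mul1mx [X in _ + X = _]mxE eqxx mulr1n.
have -> : \sum_i Ham_x k x u p q w i 0 * (x' - x) i 0 +
    (Ham_u DC k x u p q w *m (u' - u)) 0 0 =
    (r *m (col_mx x' u' - col_mx x u)) 0 0.
  have split_mul e (P : 'M[R]_(1, e)) (A : 'M[R]_(e, n)) (B : 'M[R]_(e, m)) x1 u1 :
      P *m row_mx A B *m col_mx x1 u1 = P *m A *m x1 + P *m B *m u1.
    by rewrite mul_mx_row mul_row_col.
  have mxD (A B : 'M[R]_1) : (A + B) 0 0 = A 0 0 + B 0 0 by rewrite mxE.
  have HxT : (Ham_x k x u p q w)^T = p^T *m b_x DC k x u w +
      \sum_(l < d) (col l q)^T *m sigma_x DC l k x u w + f_x DC k x u w.
    rewrite /Ham_x !linearD/= linear_sum/= !trmx_mul !trmxK; congr (_ + _ + _).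
    by apply: eq_bigr => l _; rewrite trmx_mul trmxK.
  rewrite -dotE HxT opp_col_mx add_col_mx; move: (x' - x) (u' - u) => dx du.
  rewrite /r /Jb /Jf !mulmxDl !split_mul !mulmx_suml.
  under [in RHS]eq_bigr do rewrite /Js split_mul.
  rewrite big_split/= !mul1mx.
  by rewrite !mxD; ring.
have hE y v : Ham C k y v p q w = h (col_mx y v) by rewrite /h col_mxKu col_mxKd.
rewrite !hE; apply: convex_above_tangent hr _ => t t0 t1.
split.
  by apply: (joint_dom_convex hUconv kN); rewrite ?(ltW t0)//= /joint_dom/= col_mxKd.
rewrite -!hE.
have := convex_functionP (x := (x, u)) (y := (x', u')) cH Uu Uu' (ltW t0) t1.
rewrite /h opp_col_mx add_col_mx scale_col_mx add_col_mx col_mxKu col_mxKd.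
exact.
Qed.

Lemma varphi_tangent x x' w :
  convex_function (setT : set (convex_lmodType 'cV[R]_n)) (fun x => varphi C x w) ->
  \sum_i (varphi_x DC x w)^T i 0 * (x' - x) i 0 <= varphi C x' w - varphi C x w.
Proof.
move=> cphi.
have hr : has_grad setT (fun y => varphi C y w) x (varphi_x DC x w).
  have := has_grad_jacobian 1%:M (hder.2 x w); rewrite mul1mx.
  by under eq_fun do rewrite mul1mx mxE eqxx mulr1n.
rewrite -dotE trmxK; apply: convex_above_tangent hr _ => t t0 t1; split => //.
by apply: convex_functionP cphi _ _ (ltW t0) t1.
Qed.

End Hamiltonian.

(** * Duality with the adjoint equation *)

Lemma young_ineq (R : realType) (s x y : R) : 0 < s ->
  x * y <= s / 2 * x ^+ 2 + (2 * s)^-1 * y ^+ 2.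
Proof.
move=> s0; have := sqr_ge0 (s * x - y); rewrite sqrrB exprMn => h.
rewrite -subr_ge0.
have -> : s / 2 * x ^+ 2 + (2 * s)^-1 * y ^+ 2 - x * y =
  (2 * s)^-1 * (s ^+ 2 * x ^+ 2 - s * x * y *+ 2 + y ^+ 2).
  by field; rewrite gt_eqF.
by rewrite mulr_ge0// invr_ge0 mulr_ge0// ltW.
Qed.

Section Verification.
Variables (R : realType) (disp : measure_display) (Omega : measurableType disp).
Variables (N d n m : nat) (hN : (0 < N)%N) (hd : (0 < d)%N) (Theta : Type).
Variables (F : Theta -> probability (borel 'cV[R]_d) R).
Variable W : nat -> Omega -> 'cV[R]_d.
Hypothesis hFN : (@measurable _ Omega : set (set Omega)) = Fsig W N.
Hypothesis hA3 : assumption_A3 N F W.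
Hypothesis hW : forall k, (1 <= k <= N)%N -> Lc_mx N F W 2 k (W k).
Variable U : nat -> set 'cV[R]_m.
Hypothesis hU0 : forall k, (k < N)%N -> U k !=set0.
Hypothesis hUconv : forall k, (k < N)%N -> convex_set (U k).
Variables (C : coefficients R Omega n m d) (DC : derivatives R Omega n m d).
Hypothesis hder : is_derivatives N U C DC.
Variable x0 : 'cV[R]_n.
Hypothesis hH1 : assumption_H1 N F W U C.
Hypothesis hH2 : assumption_H2 N U DC.
Variable ustar : nat -> Omega -> 'cV[R]_m.
Hypothesis hustar : admissible N F W U ustar.
Variable P : probability Omega R.
Hypothesis hP : Pset N F W P.
Variables (p : nat -> Omega -> 'cV[R]_n) (q : nat -> Omega -> 'M[R]_(n, d)).
Hypothesis hadj : adjoint_solution N W C DC x0 P ustar p q.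

Notation G := (Gsig W P).
Let sG k : sigma_algebra setT (G k) := sigma_algebra_Gsig W P k.
Let mG k : G k `<=` measurable := @Gsig_measurable _ _ _ _ W P k.
Notation Xs := (state W C x0 ustar).

(** Merges the terminal condition, at [j = N], with the driver at the earlier
    times, so that [p k] and [q k] are conditional expectations of [costate k.+1]
    and of its product with the noise for all [k < N]. *)
Definition costate (j : nat) (w : Omega) : 'cV[R]_n :=
  if j == N then (varphi_x DC (Xs N w) w)^T
  else adjoint_driver W C DC x0 ustar p q j w.

Lemma costate_condexp k : (k < N)%N ->
  condexp_mx W P k (costate k.+1) (p k) /\
  condexp_mx W P k (fun w => costate k.+1 w *m (W k.+1 w)^T) (q k).
Proof.
move=> kN; have [hp hq hk] := hadj; rewrite /costate.
have [e|ne] := eqVneq k.+1 N; last by apply: hk; rewrite ltn_neqAle ne.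
by move: hp hq; rewrite -e.
Qed.

Lemma costate_condexp_p k i : (k < N)%N ->
  exists2 Z, is_condexp P (G k) (fun w => costate k.+1 w i 0) Z &
    {ae P, forall w, p k w i 0 = Z w}.
Proof.
move=> kN; have [h _] := costate_condexp kN.
exact: (is_condexp_condexp hFN (ltnW kN) (h i 0)).
Qed.

Lemma costate_condexp_q k i l : (k < N)%N ->
  exists2 Z, is_condexp P (G k) (fun w => costate k.+1 w i 0 * W k.+1 w l 0) Z &
    {ae P, forall w, q k w i l = Z w}.
Proof.
move=> kN; have [_ h] := costate_condexp kN.
rewrite (_ : (fun w => costate k.+1 w i 0 * W k.+1 w l 0) =
  fun w => (costate k.+1 w *m (W k.+1 w)^T) i l).
  exact: (is_condexp_condexp hFN (ltnW kN) (h i l)).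
by apply/funext => w; rewrite mxE big_ord1 mxE.
Qed.

Lemma costate_measurable k i : (k < N)%N ->
  measurable_fun setT (fun w => costate k.+1 w i 0).
Proof.
by move=> kN; have [Z [iD _ _ _] _] := costate_condexp_p i kN;
  exact: integrable_measurable iD.
Qed.

(** Conditional expectation contracts L2, even after multiplication by the
    next noise, whose conditional second moment is bounded. *)
Lemma adjoint_versions k : (k < N)%N ->
  (forall i, L2 P (fun w => costate k.+1 w i 0)) ->
  exists (zp : 'I_n -> Omega -> R) (zq : 'I_n -> 'I_d -> Omega -> R),
  [/\ forall i, is_condexp P (G k) (fun w => costate k.+1 w i 0) (zp i) /\ L2 P (zp i),
      forall i l, is_condexp P (G k) (fun w => costate k.+1 w i 0 * W k.+1 w l 0) (zq i l)
        /\ L2 P (zq i l) &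
      {ae P, forall w, (forall i, p k w i 0 = zp i w) /\
                       (forall i l, q k w i l = zq i l w)}].
Proof.
move=> kN LD.
have Hp i : exists Z, [/\ is_condexp P (G k) (fun w => costate k.+1 w i 0) Z,
    L2 P Z & {ae P, forall w, p k w i 0 = Z w}].
  have [Z cZ pZ] := costate_condexp_p i kN; exists Z; split => //.
  have [iD mZ iZ hZ] := cZ; split; first exact: (gmeas_measurable (@sG k) (@mG k) mZ).
  have [mD iD2] := LD i.
  apply: (@condexp_sqr_le _ _ _ P (G k) (@sG k) (@mG k) _ _
    (2^-1 * \int[P]_w (costate k.+1 w i 0 ^+ 2)) cZ) => V K mV VK.
  have mVO := gmeas_measurable (@sG k) (@mG k) mV.
  have LV : L2 P V.
    apply: (L2_le mVO (L2_cst P K)) => w; have /andP[v0 vK] := VK w.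
    by rewrite !ger0_norm// (le_trans v0).
  have [_ iV2] := LV.
  rewrite -!RintegralZl// -RintegralD//; try exact: integrable_scale.
  apply: le_Rintegral => //.
  - exact: L2_mul LV (L2_norm (LD i)).
  - by apply: integrableDr; exact: integrable_scale.
  - move=> w _; have := young_ineq (V w) `|costate k.+1 w i 0| ltr01.
    by rewrite real_normK ?num_real// !mulr1 mul1r addrC.
have Hq il : exists Z, [/\ is_condexp P (G k)
      (fun w => costate k.+1 w il.1 0 * W k.+1 w il.2 0) Z,
    L2 P Z & {ae P, forall w, q k w il.1 il.2 = Z w}].
  case: il => i l /=.
  have [Z cZ qZ] := costate_condexp_q i l kN; exists Z; split => //.
  have [iD mZ iZ hZ] := cZ; split; first exact: (gmeas_measurable (@sG k) (@mG k) mZ).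
  have [mD iD2] := LD i.
  have [c c0 hc] := noise_second_moment hFN hP hA3 hW l kN.
  have s0 : 0 < c + 1 by rewrite ltr_wpDl.
  (* The weight [c + 1] in Young's inequality leaves at most half of the square of
     [V] on the right. *)
  apply: (@condexp_sqr_le _ _ _ P (G k) (@sG k) (@mG k) _ _
    ((c + 1) / 2 * \int[P]_w (costate k.+1 w i 0 ^+ 2)) cZ) => V K mV VK.
  have mVO := gmeas_measurable (@sG k) (@mG k) mV.
  have LV : L2 P V.
    apply: (L2_le mVO (L2_cst P K)) => w; have /andP[v0 vK] := VK w.
    by rewrite !ger0_norm// (le_trans v0).
  have [LVW hVW] := hc _ mV LV.
  have [_ iVW2] := LVW.
  apply: (@le_trans _ _ ((c + 1) / 2 * \int[P]_w (costate k.+1 w i 0 ^+ 2) +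
     (2 * (c + 1))^-1 * \int[P]_w ((V w * W k.+1 w l 0) ^+ 2))); last first.
    rewrite lerD2l; apply: (@le_trans _ _ ((2 * (c + 1))^-1 * (c * \int[P]_w (V w ^+ 2)))).
      by rewrite ler_wpM2l// invr_ge0 mulr_ge0// ltW.
    rewrite mulrA ler_wpM2r//; first by apply: Rintegral_ge0 => w _; exact: sqr_ge0.
    rewrite invfM -mulrA ler_piMr// mulrC ler_pdivrMr// mul1r.
    by rewrite lerDl.
  rewrite -!RintegralZl// -RintegralD//; try exact: integrable_scale.
  apply: le_Rintegral => //.
  - have := L2_mul (L2_norm LVW) (L2_norm (LD i)).
    apply: eq_integrable => // w _ /=; have /andP[v0 _] := VK w.
    by rewrite !normrM (ger0_norm v0) mulrAC mulrA.
  - by apply: integrableDr; exact: integrable_scale.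
  - move=> w _; have := young_ineq `|costate k.+1 w i 0| `|V w * W k.+1 w l 0| s0.
    rewrite !real_normK ?num_real//; apply: le_trans; have /andP[v0 _] := VK w.
    by rewrite !normrM (ger0_norm v0) mulrCA.
have [zp hzp] := choice Hp; have [zq hzq] := choice Hq.
exists zp, (fun i l => zq (i, l)); split.
- by move=> i; have [] := hzp i.
- by move=> i l; have [] := hzq (i, l).
have h1 : {ae P, forall w, forall i, p k w i 0 = zp i w}.
  by apply: filter_forall => i; have [] := hzp i.
have h2 : {ae P, forall w, forall il, q k w il.1 il.2 = zq il w}.
  by apply: filter_forall => il; have [] := hzq il.
by apply: filterS2 h1 h2 => w a1 a2; split => // i l; exact: (a2 (i, l)).
Qed.

Lemma costate_L2_terminal i : L2 P (fun w => costate N w i 0).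
Proof.
have [L L0 hL] := hH2; have l0 := Ordinal hd; have [u0 Uu0] := hU0 hN.
have mD : measurable_fun setT (fun w => costate N w i 0).
  have := @costate_measurable N.-1 i; rewrite prednK//; exact.
have LX : L2 P (fun w => sumnorm (Xs N w)).
  under eq_fun do rewrite sumnorm_cV; apply: L2_sum => j; apply: L2_norm.
  exact: (state_adapted hd hFN hA3 hW hU0 hUconv hder x0 hH1 hH2 hP hustar (leqnn N) j).2.
have LB := L2Z L (L2D (L2D (L2_cst P 1) LX) (L2_cst P (enorm u0))).
apply: (L2_le mD LB) => w; rewrite [leRHS]ger0_norm; last first.
  by rewrite mulr_ge0 ?(ltW L0)// !addr_ge0 ?sumnorm_ge0 ?enorm_ge0.
rewrite /costate eqxx mxE (le_trans (le_entry_enorm _ _ _))//.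
have [_ h2] := hL 0%N (Xs N w) u0 l0 w hN Uu0.
apply: le_trans (le_trans _ h2) _; first by rewrite lerDr addr_ge0 ?enorm_ge0.
by rewrite ler_wpM2l ?(ltW L0)// lerD2r lerD2l enorm_le_sumnorm.
Qed.

(** The derivatives of [b] and [sigma] are bounded, those of [f] grow linearly,
    and [p], [q] are in L2 by the preceding bound at the next time. *)
Lemma costate_L2_step k : (k.+1 < N)%N ->
  (forall i, L2 P (fun w => costate k.+2 w i 0)) ->
  forall i, L2 P (fun w => costate k.+1 w i 0).
Proof.
move=> kN LD i; have [L L0 hL] := hH2; have l0 := Ordinal hd.
have [zp [zq [hp hq hpq]]] := adjoint_versions kN LD.
have mD := costate_measurable i (ltnW kN).
have [Uu hX hu] := admissible_pair hd hFN hA3 hW hU0 hUconv hder x0 hH1 hH2 hP hustar kN.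
have LS a (Z : Omega -> 'cV[R]_a) : (forall i, L2 P (fun w => Z w i 0)) ->
    L2 P (fun w => sumnorm (Z w)).
  by move=> LZ; under eq_fun do rewrite sumnorm_cV; apply: L2_sum => j; exact: L2_norm.
have LX := LS _ _ (fun i => (hX i).2); have Lu := LS _ _ (fun i => (hu i).2).
have Lp : L2 P (fun w => \sum_j `|zp j w|).
  by apply: L2_sum => j; apply: L2_norm; have [] := hp j.
have Lq : L2 P (fun w => \sum_(l < d) \sum_j `|zq j l w|).
  by apply: L2_sum => l; apply: L2_sum => j; apply: L2_norm; have [] := hq j l.
have LB := L2Z L (L2D (L2D Lp Lq) (L2D (L2D (L2_cst P 1) LX) Lu)).
apply: (L2_le_ae mD LB); apply: filterS hpq => w [ep eq].
rewrite [leRHS]ger0_norm; last first.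
  rewrite mulr_ge0 ?(ltW L0)// !addr_ge0 ?sumnorm_ge0//; apply: sumr_ge0 => // l _.
  exact: sumr_ge0.
rewrite /costate (ltn_eqF kN) /adjoint_driver.
set x := Xs k.+1 w; set v := ustar k.+1 w.
have Uv : U k.+1 v by exact: Uu.
rewrite 2!mxE summxE mulrDr.
have ge := fun e e' (A : 'M[R]_(e, e')) => enorm_ge0 A.
have bK : enorm (b_x DC k.+1 x v w)^T <= L.
  rewrite /enorm exchange_big /=; under eq_bigr do under eq_bigr do rewrite mxE.
  have [h _] := hL k.+1 x v l0 w kN Uv; apply: le_trans h.
  by rewrite -!addrA lerDl !addr_ge0.
have sK l : enorm (sigma_x DC l k.+1 x v w)^T <= L.
  rewrite /enorm exchange_big /=; under eq_bigr do under eq_bigr do rewrite mxE.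
  have [h _] := hL k.+1 x v l w kN Uv; apply: le_trans h.
  by rewrite -addrA addrACA -addrA [X in _ <= X]addrC -!addrA lerDl !addr_ge0.
apply: (le_trans (ler_normD _ _)); apply: lerD.
  apply: (le_trans (ler_normD _ _)); rewrite mulrDr; apply: lerD.
    apply: (le_trans (le_sumnorm_mulmx _ _ _)).
    rewrite sumnorm_cV (eq_bigr (fun j => `|zp j w|)); last by move=> j _; rewrite ep.
    by rewrite ler_wpM2r// sumr_ge0.
  apply: (le_trans (ler_norm_sum _ _ _)); rewrite mulr_sumr; apply: ler_sum => l _.
  apply: (le_trans (le_sumnorm_mulmx _ _ _)).
  rewrite sumnorm_cV (eq_bigr (fun j => `|zq j l w|)); last by move=> j _; rewrite mxE eq.
  by rewrite ler_wpM2r// sumr_ge0.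
rewrite mxE (le_trans (le_entry_enorm _ _ _))//.
have [_ h2] := hL k.+1 x v l0 w kN Uv.
apply: le_trans (le_trans _ h2) _; first by rewrite -addrA lerDl addr_ge0.
by rewrite ler_wpM2l ?(ltW L0)// lerD ?enorm_le_sumnorm// lerD2l enorm_le_sumnorm.
Qed.

Lemma costate_L2 k : (k < N)%N -> forall i, L2 P (fun w => costate k.+1 w i 0).
Proof.
move=> kN; have [r eN] : exists r, N = (k.+1 + r)%N.
  by exists (N - k.+1)%N; rewrite subnKC.
elim: r k kN eN => [|r IH] k kN eN i.
  by have := costate_L2_terminal i; rewrite [in costate N]eN addn0.
have kN' : (k.+1 < N)%N by rewrite eN addnS ltnS leq_addr.
by apply: costate_L2_step => // j; apply: IH => //; rewrite eN addnS.
Qed.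

Section Comparison.
Hypothesis hHu : forall k (v : 'cV[R]_m), (k < N)%N -> U k v ->
  {ae P, forall w, 0 <= (Ham_u DC k (Xs k w) (ustar k w) (p k w) (q k w) w
                           *m (v - ustar k w)) 0 0}.
Hypothesis hHconv : forall k (p' : 'cV[R]_n) (q' : 'M[R]_(n, d)) (w : Omega),
  (k < N)%N ->
  convex_function
    ([set z | U k z.2] : set (convex_lmodType ('cV[R]_n * 'cV[R]_m)%type))
    (fun z => Ham C k z.1 z.2 p' q' w).
Hypothesis hphiconv : forall w : Omega,
  convex_function (setT : set (convex_lmodType 'cV[R]_n)) (fun x => varphi C x w).
Variable u : nat -> Omega -> 'cV[R]_m.
Hypothesis hu : admissible N F W U u.
Notation X := (state W C x0 u).

(** The variational inequality holds for all constant controls up to a null set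
    depending on the constant; a dense sequence of constants gives one null set
    for all of them, so that a random control can be substituted. *)
Lemma variational_ae k : (k < N)%N ->
  {ae P, forall w, 0 <= (Ham_u DC k (Xs k w) (ustar k w) (p k w) (q k w) w
                           *m (u k w - ustar k w)) 0 0}.
Proof.
move=> kN; have [z [Uz dz]] := dense_sequence (hU0 kN).
have : {ae P, forall w, forall i, 0 <=
    (Ham_u DC k (Xs k w) (ustar k w) (p k w) (q k w) w *m (z i - ustar k w)) 0 0}.
  by apply: ae_foralln => i; exact: hHu.
apply: filterS => w hz; have [Uu _] := hu kN.
set r := Ham_u _ _ _ _ _ _ _ in hz *.
apply/ler_addgt0Pr => e e0; pose K := enorm r + 1.
have K0 : 0 < K by rewrite ltr_wpDl ?enorm_ge0.
have [i hi] := dz (u k w) (e / K) (Uu w) ltac:(by rewrite divr_gt0).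
have -> : u k w - ustar k w = (z i - ustar k w) + (u k w - z i).
  by rewrite [RHS]addrC subrKA.
rewrite mulmxDr mxE -addrA addr_ge0// -lerBlDl sub0r.
rewrite (le_trans (ler_norm _))// normrN (le_trans (le_sumnorm_mulmx _ _ _))//.
apply: (@le_trans _ _ (K * (e / K))); last by rewrite mulrC divfK// gt_eqF.
apply: ler_pM; rewrite ?enorm_ge0 ?sumnorm_ge0//; last exact: ltW.
by rewrite /K lerDl.
Qed.

Definition variation (j : nat) (w : Omega) : R :=
  \sum_i costate j w i 0 * (X j w - Xs j w) i 0.

Definition delta_f (k : nat) (w : Omega) : R :=
  f C k (X k w) (u k w) w - f C k (Xs k w) (ustar k w) w.

Let db k w i := b C k (X k w) (u k w) w i 0 - b C k (Xs k w) (ustar k w) w i 0.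
Let ds k l w i :=
  sigma C l k (X k w) (u k w) w i 0 - sigma C l k (Xs k w) (ustar k w) w i 0.

Let pair_u k kN := admissible_pair hd hFN hA3 hW hU0 hUconv hder x0 hH1 hH2 hP (k := k) hu kN.
Let pair_s k kN := admissible_pair hd hFN hA3 hW hU0 hUconv hder x0 hH1 hH2 hP (k := k) hustar kN.

Lemma db_L2 k i : (k < N)%N ->
  gmeas (G k) (fun w => db k w i) /\ L2 P (fun w => db k w i).
Proof.
move=> kN.
have [m1 L1] := b_along hd hFN hU0 hUconv hder hH1 hH2 hP kN (pair_u kN) i.
have [m2 L2'] := b_along hd hFN hU0 hUconv hder hH1 hH2 hP kN (pair_s kN) i.
by split; [exact: measurable_funB|exact: L2B].
Qed.

Lemma ds_L2 k l i : (k < N)%N ->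
  gmeas (G k) (fun w => ds k l w i) /\ L2 P (fun w => ds k l w i).
Proof.
move=> kN.
have [m1 L1] := sigma_along hFN hU0 hUconv hder hH1 hH2 hP kN (pair_u kN) l i.
have [m2 L2'] := sigma_along hFN hU0 hUconv hder hH1 hH2 hP kN (pair_s kN) l i.
by split; [exact: measurable_funB|exact: L2B].
Qed.

Lemma delta_f_integrable k : (k < N)%N -> P.-integrable setT (EFin \o delta_f k).
Proof.
move=> kN; apply: integrableBr.
  exact: (f_along hd hFN hU0 hUconv hder hH1 hH2 hP kN (pair_u kN)).
exact: (f_along hd hFN hU0 hUconv hder hH1 hH2 hP kN (pair_s kN)).
Qed.

Lemma state_diff k w i : (X k.+1 w - Xs k.+1 w) i 0 =
  db k w i + \sum_(l < d) W k.+1 w l 0 * ds k l w i.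
Proof.
rewrite /= !(mxE, summxE) opprD addrACA; congr (_ + _).
rewrite -sumrB; apply: eq_bigr => l _.
by rewrite !mxE -mulrBr.
Qed.

Lemma variation_integrable j : (j <= N)%N -> P.-integrable setT (EFin \o variation j).
Proof.
case: j => [_|k kN].
  rewrite (_ : variation 0 = fun _ => 0); first by case: (L2_cst P 0); rewrite expr0n.
  by apply/funext => w; rewrite /variation /= big1// => i _; rewrite subrr mxE mulr0.
apply: integrable_sumr => i; apply: L2_mul; first exact: costate_L2.
have SA v (hv : admissible N F W U v) :=
  (state_adapted hd hFN hA3 hW hU0 hUconv hder x0 hH1 hH2 hP hv kN i).2.
have := L2B (SA _ hu) (SA _ hustar).
by congr L2; apply/funext => w; rewrite !mxE.
Qed.

(** One step of the backward duality: conditioning on [F_k] replaces the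
    costate at [k.+1] by the adjoint pair at [k], and convexity of the
    Hamiltonian together with the variational inequality bounds the resulting
    increment from below by the costate at [k]. *)
Lemma variation_step k : (k < N)%N ->
  \int[P]_w variation k w <= \int[P]_w variation k.+1 w + \int[P]_w delta_f k w.
Proof.
move=> kN; have LD := costate_L2 kN.
have [zp [zq [hp hq hpq]]] := adjoint_versions kN LD.
pose Y w := \sum_i (db k w i * zp i w) + \sum_(l < d) \sum_i (ds k l w i * zq i l w).
have ip i : P.-integrable setT (EFin \o (fun w => db k w i * costate k.+1 w i 0)).
  by apply: L2_mul; [case: (db_L2 i kN)|exact: LD].
have iq i l : P.-integrable setT
    (EFin \o (fun w => ds k l w i * (costate k.+1 w i 0 * W k.+1 w l 0))).
  have [c c0 hc] := noise_second_moment hFN hP hA3 hW l kN.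
  have [ms Ls] := ds_L2 l i kN; have [LsW _] := hc _ ms Ls.
  have := L2_mul LsW (LD i); apply: eq_integrable => // w _ /=.
  by rewrite mulrAC mulrA.
have izp i : P.-integrable setT (EFin \o (fun w => db k w i * zp i w)).
  by apply: L2_mul; [case: (db_L2 i kN)|case: (hp i)].
have izq i l : P.-integrable setT (EFin \o (fun w => ds k l w i * zq i l w)).
  by apply: L2_mul; [case: (ds_L2 l i kN)|case: (hq i l)].
have iY1 := integrable_sumr (index_enum _) izp.
have iY2 := integrable_sumr (index_enum _) (fun l => integrable_sumr (index_enum _) (izq^~ l)).
have iY : P.-integrable setT (EFin \o Y) := integrableDr iY1 iY2.
have -> : \int[P]_w variation k.+1 w = \int[P]_w Y w.
  pose V w := \sum_i (db k w i * costate k.+1 w i 0) +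
     \sum_(l < d) \sum_i (ds k l w i * (costate k.+1 w i 0 * W k.+1 w l 0)).
  have iV1 := integrable_sumr (index_enum _) ip.
  have iV2 := integrable_sumr (index_enum _) (fun l => integrable_sumr (index_enum _) (iq^~ l)).
  transitivity (\int[P]_w V w).
    apply: eq_Rintegral => w _; rewrite /V /variation exchange_big -big_split/=.
    apply: eq_bigr => i _; rewrite state_diff mulrDr mulrC; congr (_ + _).
    by rewrite mulr_sumr; apply: eq_bigr => l _; ring.
  rewrite /V /Y !RintegralD//; congr (_ + _).
    rewrite !Rintegral_sumr//; apply: eq_bigr => i _.
    have [cp _] := hp i; have [m1 _] := db_L2 i kN.
    by rewrite (condexp_mul (@sG k) (@mG k) cp m1 (ip i)).
  have iqs l := integrable_sumr (index_enum _) (iq^~ l).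
  have izqs l := integrable_sumr (index_enum _) (izq^~ l).
  rewrite !Rintegral_sumr//; apply: eq_bigr => l _.
  rewrite !Rintegral_sumr//; apply: eq_bigr => i _.
  have [cq _] := hq i l; have [m1 _] := ds_L2 l i kN.
  by rewrite (condexp_mul (@sG k) (@mG k) cq m1 (iq i l)).
have idf := delta_f_integrable kN.
rewrite -RintegralD//; apply: le_Rintegral_ae.
- exact: variation_integrable (ltnW kN).
- exact: integrableDr.
apply: filterS2 hpq (variational_ae kN) => w [ep eq] hv.
have [Us _] := hustar kN; have [Uu _] := hu kN.
have := Ham_tangent hUconv hder (Xs k w) (X k w) kN (Us w) (Uu w) (hHconv (p k w) (q k w) w kN).
have -> : \sum_i Ham_x DC k (Xs k w) (ustar k w) (p k w) (q k w) w i 0 *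
    (X k w - Xs k w) i 0 = variation k w.
  by rewrite /variation /costate (ltn_eqF kN).
have -> : Ham C k (X k w) (u k w) (p k w) (q k w) w -
    Ham C k (Xs k w) (ustar k w) (p k w) (q k w) w = Y w + delta_f k w.
  have mxD (A B : 'M[R]_1) : (A + B) 0 0 = A 0 0 + B 0 0 by rewrite mxE.
  rewrite /Ham !mxD !summxE !dotE /Y /delta_f.
  have -> : \sum_i db k w i * zp i w =
      \sum_i p k w i 0 * b C k (X k w) (u k w) w i 0 -
      \sum_i p k w i 0 * b C k (Xs k w) (ustar k w) w i 0.
    by rewrite -sumrB; apply: eq_bigr => i _; rewrite ep /db; ring.
  have -> : \sum_(l < d) \sum_i ds k l w i * zq i l w =
      \sum_(l < d) ((col l (q k w))^T *m sigma C l k (X k w) (u k w) w) 0 0 -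
      \sum_(l < d) ((col l (q k w))^T *m sigma C l k (Xs k w) (ustar k w) w) 0 0.
    rewrite -sumrB; apply: eq_bigr => l _; rewrite !dotE -sumrB.
    by apply: eq_bigr => i _; rewrite mxE eq /ds; ring.
  ring.
by apply: le_trans; rewrite lerDl.
Qed.

(** Both states start from [x0], so the variation vanishes at time [0]. *)
Lemma variation_sum_ge0 j : (j <= N)%N ->
  0 <= \int[P]_w variation j w + \sum_(k < j) \int[P]_w delta_f k w.
Proof.
elim: j => [_|k IH kN].
  rewrite big_ord0 addr0 (_ : variation 0 = fun _ => 0) ?Rintegral_cst_proba//.
  by apply/funext => w; rewrite /variation /= big1// => i _; rewrite subrr mxE mulr0.
apply: le_trans (IH (ltnW kN)) _; rewrite big_ord_recr/= addrA [leRHS]addrAC.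
by rewrite lerD2r variation_step.
Qed.

Lemma cost_integrable v : admissible N F W U v ->
  P.-integrable setT (EFin \o total_cost N W C x0 v).
Proof.
move=> hv; have pair k kN :=
  admissible_pair hd hFN hA3 hW hU0 hUconv hder x0 hH1 hH2 hP (k := k) hv kN.
apply: integrableDr.
  apply: integrable_sumr => k.
  exact: (f_along hd hFN hU0 hUconv hder hH1 hH2 hP (ltn_ord k) (pair k (ltn_ord k))).
apply: (varphi_along hd hFN hU0 hder hH1 hH2 hP hN) => i.
exact: (state_adapted hd hFN hA3 hW hU0 hUconv hder x0 hH1 hH2 hP hv (leqnn N) i).
Qed.

Lemma cost_le : ('E_P[total_cost N W C x0 ustar] <= 'E_P[total_cost N W C x0 u])%E.
Proof.
have is_ := cost_integrable hustar; have iu := cost_integrable hu.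
suff : 0 <= \int[P]_w (total_cost N W C x0 u w - total_cost N W C x0 ustar w).
  rewrite RintegralB// subr_ge0 -lee_fin /Rintegral !fineK; try exact: integrable_fin_num.
  by rewrite !unlock.
have idf : P.-integrable setT (EFin \o (fun w => \sum_(k < N) delta_f k w)).
  by apply: integrable_sumr => k; exact: delta_f_integrable.
have ivar := variation_integrable (leqnn N).
apply: le_trans (variation_sum_ge0 (leqnn N)) _.
rewrite -Rintegral_sumr; last by move=> k; exact: delta_f_integrable.
rewrite -RintegralD//; apply: le_Rintegral => //; [exact: integrableDr|exact: integrableBr|].
move=> w _; rewrite /total_cost opprD addrACA -sumrB [leLHS]addrC.
rewrite lerD//.
have := varphi_tangent hder (Xs N w) (X N w) (hphiconv w).
by rewrite /variation /costate eqxx.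
Qed.

End Comparison.

End Verification.

Theorem theorem4p8 (R : realType) (disp : measure_display)
    (Omega : measurableType disp) (N d n m : nat) (hN : (0 < N)%N)
    (hd : (0 < d)%N) (Theta : Type)
    (F : Theta -> probability (borel 'cV[R]_d) R)
    (W : nat -> Omega -> 'cV[R]_d)
    (hFN : (@measurable _ Omega : set (set Omega)) = Fsig W N)
    (hA1 : assumption_A1 N F W) (hA2 : assumption_A2 F)
    (hA3 : assumption_A3 N F W)
    (hW : forall k, (1 <= k <= N)%N -> Lc_mx N F W 2 k (W k))
    (U : nat -> set 'cV[R]_m)
    (hU0 : forall k, (k < N)%N -> U k !=set0)
    (hUconv : forall k, (k < N)%N -> convex_set (U k))
    (C : coefficients R Omega n m d) (DC : derivatives R Omega n m d)
    (hder : is_derivatives N U C DC) (x0 : 'cV[R]_n)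
    (hH1 : assumption_H1 N F W U C) (hH2 : assumption_H2 N U DC)
    (hH3 : assumption_H3 N U DC)
    (ustar : nat -> Omega -> 'cV[R]_m)
    (hustar : admissible N F W U ustar)
    (Pstar : probability Omega R)
    (hPstar : Pstar_set N F W C x0 ustar Pstar)
    (p : nat -> Omega -> 'cV[R]_n) (q : nat -> Omega -> 'M[R]_(n, d))
    (hadj : adjoint_solution N W C DC x0 Pstar ustar p q)
    (hHu : forall k (u : 'cV[R]_m), (k < N)%N -> U k u ->
       {ae Pstar, forall w,
          0 <= (Ham_u DC k (state W C x0 ustar k w) (ustar k w) (p k w) (q k w) w
                  *m (u - ustar k w)) 0 0})
    (hHconv : forall k (p' : 'cV[R]_n) (q' : 'M[R]_(n, d)) (w : Omega),
       (k < N)%N ->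
       convex_function
         ([set z | U k z.2] : set (convex_lmodType ('cV[R]_n * 'cV[R]_m)%type))
         (fun z => Ham C k z.1 z.2 p' q' w))
    (hphiconv : forall w : Omega,
       convex_function (setT : set (convex_lmodType 'cV[R]_n))
         (fun x => varphi C x w)) :
  optimal N F W U C x0 ustar.
Proof.
split=> // u hu; case: hPstar => hP <-.
apply: (@le_trans _ _ ('E_Pstar[total_cost N W C x0 u])%E); last first.
  by apply: ereal_sup_ubound; exists Pstar.
exact: (cost_le hN hd hFN hA3 hW hU0 hUconv hder hH1 hH2 hustar hP hadj hHu
          hHconv hphiconv hu).
Qed.
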